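(* For every set $E$ of finite $\mathcal{L}^\alpha$-perimeter in $\mathbb{R}_+^d$, there exists a function $u\in L^1(\mathbb{R}_+^d,d\mu_\alpha)$ such that $$\mathscr{F}_{u,\mathcal{L}^\alpha}(E)\le\mathscr{F}_{u,\mathcal{L}^\alpha}(F)$$ holds for every set $F$ of finite $\mathcal{L}^\alpha$-perimeter in $\Omega_1$.
   Context: Let $d\ge3$, $\alpha=(\alpha_1,\dots,\alpha_d)\in(-1,\infty)^d$, $\mathbb{R}_+^d=(0,\infty)^d$, let $\Omega\subset\mathbb{R}_+^d$ be an open set, and let $\Omega_1=\Omega\setminus\{x\in\mathbb{R}_+^d:\ \exists\, i\in\{1,\dots,d\}\text{ such that }\sqrt{x_i}<1\}$, assumed open. The measure $\mu_\alpha$ on $\mathbb{R}_+^d$ is $d\mu_\alpha(x)=\omega(x)\,dx$ with $\omega(x)=\prod_{i=1}^d \frac{x_i^{\alpha_i}e^{-x_i}}{\Gamma(\alpha_i+1)}$. Put $\delta_i^*=-\sqrt{x_i}\Big(\frac{\partial}{\partial x_i}+\frac{\alpha_i+\frac12-x_i}{x_i}\Big)$ and $\mathrm{div}_{\mathcal{L}^\alpha}\varphi=\sum_{i=1}^d\delta_i^*\varphi_i$ for $C^1$ vector fields $\varphi=(\varphi_1,\dots,\varphi_d)$. For an open set $U\subset\mathbb{R}_+^d$, let $\mathcal{F}(U)$ be the set of all $\varphi\in C_c^1(U,\mathbb{R}^d)$ with $\sup_{x\in U}(|\varphi_1(x)|^2+\dots+|\varphi_d(x)|^2)^{1/2}\le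 1$. The $\mathcal{L}^\alpha$-perimeter of a (measurable) set $E$ in $U$ is $P_{\mathcal{L}^\alpha}(E,U)=\sup_{\varphi\in\mathcal{F}(U)}\int_E\mathrm{div}_{\mathcal{L}^\alpha}\varphi\,d\mu_\alpha$. A set $E$ is of finite $\mathcal{L}^\alpha$-perimeter in $U$ if $E\subset U$ and $P_{\mathcal{L}^\alpha}(E,U)<\infty$ (here with $U=\mathbb{R}_+^d$ or $U=\Omega_1$). For an integrable function $u$ (with respect to $\mu_\alpha$) and a set $E$ of finite $\mathcal{L}^\alpha$-perimeter, the Massari type functional is $\mathscr{F}_{u,\mathcal{L}^\alpha}(E)=P_{\mathcal{L}^\alpha}(E,\Omega_1)+\int_E u(x)\,d\mu_\alpha(x)$. *)

(* Defs.v *)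
From HB Require Import structures.
From mathcomp Require Import all_boot all_order all_algebra.
From mathcomp Require Import all_classical all_reals all_analysis.
From mathcomp Require Import measurable_realfun.

Set Implicit Arguments.
Unset Strict Implicit.
Unset Printing Implicit Defensive.

Import Order.TTheory GRing.Theory Num.Theory.
Import numFieldNormedType.Exports.

Local Open Scope classical_set_scope.
Local Open Scope ring_scope.

(* The Borel sigma-algebra of R^n, generated by the n coordinates. *)
Definition rV_display : measure_display. Proof. exact. Qed.

Section measurable_rV.
Context {R : realType} (n : nat).

Let coord (i : 'I_n) (x : 'rV[R]_n) : measurableTypeR R := x ord0 i.

Let rV_set0 : g_sigma_preimage coord set0.
Proof. exact: sigma_algebra0. Qed.

Let rV_setC A : g_sigma_preimage coord A -> g_sigma_preimage coord (~` A).
Proof. exact: sigma_algebraC. Qed.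

Let rV_bigcup (F : _^nat) : (forall i, g_sigma_preimage coord (F i)) ->
  g_sigma_preimage coord (\bigcup_i (F i)).
Proof. exact: sigma_algebra_bigcup. Qed.

HB.instance Definition _ := @isMeasurable.Build rV_display
  'rV[R]_n (g_sigma_preimage coord) rV_set0 rV_setC rV_bigcup.

Lemma measurable_coord (i : 'I_n) :
  measurable_fun [set: 'rV[R]_n] (fun x => x ord0 i : measurableTypeR R).
Proof.
move=> _ Y mY; rewrite setTI; apply: sub_sigma_algebra => /=.
rewrite -bigcup_seq/=; exists i => /=; first by rewrite mem_index_enum.
by exists Y => //; rewrite setTI.
Qed.

Lemma measurable_fun_rV d (T : measurableType d) (f : T -> 'rV[R]_n) :
  (forall i, measurable_fun [set: T] (fun t => f t ord0 i : measurableTypeR R)) ->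
  measurable_fun [set: T] f.
Proof.
move=> mf _ A mA; rewrite setTI.
suff : g_sigma_preimage (fun i => coord i \o f) `<=` measurable.
  by rewrite g_sigma_preimage_comp; apply; exists A => //; rewrite setTI.
apply: smallest_sub; first exact: sigma_algebra_measurable.
rewrite -bigcup_seq => B [i _ [C mC <-]].
exact: mf.
Qed.

End measurable_rV.

Section lebesgue_rV.
Context {R : realType}.

Definition rV_cons n (p : measurableTypeR R * 'rV[R]_n) : 'rV[R]_n.+1 :=
  \row_i (if unlift ord0 i is Some j then p.2 ord0 j else p.1).

Definition rV_behead n (x : 'rV[R]_n.+1) : 'rV[R]_n :=
  \row_i x ord0 (lift ord0 i).

Lemma rV_cons0 n (p : measurableTypeR R * 'rV[R]_n) :
  rV_cons p ord0 ord0 = p.1.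
Proof. by rewrite mxE unlift_none. Qed.

Lemma rV_consS n (p : measurableTypeR R * 'rV[R]_n) i :
  rV_cons p ord0 (lift ord0 i) = p.2 ord0 i.
Proof. by rewrite mxE liftK. Qed.

Lemma rV_consK n (p : measurableTypeR R * 'rV[R]_n) :
  rV_behead (rV_cons p) = p.2.
Proof. by apply/rowP => i; rewrite mxE rV_consS. Qed.

Lemma measurable_rV_cons n : measurable_fun setT (@rV_cons n).
Proof.
apply: measurable_fun_rV => i.
have [j|] := unliftP ord0 i => ->.
  under [X in measurable_fun _ X]eq_fun do rewrite rV_consS.
  exact: (measurableT_comp (measurable_coord j) measurable_snd).
under [X in measurable_fun _ X]eq_fun do rewrite rV_cons0.
exact: measurable_fst.
Qed.

Lemma measurable_rV_behead n : measurable_fun setT (@rV_behead n).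
Proof.
apply: measurable_fun_rV => i.
under [X in measurable_fun _ X]eq_fun do rewrite mxE.
exact: measurable_coord.
Qed.

Section lebesgue_rV_succ.
Variables (n : nat) (m : {sigma_finite_measure set 'rV[R]_n -> \bar R}).

Definition lebesgue_rV_succ : set 'rV[R]_n.+1 -> \bar R :=
  pushforward (@lebesgue_measure R \x m)%E (@rV_cons n).

Let succ0 : lebesgue_rV_succ set0 = 0%E.
Proof. by rewrite /lebesgue_rV_succ /pushforward preimage_set0 measure0. Qed.

Let succ_ge0 A : (0 <= lebesgue_rV_succ A)%E.
Proof. by rewrite /lebesgue_rV_succ /pushforward measure_ge0. Qed.

Let succ_sigma_additive : semi_sigma_additive lebesgue_rV_succ.
Proof.
move=> F mF tF mUF; rewrite /lebesgue_rV_succ /pushforward preimage_bigcup.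
apply: measure_semi_sigma_additive.
- move=> k; rewrite -[X in measurable X]setTI.
  exact: (measurable_rV_cons measurableT (mF k)).
- apply/trivIsetP => /= i j _ _ ij; rewrite -preimage_setI.
  by move/trivIsetP : tF => /(_ _ _ _ _ ij) ->//; rewrite preimage_set0.
- rewrite -preimage_bigcup -[X in measurable X]setTI.
  exact: (measurable_rV_cons measurableT mUF).
Qed.

HB.instance Definition _ := isMeasure.Build _ _ _
  lebesgue_rV_succ succ0 succ_ge0 succ_sigma_additive.

Let succ_sigma_finite : sigma_finite setT lebesgue_rV_succ.
Proof.
have /sigma_finiteP[F [TF ndF Foo]] := sigma_finiteT (@lebesgue_measure R).
have /sigma_finiteP[G [TG ndG Goo]] := sigma_finiteT m.
exists (fun k => [set x : 'rV[R]_n.+1 | F k (x ord0 ord0) /\ G k (rV_behead x)]).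
  apply/esym; rewrite -subTset => x _.
  have [i _ Fix] : (\bigcup_k F k) (x ord0 ord0) by rewrite -TF.
  have [j _ Gjx] : (\bigcup_k G k) (rV_behead x) by rewrite -TG.
  exists (maxn i j) => //; split.
    by move: Fix; exact/subsetPset/ndF/leq_maxl.
  by move: Gjx; exact/subsetPset/ndG/leq_maxr.
move=> k; have [mF Fkoo] := Foo k; have [mG Gkoo] := Goo k; split.
  apply: measurableI; rewrite -[X in measurable X]setTI.
    exact: (measurable_coord ord0 measurableT mF).
  exact: (measurable_rV_behead measurableT mG).
rewrite /lebesgue_rV_succ /pushforward (_ : _ @^-1` _ = F k `*` G k).
  by rewrite product_measure1E// lte_mul_pinfty// ge0_fin_numE.
by apply/seteqP; split=> -[x y] /=; rewrite rV_cons0 rV_consK.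
Qed.

HB.instance Definition _ := Measure_isSigmaFinite.Build _ _ _
  lebesgue_rV_succ succ_sigma_finite.

End lebesgue_rV_succ.

(* The n-fold product of the Lebesgue measure of R, on Borel sets. *)
Fixpoint borel_lebesgue_rV n : {sigma_finite_measure set 'rV[R]_n -> \bar R} :=
  match n with
  | 0 => \d_(0 : 'rV[R]_0)
  | n'.+1 => lebesgue_rV_succ (borel_lebesgue_rV n')
  end.

Lemma borel_lebesgue_rV_box n (A : 'I_n -> set R) :
  (forall i, measurable (A i : set (measurableTypeR R))) ->
  (borel_lebesgue_rV n [set x | forall i, A i (x ord0 i)] =
   \prod_(i < n) lebesgue_measure (A i))%E.
Proof.
elim: n A => [|n IH] A mA.
  by rewrite big_ord0 /= diracE mem_set// => -[].
rewrite big_ord_recl -IH//= -product_measure1E//; last first.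
  rewrite [X in measurable X](_ : _ =
      \bigcap_(i in [set: 'I_n])
        ((fun x : 'rV[R]_n => x ord0 i : measurableTypeR R) @^-1`
          A (lift ord0 i))).
    apply: fin_bigcap_measurable => [|i _]; first exact: finite_finset.
    by rewrite -[X in measurable X]setTI; exact: measurable_coord.
  by apply/seteqP; split=> x /= xA i; [move=> _|]; exact: xA.
congr ((_ \x _)%E _); apply/seteqP; split=> -[x y] /=.
  move=> xyA; split; first by have := xyA ord0; rewrite rV_cons0.
  by move=> i; have := xyA (lift ord0 i); rewrite rV_consS.
move=> [xA yA] i; have [j|] := unliftP ord0 i => ->.
  by rewrite rV_consS.
by rewrite rV_cons0.
Qed.

(* The Lebesgue sigma-algebra and the Lebesgue measure of R^n: the completion
   of the product measure above. *)
Definition lebesgue_type n := caratheodory_type (borel_lebesgue_rV n)^*%mu.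

HB.instance Definition _ n := Measurable.on (lebesgue_type n).

Definition lebesgue_rV n : set (lebesgue_type n) -> \bar R :=
  @completed_measure_extension _ _ _ (borel_lebesgue_rV n).

HB.instance Definition _ n := Measure.on (@lebesgue_rV n).

Lemma borel_lebesgue_measurable n (A : set 'rV[R]_n) :
  measurable A -> measurable (A : set (lebesgue_type n)).
Proof. exact: caratheodory_measurable_mu_ext. Qed.

Lemma measurable_coord_lebesgue n (i : 'I_n) :
  measurable_fun [set: lebesgue_type n]
    (fun x : 'rV[R]_n => x ord0 i : measurableTypeR R).
Proof.
move=> _ Y mY; rewrite setTI; apply: borel_lebesgue_measurable.
by rewrite -[X in measurable X]setTI; exact: measurable_coord.
Qed.

End lebesgue_rV.
Arguments lebesgue_type R n : clear implicits.
Arguments lebesgue_rV R n : clear implicits.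

Section laguerre.
Context {R : realType} {d : nat}.
Implicit Types (alpha : 'I_d -> R) (U E Omega : set 'rV[R]_d).
Implicit Types (x : 'rV[R]_d) (phi : 'rV[R]_d -> 'rV[R]_d).

Definition Gamma (s : R) : R :=
  \int[lebesgue_measure]_(t in `]0, +oo[) (t `^ (s - 1) * expR (- t)).

Definition orthant : set 'rV[R]_d := [set x | forall i, 0 < x ord0 i].

Definition omega alpha x : R :=
  \prod_(i < d) (x ord0 i `^ alpha i * expR (- x ord0 i) / Gamma (alpha i + 1)).

(* mu_alpha is extended by zero outside of the positive orthant. *)
Definition mu_ alpha : set (lebesgue_type R d) -> \bar R := fun A =>
  (\int[lebesgue_rV R d]_(x in A `&` orthant) (omega alpha x)%:E)%E.

Lemma measurable_orthant : measurable (orthant : set (lebesgue_type R d)).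
Proof.
rewrite (_ : orthant = \bigcap_(i in [set: 'I_d])
    ((fun x : 'rV[R]_d => x ord0 i : measurableTypeR R) @^-1` `]0, +oo[)).
  apply: fin_bigcap_measurable => [|i _]; first exact: finite_finset.
  rewrite -[X in measurable X]setTI.
  exact: (measurable_coord_lebesgue i).
apply/seteqP; split=> x xA i.
  by move=> _ /=; rewrite in_itv/= andbT.
by have /= := xA i I; rewrite in_itv/= andbT.
Qed.

Lemma measurable_omega alpha :
  measurable_fun [set: lebesgue_type R d] (omega alpha).
Proof.
apply: measurable_prod => i _; apply: measurable_funM => //.
apply: measurable_funM.
  exact: (measurableT_comp (measurable_powR _) (measurable_coord_lebesgue i)).
apply: measurableT_comp => //; apply: measurableT_comp => //.
exact: (measurable_coord_lebesgue i).
Qed.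

Lemma omega_ge0 alpha x : 0 <= omega alpha x.
Proof.
apply: prodr_ge0 => i _; rewrite divr_ge0// ?mulr_ge0 ?powR_ge0 ?expR_ge0//.
by apply: Rintegral_ge0 => t _; rewrite mulr_ge0 ?powR_ge0 ?expR_ge0.
Qed.

Section mu_measure.
Variable alpha : 'I_d -> R.
Local Open Scope ereal_scope.

Let mu0 : mu_ alpha set0 = 0.
Proof. by rewrite /mu_ set0I integral_set0. Qed.

Let mu_ge0 A : 0 <= mu_ alpha A.
Proof. by apply: integral_ge0 => x _; rewrite lee_fin omega_ge0. Qed.

Let mu_sigma_additive : semi_sigma_additive (mu_ alpha).
Proof.
have -> : mu_ alpha = (fun A => \int[lebesgue_rV R d]_(x in A)
    ((fun x => (omega alpha x)%:E) \_ orthant) x).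
  by apply/funext => A; rewrite -integral_mkcondr.
apply: semi_sigma_additive_nng_induced.
  apply/(measurable_restrictT _ measurable_orthant).
  apply: measurable_funTS; apply/measurable_EFinP; exact: measurable_omega.
by move=> x; apply: erestrict_ge0 => y _; rewrite lee_fin omega_ge0.
Qed.

HB.instance Definition _ := isMeasure.Build _ _ _
  (mu_ alpha) mu0 mu_ge0 mu_sigma_additive.

End mu_measure.

Definition delta_star alpha (i : 'I_d) (f : 'rV[R]_d -> R) x : R :=
  - Num.sqrt (x ord0 i) *
    ('D_(delta_mx ord0 i) f x
     + (alpha i + 2^-1 - x ord0 i) / x ord0 i * f x).

Definition laguerre_div alpha phi x : R :=
  \sum_(i < d) delta_star alpha i (fun y => phi y ord0 i) x.

(* C_c^1(U, R^d): each field is extended by zero to the whole of R^d. *)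
Definition C1c U : set ('rV[R]_d -> 'rV[R]_d) := [set phi |
  [/\ forall x, U x -> differentiable phi x,
      forall x, U x -> {for x, continuous (jacobian phi)},
      compact (closure [set x | phi x != 0]) &
      closure [set x | phi x != 0] `<=` U]].

Definition euclidean_norm x : R := Num.sqrt (\sum_(i < d) `|x ord0 i| ^+ 2).

Definition test_fields U : set ('rV[R]_d -> 'rV[R]_d) := [set phi |
  C1c U phi /\
  (ereal_sup [set (euclidean_norm (phi x))%:E | x in U] <= 1)%E].

Definition perimeter alpha E U : \bar R :=
  ereal_sup [set (\int[mu_ alpha]_(x in E) (laguerre_div alpha phi x)%:E)%E
            | phi in test_fields U].

Definition finite_perimeter alpha E U : Prop :=
  [/\ measurable (E : set (lebesgue_type R d)), E `<=` U &
      (perimeter alpha E U < +oo)%E].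

Definition Omega1 Omega : set 'rV[R]_d :=
  Omega `\` [set x | orthant x /\ exists i, Num.sqrt (x ord0 i) < 1].

Definition massari alpha Omega (u : 'rV[R]_d -> R) E : \bar R :=
  (perimeter alpha E (Omega1 Omega) + \int[mu_ alpha]_(x in E) (u x)%:E)%E.

End laguerre.

(* Main.v *)
(* Write [U] for [Omega1 Omega] and [K] for the set of the Laguerre divergences
   of the test fields on [U], a convex set of bounded functions. It suffices to
   find [z] in L1(mu) which calibrates [E]: the integral of [z] over any
   measurable [F] is at most P(F, U), with equality for [F = E]. Then [u = - z]
   makes the functional vanish at [E] and nonnegative everywhere.

   Let [s_k] be the L2(mu)-projection of [k 1_E] on the closure of [K] (the dual
   form of total variation denoising). Because the total variation, i.e. the
   support function of [K], is submodular, [f <= f'] implies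
   [f - s_f <= f' - s_f'] almost everywhere; comparing the data [k 1_E],
   [(k + 1) 1_E] and [k 1_E + 1] shows that [s_k] increases on [E] and decreases
   off [E]. Elements of [K] have mean zero, so the L1 norms of the increments are
   twice the increments of the integrals over [E] of [s_k], which are bounded by
   P(E, U) and converge to it. Hence [s_k] converges in L1(mu), and [z] is its
   limit.

   Submodularity is proved for smooth fields: with [w] a mollification of
   [h1 - h2], two test fields [phi] and [psi] are exchanged with the weight
   [eta(w)], and the integral of [w div (eta(w) xi)] is that of [ramp(w) div xi],
   where [eta] is the derivative of [ramp]. In the flux coordinates
   [sqrt x_i omega(x) phi_i(x)] the Laguerre divergence becomes the Euclidean
   one, which commutes with convolution. *)
From HB Require Import structures.
Require Import Defs.
From mathcomp Require Import all_boot all_order all_algebra.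
From mathcomp Require Import all_classical all_reals all_analysis.
From mathcomp Require Import measurable_realfun ring lra.

Set Implicit Arguments.
Unset Strict Implicit.
Unset Printing Implicit Defensive.

Import Order.TTheory GRing.Theory Num.Theory.
Import numFieldNormedType.Exports.

Local Open Scope classical_set_scope.
Local Open Scope ring_scope.


(** A maximizing sequence for P(E, U) has no L1 compactness: the constraint bounds the fields, not
    their divergences. The order between successive projections replaces compactness. Submodularity
    is wanted for the minimum [h1 - w^+] and the maximum [h2 + w^+], where [w = h1 - h2]. The weight
    that exchanges two fields would then be the indicator of [0 < w], which is not C^1; so [w^+] is
    replaced by [ramp w], and the comparison of projections uses only its sign and a linear bound.
    As [w] is merely square-integrable, it must be mollified too, and the fields to be compared then
    depend on the scale [e]: estimates for mollified fields have to be uniform over all fields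
    supported in a given compact set. Finally, mollifying in flux coordinates distorts the norm
    constraint, whose coefficients vary with the point; uniform continuity of their logarithms
    limits the loss to a factor [1 + t], with [t] arbitrarily small. *)

(** * Integrable and square-integrable real functions *)

Lemma fct_scalerAl (T : Type) (R : realType) (k : R) (f g : T -> R) :
  (k *: f) * g = k *: (f * g).
Proof. by apply/funext => x; rewrite !fctE -[_ *: f x]/(k * f x) -mulrA. Qed.

Lemma fct_scalerAr (T : Type) (R : realType) (k : R) (f g : T -> R) :
  f * (k *: g) = k *: (f * g).
Proof. by rewrite mulrC fct_scalerAl mulrC. Qed.

Section L1.
Context d {T : measurableType d} {R : realType} (nu : {measure set T -> \bar R}).
Implicit Types f g h : T -> R.

Definition intg f := nu.-integrable [set: T] (EFin \o f).

Lemma intg_measurable f : intg f -> measurable_fun [set: T] f.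
Proof. by move=> /measurable_int/measurable_EFinP. Qed.

Lemma intgD f g : intg f -> intg g -> intg (f + g).
Proof.
by move=> If Ig; rewrite /intg (_ : EFin \o _ = (EFin \o f) \+ (EFin \o g))%E //;
  apply: integrableD.
Qed.

Lemma intgZ k f : intg f -> intg (k *: f).
Proof.
by move=> If; rewrite /intg (_ : EFin \o _ = (fun x => k%:E * (EFin \o f) x)%E) //;
  apply: integrableZl.
Qed.

Lemma intgN f : intg f -> intg (- f).
Proof. by move=> If; rewrite -scaleN1r; apply: intgZ. Qed.

Lemma intgB f g : intg f -> intg g -> intg (f - g).
Proof. by move=> If Ig; apply: intgD => //; apply: intgN. Qed.

Lemma intg0 : intg 0.
Proof. exact: integrable0. Qed.

Lemma le_intg f g : measurable_fun [set: T] f -> (forall x, `|f x| <= g x) ->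
  intg g -> intg f.
Proof.
move=> mf fg; apply: le_integrable => //; first exact/measurable_EFinP.
by move=> x _ /=; rewrite lee_fin (le_trans (fg x))// ler_norm.
Qed.

Lemma intg_abs f : intg f -> intg (fun x => `|f x|).
Proof.
move=> If; apply: (@le_intg _ (fun x => `|f x|)).
- exact/measurableT_comp/intg_measurable.
- by move=> x; rewrite normr_id.
- by move: If => /integrable_abse; apply: eq_integrable.
Qed.

Lemma intg_bdM f g (c : R) : measurable_fun [set: T] g -> (forall x, `|g x| <= c) ->
  intg f -> intg (f * g).
Proof.
move=> mg gc If; apply: (@le_intg _ (fun x => c * `|f x|)).
- by apply: measurable_funM => //; exact: intg_measurable.
- by move=> x; rewrite normrM mulrC ler_wpM2r.
- exact/intgZ/intg_abs.
Qed.

Lemma intg_indic f E : measurable E -> intg f -> intg (f * \1_E).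
Proof.
move=> mE If; apply: (@intg_bdM _ _ 1) => // x.
by rewrite indicE; case: (_ \in _); rewrite ?normr0 ?normr1.
Qed.

Lemma Rintegral_indic f E : \int[nu]_(x in E) f x = \int[nu]_x (f * \1_E) x.
Proof.
rewrite Rintegral_mkcond; apply: eq_Rintegral => x _.
by rewrite patchE /= fctE indicE; case: ifP => _; rewrite ?mulr1 ?mulr0.
Qed.

Lemma IntD f g : intg f -> intg g ->
  \int[nu]_x (f + g) x = \int[nu]_x f x + \int[nu]_x g x.
Proof. by move=> If Ig; rewrite -RintegralD. Qed.

Lemma IntB f g : intg f -> intg g ->
  \int[nu]_x (f - g) x = \int[nu]_x f x - \int[nu]_x g x.
Proof. by move=> If Ig; rewrite -RintegralB. Qed.

Lemma IntZ k f : intg f -> \int[nu]_x (k *: f) x = k * \int[nu]_x f x.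
Proof. by move=> If; rewrite -RintegralZl. Qed.

Lemma le_Int f g : intg f -> intg g -> (forall x, f x <= g x) ->
  \int[nu]_x f x <= \int[nu]_x g x.
Proof. by move=> If Ig fg; apply: le_Rintegral. Qed.

Lemma Int_EFin f : intg f -> (\int[nu]_x (f x)%:E = (\int[nu]_x f x)%R%:E)%E.
Proof. by move=> If; rewrite fineK//; apply: integrable_fin_num. Qed.

Lemma Int_abs_le f g : intg f -> intg g -> (forall x, `|f x| <= g x) ->
  `|\int[nu]_x f x| <= \int[nu]_x g x.
Proof.
move=> If Ig fg; rewrite (le_trans (le_normr_Rintegral _ _))//.
by apply: le_Int => //; apply: intg_abs.
Qed.

Lemma Int_ae f g : intg f -> intg g -> {ae nu, forall x, f x = g x} ->
  \int[nu]_x f x = \int[nu]_x g x.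
Proof.
move=> If Ig fg; congr fine; apply: ae_eq_integral => //.
- exact: measurable_int If.
- exact: measurable_int Ig.
- by apply: filterS fg => x -> .
Qed.

Lemma Int_ge0_eq0 f : intg f -> (forall x, 0 <= f x) -> \int[nu]_x f x <= 0 ->
  {ae nu, forall x, f x = 0}.
Proof.
move=> If f0 I0.
have : (\int[nu]_x `|(f x)%:E| = 0)%E.
  rewrite (eq_integral (fun x => (f x)%:E)); last first.
    by move=> x _ /=; rewrite ger0_norm.
  rewrite Int_EFin//; congr EFin; apply/eqP; rewrite eq_le I0/=.
  exact: Rintegral_ge0.
move/ae_eq_integral_abs => /(_ measurableT (measurable_int _ If)).
by apply: filterS => x /= /(_ Logic.I) [].
Qed.

(** The increments are summable in L1, so their sum [G] is integrable, hence finite almost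
    everywhere; the series converges absolutely there, and [|z 0| + G] dominates the sequence. *)
Lemma L1_limit (z : nat -> T -> R) (C : R) :
  (forall k, intg (z k)) ->
  (forall n, \sum_(0 <= k < n) \int[nu]_x `|z k.+1 x - z k x| <= C) ->
  exists s : T -> R, [/\ intg s, {ae nu, forall x, z ^~ x @ \oo --> s x} &
    (fun k => \int[nu]_x `|z k x - s x|) @ \oo --> (0:R)].
Proof.
move=> Iz zC.
pose dz k x := `|z k.+1 x - z k x|.
have Idz k : intg (dz k) by apply: intg_abs; apply: intgB.
have mdz k : measurable_fun [set: T] (EFin \o dz k) := measurable_int _ (Idz k).
pose G x : \bar R := (\sum_(0 <= k <oo) (dz k x)%:E)%E.
have G0 x : (0 <= G x)%E by apply: nneseries_ge0 => k *; rewrite lee_fin normr_ge0.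
have mG : measurable_fun [set: T] G.
  apply: ge0_emeasurable_sum => [k x *|k *]; [by rewrite lee_fin normr_ge0|exact: mdz].
have IG : nu.-integrable [set: T] G.
  apply/integrableP; split => //.
  under eq_integral do rewrite gee0_abs//.
  rewrite /G integral_nneseries//; last by move=> *; rewrite lee_fin normr_ge0.
  apply: (@le_lt_trans _ _ C%:E); last exact: ltry.
  apply: lime_le; first by apply: is_cvg_nneseries => k *; apply: integral_ge0 => x _; rewrite lee_fin normr_ge0.
  apply: nearW => n.
  rewrite (eq_bigr (fun k => (\int[nu]_x dz k x)%R%:E)); last by move=> k _; rewrite Int_EFin.
  by rewrite sumEFin lee_fin.
pose A := [set x | (G x < +oo)%E].
have mA : measurable A.
  rewrite -[A]setTI.
  exact: (emeasurable_fun_infty_o measurableT mG).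
have aeA : {ae nu, forall x, A x}.
  have := integrable_ae measurableT IG; apply: filterS => x /(_ Logic.I).
  by rewrite /A /= ge0_fin_numE.
have zE k x : z k x = z 0%N x + \sum_(0 <= i < k) (z i.+1 x - z i x).
  by rewrite telescope_sumr// addrC subrK.
have cvgA x : A x -> cvg (z ^~ x @ \oo).
  move=> Ax.
  have cs : cvgn (series (fun i => z i.+1 x - z i x)).
    apply: normed_cvg; apply: nondecreasing_is_cvgn.
      by apply: nondecreasing_series => *; apply: normr_ge0.
    exists (fine (G x)) => _ [n _ <-].
    rewrite -lee_fin fineK ?ge0_fin_numE// /normed_series_of seriesEnat/= -sumEFin.
    by apply: nneseries_lim_ge => *; rewrite lee_fin normr_ge0.
  rewrite (_ : z ^~ x = (fun k => z 0%N x + series (fun i => z i.+1 x - z i x) k)).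
    by apply: is_cvgD => //; exact: is_cvg_cst.
  by apply/funext => k; rewrite zE.
(* Cutting off to the set of finite [G] makes the sequence converge at every point, so that [s] is
   measurable as a pointwise limit. *)
pose z' k := z k * \1_A.
pose s x := lim (z' ^~ x @ \oo).
have z's x : z' ^~ x @ \oo --> s x.
  suff : cvg (z' ^~ x @ \oo) by [].
  have [Ax|Ax] := pselect (A x).
    suff -> : z' ^~ x = z ^~ x by apply: cvgA.
    by apply/funext => k; rewrite /z' fctE indicE mem_set// mulr1.
  suff -> : z' ^~ x = cst 0 by exact: is_cvg_cst.
  by apply/funext => k; rewrite /z' fctE indicE memNset// mulr0.
have zs : {ae nu, forall x, z ^~ x @ \oo --> s x}.
  apply: filterS aeA => x Ax; rewrite (_ : z ^~ x = z' ^~ x)//.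
  by apply/funext => k; rewrite /z' fctE indicE mem_set// mulr1.
have ms : measurable_fun [set: T] s.
  apply: (@measurable_fun_cvg _ _ _ _ z') => [k|x _]; last exact: z's.
  exact/intg_measurable/intg_indic.
have zG k x : (`|(z k x)%:E| <= `|z 0%N x|%:E + G x)%E.
  rewrite abse_EFin zE (@le_trans _ _ (`|z 0%N x|%:E + (\sum_(0 <= i < k) dz i x)%:E)%E)//.
    rewrite -EFinD lee_fin (le_trans (ler_normD _ _))// lerD2l.
    exact: ler_norm_sum.
  by rewrite leeD2l// -sumEFin; apply: nneseries_lim_ge => *; rewrite lee_fin normr_ge0.
have aezs : {ae nu, forall x, [set: T] x ->
    (fun k => (z k x)%:E) @ \oo --> (s x)%:E}.
  apply: filterS zs => x zsx _; apply/fine_cvgP; split; first exact: nearW.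
  exact: zsx.
have IzG : nu.-integrable [set: T] (fun x => `|z 0%N x|%:E + G x)%E.
  by apply: integrableD => //; exact: intg_abs.
have aezG : {ae nu, forall x k, [set: T] x ->
    (`|(z k x)%:E| <= `|z 0%N x|%:E + G x)%E}.
  by apply: aeW => x k _; exact: zG.
have [Is s0 _] := dominated_convergence measurableT
  (fun k => measurable_int _ (Iz k)) ((measurable_EFinP _ _).2 ms) aezs IzG aezG.
exists s; split => //.
apply: cvg_trans; last exact: (fine_cvg s0).
by apply: near_eq_cvg; apply: nearW => k.
Qed.

End L1.

Section L2.
Context d {T : measurableType d} {R : realType} (nu : {measure set T -> \bar R}).
Hypothesis nu_fin : (nu [set: T] < +oo)%E.
Implicit Types f g h : T -> R.

Definition L2 f := measurable_fun [set: T] f /\ intg nu (f * f).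

Definition dot f g := \int[nu]_x (f * g) x.

Lemma intg_cst (c : R) : intg nu (cst c).
Proof.
apply/integrableP; split; first exact/measurable_EFinP/measurable_cst.
by rewrite (eq_integral (cst `|c|%:E))// integral_cst//= lte_mul_pinfty.
Qed.

Lemma intg_bounded f c : measurable_fun [set: T] f -> (forall x, `|f x| <= c) ->
  intg nu f.
Proof. by move=> mf fc; apply: (le_intg mf fc); apply: intg_cst. Qed.

Lemma L2M f g : L2 f -> L2 g -> intg nu (f * g).
Proof.
move=> [mf If] [mg Ig]; apply: (@le_intg _ _ _ _ _ (f * f + g * g)).
- exact: measurable_funM.
- move=> x; rewrite !fctE ler_norml; have := sqr_ge0 (f x + g x).
  have := sqr_ge0 (f x - g x); nra.
- exact: intgD.
Qed.

Lemma L2_bounded f c : measurable_fun [set: T] f -> (forall x, `|f x| <= c) -> L2 f.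
Proof.
move=> mf fc; split => //; apply: (@intg_bounded _ (c * c)).
  exact: measurable_funM.
by move=> x; rewrite normrM ler_pM.
Qed.

Lemma L2_cst (c : R) : L2 (cst c).
Proof. exact: (@L2_bounded _ `|c|). Qed.

Lemma L2D f g : L2 f -> L2 g -> L2 (f + g).
Proof.
move=> Lf Lg; split; first exact: (measurable_funD Lf.1 Lg.1).
rewrite mulrDl !mulrDr; apply: intgD; apply: intgD; exact: L2M.
Qed.

Lemma L2Z k f : L2 f -> L2 (k *: f).
Proof.
move=> [mf If]; split; first by apply: measurable_funM.
by rewrite fct_scalerAl fct_scalerAr; do 2 apply: intgZ.
Qed.

Lemma L2N f : L2 f -> L2 (- f).
Proof. by move=> Lf; rewrite -scaleN1r; apply: L2Z. Qed.

Lemma L2B f g : L2 f -> L2 g -> L2 (f - g).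
Proof. by move=> Lf Lg; apply: L2D => //; apply: L2N. Qed.

Lemma L2_intg f : L2 f -> intg nu f.
Proof. by move=> Lf; rewrite -[f]mulr1; apply: L2M => //; apply: L2_cst. Qed.

Lemma L2_indic E : measurable E -> L2 \1_E.
Proof.
move=> mE; apply: (@L2_bounded _ 1); first exact: measurable_indic.
by move=> x; rewrite indicE; case: (_ \in _); rewrite ?normr0 ?normr1.
Qed.

Lemma dotC f g : dot f g = dot g f.
Proof. by rewrite /dot mulrC. Qed.

Lemma dotDl f g h : L2 f -> L2 g -> L2 h -> dot (f + g) h = dot f h + dot g h.
Proof. by move=> *; rewrite /dot mulrDl IntD//; apply: L2M. Qed.

Lemma dotDr f g h : L2 f -> L2 g -> L2 h -> dot h (f + g) = dot h f + dot h g.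
Proof. by move=> *; rewrite /dot mulrDr IntD//; apply: L2M. Qed.

Lemma dotZl k f h : L2 f -> L2 h -> dot (k *: f) h = k * dot f h.
Proof. by move=> *; rewrite /dot fct_scalerAl IntZ//; apply: L2M. Qed.

Lemma dotZr k f h : L2 f -> L2 h -> dot h (k *: f) = k * dot h f.
Proof. by move=> *; rewrite dotC dotZl// dotC. Qed.

Lemma dotNl f h : L2 f -> L2 h -> dot (- f) h = - dot f h.
Proof. by move=> *; rewrite -scaleN1r dotZl// mulN1r. Qed.

Lemma dotNr f h : L2 f -> L2 h -> dot h (- f) = - dot h f.
Proof. by move=> *; rewrite dotC dotNl// dotC. Qed.

Lemma dotBl f g h : L2 f -> L2 g -> L2 h -> dot (f - g) h = dot f h - dot g h.
Proof. by move=> *; rewrite dotDl ?dotNl//; apply: L2N. Qed.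

Lemma dotBr f g h : L2 f -> L2 g -> L2 h -> dot h (f - g) = dot h f - dot h g.
Proof. by move=> *; rewrite dotDr ?dotNr//; apply: L2N. Qed.

Lemma dot_ge0 f : 0 <= dot f f.
Proof. by apply: Rintegral_ge0 => x _; rewrite fctE -expr2 sqr_ge0. Qed.

(** A weighted AM-GM bound in the place of the Cauchy-Schwarz inequality: with [t] free, no square
    root of [dot] is needed. *)
Lemma dot_AMGM f g (t : R) : 0 < t -> L2 f -> L2 g ->
  `|dot f g| <= t * dot f f + t^-1 * dot g g.
Proof.
move=> t0 Lf Lg; rewrite /dot -!IntZ ?Lf.2 ?Lg.2//.
rewrite -IntD; [|exact: intgZ Lf.2|exact: intgZ Lg.2].
apply: Int_abs_le; first exact: L2M.
  by apply: intgD; apply: intgZ; [case: Lf|case: Lg].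
move=> x; rewrite !fctE /=.
have -> : `|f x * g x| = (t * `|f x|) * (t^-1 * `|g x|) * 1.
  by rewrite normrM mulr1 mulrACA divff ?gt_eqF// mul1r.
set a := `|f x|; set b := `|g x|.
have -> : t *: (f x * f x) = t * a ^+ 2 by rewrite /a real_normK ?num_real.
have -> : t^-1 *: (g x * g x) = t^-1 * b ^+ 2 by rewrite /b real_normK ?num_real.
have -> : t * a * (t^-1 * b) * 1 = a * b by rewrite mulr1 mulrACA divff ?gt_eqF// mul1r.
have -> : t * a ^+ 2 + t^-1 * b ^+ 2 = t * (a - t^-1 * b) ^+ 2 + 2 * (a * b).
  by field; rewrite gt_eqF.
have : 0 <= a * b := mulr_ge0 (normr_ge0 _) (normr_ge0 _).
have : 0 <= t * (a - t^-1 * b) ^+ 2 by rewrite mulr_ge0 ?sqr_ge0// ltW.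
lra.
Qed.

Lemma dot_cvg (z : nat -> T -> R) s f : (forall k, L2 (z k)) -> L2 s -> L2 f ->
  (fun k => dot (z k - s) (z k - s)) @ \oo --> (0:R) ->
  (fun k => dot f (z k)) @ \oo --> dot f s.
Proof.
move=> Lz Ls Lf zs; apply/cvgrPdist_le => e e0.
(* The weight makes [t^-1 * dot f f] at most [e / 2]; the added 1 keeps [t] positive when [dot f f]
   is 0. *)
pose t := (dot f f + 1) / (e / 2).
have M0 := dot_ge0 f.
have t0 : 0 < t by apply: divr_gt0; lra.
have e2 : 0 < e / 2 / t by apply: divr_gt0 => //; lra.
move/cvgrPdist_le : zs => /(_ _ e2); apply: filterS => k.
rewrite sub0r normrN ger0_norm ?dot_ge0// => zk.
rewrite distrC -dotBr// dotC (le_trans (dot_AMGM t0 _ _))//; first exact: L2B.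
have -> : e = e / 2 + e / 2 by field.
apply: lerD; first by rewrite -ler_pdivlMl// mulrC.
have te : t * (e / 2) = dot f f + 1 by rewrite /t divfK//; lra.
rewrite mulrC ler_pdivrMr// mulrC te; lra.
Qed.

End L2.

(** * The L2 projection on a convex set and its large-data limit *)

Section ROF.
Context d {T : measurableType d} {R : realType} (nu : {measure set T -> \bar R}).
Hypothesis nu_fin : (nu [set: T] < +oo)%E.
Implicit Types f g h : T -> R.

Local Notation L2 := (L2 nu).
Local Notation dot := (dot nu).

(** Fatou's lemma for the squares: it gives at once the square-integrability of an almost everywhere
    limit and its bound. *)
Lemma fatou_dot (z : nat -> T -> R) (s : T -> R) (c : R) : (forall k, L2 (z k)) ->
  measurable_fun [set: T] s ->
  {ae nu, forall x, z ^~ x @ \oo --> s x} ->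
  (forall k, dot (z k) (z k) <= c) -> L2 s /\ dot s s <= c.
Proof.
move=> Lz ms zs zc.
pose F k x : \bar R := (z k x * z k x)%:E.
have mz2 k : measurable_fun [set: T] (F k) := measurable_int _ (Lz k).2.
have F0 k x : [set: T] x -> (0 <= F k x)%E by rewrite lee_fin -expr2 sqr_ge0.
have := fatou nu measurableT mz2 F0.
rewrite (@ge0_ae_eq_integral _ _ _ _ _ _ (fun x => (s x * s x)%:E))//; first last.
- apply: filterS zs => x zsx _.
  have Fs : F ^~ x @ \oo --> (s x * s x)%:E.
    by apply/fine_cvgP; split; [exact: nearW|exact: cvgM].
  by rewrite is_cvg_limn_einfE; [exact/cvg_lim|apply/cvg_ex; eexists; exact: Fs].
- by move=> x _; rewrite lee_fin -expr2 sqr_ge0.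
- move=> x _; rewrite limn_einf_lim; apply: lime_ge; first exact: is_cvg_einfs.
  by apply: nearW => n; apply: le_ereal_inf_tmp => _ [k _ <-]; exact: F0.
- exact/measurable_EFinP/measurable_funM.
- rewrite (_ : (fun x => _) = (fun x => - limn_esup (-%E \o F ^~ x))%E).
    apply: measurableT_comp => //; apply: measurable_fun_limn_esup => k.
    exact: measurableT_comp.
  by apply/funext => x; rewrite limn_esupN oppeK.
move=> Fle.
have s2c : (\int[nu]_x (s x * s x)%:E <= c%:E)%E.
  apply: (le_trans Fle); rewrite limn_einf_lim; apply: lime_le; first exact: is_cvg_einfs.
  apply: nearW => n; apply: (@le_trans _ _ (\int[nu]_x F n x)%E).
    by apply: ereal_inf_lbound; exists n => //=.
  by have := Int_EFin (Lz n).2; rewrite /F /= => ->; rewrite lee_fin; exact: zc.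
have Is : intg nu (s * s).
  apply/integrableP; split; first exact/measurable_EFinP/measurable_funM.
  rewrite (eq_integral (fun x => (s x * s x)%:E)).
    exact: (le_lt_trans s2c (ltry _)).
  by move=> x _ /=; rewrite fctE ger0_norm// -expr2 sqr_ge0.
split; first by split.
by rewrite -lee_fin /dot -(Int_EFin Is).
Qed.

Lemma sum_half n : \sum_(0 <= k < n) (2^-1 : R) ^+ k <= 2.
Proof.
have -> : \sum_(0 <= k < n) (2^-1 : R) ^+ k = 2 - 2 * 2^-1 ^+ n.
  elim: n => [|n IH]; first by rewrite big_nil expr0; lra.
  by rewrite big_nat_recr//= IH exprS; lra.
by rewrite gerBl mulr_ge0 ?exprn_ge0.
Qed.

Lemma half_sqr_cvg0 : (fun k => ((2^-1 : R) ^+ k) ^+ 2) @ \oo --> (0:R).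
Proof.
rewrite (_ : (fun _ => _) = (fun k => (4^-1 : R) ^+ k)).
  by apply: cvg_expr; rewrite ger0_norm; lra.
apply/funext => k; rewrite -exprM mulnC exprM; congr (_ ^+ k).
by rewrite exprVn -natrX.
Qed.

(** The total mass is finite, so increments that are geometric in L2 are geometric in L1: [L1_limit]
    provides an almost everywhere limit, and Fatou's lemma for [z k - z l], as [l] grows, returns
    the rate. *)
Lemma L2_complete (z : nat -> T -> R) : (forall k, L2 (z k)) ->
  (forall k l, (k <= l)%N ->
    dot (z k - z l) (z k - z l) <= ((2^-1 : R) ^+ k) ^+ 2) ->
  exists s : T -> R, L2 s /\
    forall k, dot (z k - s) (z k - s) <= ((2^-1 : R) ^+ k) ^+ 2.
Proof.
move=> Lz zc.
have LB k l : L2 (z k - z l) by apply: L2B.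
pose M := dot (cst 1) (cst 1).
have dz k : \int[nu]_x `|z k.+1 x - z k x| <= (1 + M) * (2^-1 : R) ^+ k.
  set q := _ ^+ k; have q0 : 0 < q by rewrite exprn_gt0.
  (* With this [t], the bound [|a| <= t * a ^+ 2 + t^-1] integrates to [(1 + M) * q], because the L2
     bound is [q ^+ 2]. *)
  pose t := q^-1; have t0 : 0 < t by rewrite invr_gt0.
  apply: (@le_trans _ _ (t * dot (z k - z k.+1) (z k - z k.+1) + t^-1 * M)).
    have L1 : L2 (cst 1) := L2_cst nu_fin 1.
    rewrite /M /dot -!IntZ ?(LB k k.+1).2 ?L1.2//.
    have I1 := intgZ t (LB k k.+1).2.
    have I2 := intgZ t^-1 L1.2.
    rewrite -IntD//; apply: le_Int; [|exact: intgD|].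
      exact/intg_abs/(L2_intg nu_fin)/LB.
    move=> x; rewrite !fctE /= distrC mulr1 -[_ *: _]/(t * _) -[_ *: 1]/(t^-1 * 1).
    rewrite /= mulr1 -expr2 -[X in _ * X ^+ 2]/(z k x - z k.+1 x).
    rewrite -(@real_normK _ (z k x - z k.+1 x)) ?num_real//.
    set a := `| _ |; have a0 : 0 <= a := normr_ge0 _.
    have -> : t * a ^+ 2 + t^-1 = t * (a - t^-1) ^+ 2 + 2 * a by field; rewrite gt_eqF.
    have : 0 <= t * (a - t^-1) ^+ 2 by rewrite mulr_ge0 ?sqr_ge0// ltW.
    lra.
  have := zc k k.+1 (leqnSn k); rewrite -/q => zk.
  rewrite mulrDl mul1r lerD// /t ?invrK 1?mulrC//.
  by rewrite ler_pdivrMr// -expr2.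
have [|s [Is zs _]] := @L1_limit _ _ _ nu z ((1 + M) * 2) (fun k => L2_intg nu_fin (Lz k)).
  move=> n; apply: (@le_trans _ _ (\sum_(0 <= k < n) (1 + M) * (2^-1 : R) ^+ k)).
    by apply: ler_sum.
  by rewrite -mulr_sumr ler_wpM2l ?sum_half// addr_ge0// dot_ge0.
have ms := intg_measurable Is.
exists s.
have sk k : L2 (z k - s) /\ dot (z k - s) (z k - s) <= ((2^-1 : R) ^+ k) ^+ 2.
  apply: (@fatou_dot (fun l => z k - z (l + k)%N)).
  - by move=> l; apply: LB.
  - by apply: measurable_funB => //; exact: (Lz k).1.
  - apply: filterS zs => x zsx; apply: cvgB; first exact: cvg_cst.
    by rewrite (cvg_shiftn k (z ^~ x)).
  - by move=> l; apply: zc; rewrite leq_addl.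
split; last by move=> k; case: (sk k).
rewrite (_ : s = z 0%N - (z 0%N - s)); last by rewrite subKr.
by apply: L2B => //; case: (sk 0%N).
Qed.

Variable K : set (T -> R).
Hypothesis KL2 : forall z, K z -> L2 z.
Hypothesis K0 : K 0.
Hypothesis Kconv : forall z1 z2 (t : R), K z1 -> K z2 -> 0 <= t <= 1 ->
  K ((1 - t) *: z1 + t *: z2).

(* [s] is the [L2]-projection of [f] on the closure of [K]. *)
Definition projK f s := [/\ L2 s,
  (exists2 z : nat -> T -> R, (forall k, K (z k)) &
    forall k, dot (z k - s) (z k - s) <= ((2^-1 : R) ^+ k) ^+ 2) &
  forall zeta, K zeta -> dot (f - s) (zeta - s) <= 0].

(** A sequence minimizing the squared distance to [f] is Cauchy by the parallelogram law [par] and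
    the convexity of [K]. The first-order condition is obtained along the sequence, up to [e k], and
    passed to the limit. *)
Lemma projK_exists f : L2 f -> exists s, projK f s.
Proof.
move=> Lf.
pose G z := dot (z - f) (z - f).
pose V := [set G z | z in K].
have V0 : V !=set0 by exists (G 0); exists 0.
have Vlb : has_lbound V by exists 0 => _ [z _ <-]; exact: dot_ge0.
pose g := inf V.
have gK z : K z -> g <= G z by move=> Kz; apply: ge_inf => //; exists z.
(* The parallelogram law bounds the squared distance of [z k] and [z l] by [2 * (e k + e l)], at
   most [4 * e k] for [k <= l]; hence the division by 4. *)
pose e k : R := ((2^-1 : R) ^+ k) ^+ 2 / 4.
have e0 k : 0 < e k by rewrite divr_gt0// !exprn_gt0.
have /choice[z zP] : forall k, exists z, K z /\ G z < g + e k.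
  move=> k; have [_ [z Kz <-] zg] := inf_adherent (e0 k) (conj V0 Vlb).
  by exists z.
have Kz k : K (z k) by case: (zP k).
have zg k : G (z k) < g + e k by case: (zP k).
have Lz k : L2 (z k) := KL2 (Kz k).
have par a b : L2 a -> L2 b -> dot (a - b) (a - b) =
    2 * dot a a + 2 * dot b b - 4 * dot (2^-1 *: (a + b)) (2^-1 *: (a + b)).
  move=> La Lb; have LD := L2D La Lb.
  rewrite dotZl ?dotZr//; last exact: L2Z.
  rewrite dotBl ?dotBr ?dotBr//; last exact: L2B.
  rewrite dotDl ?dotDr ?dotDr// (dotC _ b a); by field.
have [|s [Ls zs]] := @L2_complete z Lz.
  move=> k l kl.
  have -> : z k - z l = (z k - f) - (z l - f) by rewrite opprB addrA subrK.
  rewrite par; [|exact: L2B|exact: L2B].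
  have Km : K ((1 - 2^-1) *: z k + 2^-1 *: z l) by apply: Kconv => //; lra.
  have -> : 2^-1 *: (z k - f + (z l - f)) = (1 - 2^-1) *: z k + 2^-1 *: z l - f.
    apply/funext => x; rewrite !fctE.
    rewrite -![_ *: _ x]/(_ * _) -[LHS]/(_ * _); lra.
  have := gK _ Km; rewrite /G.
  have := zg k; have := zg l; rewrite /G.
  have : e l <= e k.
    rewrite ler_wpM2r// ler_pXn2r ?nnegrE ?exprn_ge0//.
    by rewrite ler_wiXn2l//; lra.
  rewrite /e; set a := (2^-1 ^+ l) ^+ 2; set b := (2^-1 ^+ k) ^+ 2.
  lra.
exists s; split => //; first by exists z.
move=> zeta Kzeta; have Lzeta := KL2 Kzeta.
have zs0 : (fun k => dot (z k - s) (z k - s)) @ \oo --> (0:R).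
  apply: (@squeeze_cvgr _ _ _ _ (cst 0) _ _ _ _ _ half_sqr_cvg0); last exact: cvg_cst.
  by apply: nearW => k; rewrite dot_ge0 zs.
have e_cvg0 : e @ \oo --> (0:R).
  by rewrite -[0](mul0r (4^-1)); apply: cvgM; [exact: half_sqr_cvg0|exact: cvg_cst].
have Lsf : L2 (s - f) by apply: L2B.
have Lzs : L2 (zeta - s) by apply: L2B.
(* Moving [z k] towards [zeta] stays in [K], so it cannot lower the squared distance to [f] by more
   than [e k]; this is the limit in [k]. *)
have tmain (t : R) : 0 <= t <= 1 ->
  0 <= 2 * t * dot (s - f) (zeta - s) + t ^+ 2 * dot (zeta - s) (zeta - s).
  move=> t01.
  have expand a b : L2 a -> L2 b -> dot (a + t *: (b - a) - f) (a + t *: (b - a) - f) =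
      dot (a - f) (a - f) + 2 * t * dot (a - f) (b - a) + t ^+ 2 * dot (b - a) (b - a).
    move=> La Lb.
    have Laf : L2 (a - f) by apply: L2B.
    have Lba : L2 (b - a) by apply: L2B.
    have Lt : L2 (t *: (b - a)) by apply: L2Z.
    have LD : L2 (a - f + t *: (b - a)) by apply: L2D.
    rewrite addrAC (dotDl Laf Lt LD) !(dotDr Laf Lt)// !dotZl// !dotZr//.
    rewrite (dotC _ (b - a) (a - f)); ring.
  have ck h : L2 h -> (fun k => dot h (z k)) @ \oo --> dot h s.
    by move=> Lh; apply: (dot_cvg Lz Ls Lh zs0).
  have czz : (fun k => dot (z k) (z k)) @ \oo --> dot s s.
    rewrite (_ : (fun _ => _) = (fun k =>
        dot (z k - s) (z k - s) + 2 * dot s (z k) - dot s s)).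
      rewrite [X in _ --> X](_ : _ = 0 + 2 * dot s s - dot s s); last by ring.
      apply: cvgB; last exact: cvg_cst.
      by apply: cvgD => //; apply: cvgM; [exact: cvg_cst|exact: ck].
    apply/funext => k; have Lk := Lz k.
    rewrite dotBl ?dotBr ?dotBr//; last exact: L2B.
    rewrite (dotC _ s (z k)); ring.
  have c1 : (fun k => dot (z k - f) (zeta - z k)) @ \oo --> dot (s - f) (zeta - s).
    have split2 a : L2 a -> dot (a - f) (zeta - a) =
        dot zeta a - dot a a - dot f zeta + dot f a.
      move=> La; rewrite dotBl ?dotBr ?dotBr//; last exact: L2B.
      rewrite (dotC _ a zeta); ring.
    rewrite (_ : (fun _ => _) = (fun k =>
        dot zeta (z k) - dot (z k) (z k) - dot f zeta + dot f (z k))); last first.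
      by apply/funext => k; rewrite split2.
    rewrite split2//; apply: cvgD; last exact: ck.
    by apply: cvgB; [apply: cvgB => //; exact: ck|exact: cvg_cst].
  have c2 : (fun k => dot (zeta - z k) (zeta - z k)) @ \oo --> dot (zeta - s) (zeta - s).
    have split2 a : L2 a -> dot (zeta - a) (zeta - a) =
        dot zeta zeta - 2 * dot zeta a + dot a a.
      move=> La; rewrite dotBl ?dotBr ?dotBr//; last exact: L2B.
      rewrite (dotC _ a zeta); ring.
    rewrite (_ : (fun _ => _) = (fun k =>
        dot zeta zeta - 2 * dot zeta (z k) + dot (z k) (z k))); last first.
      by apply/funext => k; rewrite split2.
    rewrite split2//; apply: cvgD => //; apply: cvgB; first exact: cvg_cst.
    by apply: cvgM; [exact: cvg_cst|exact: ck].
  have cc : (fun k => e k + 2 * t * dot (z k - f) (zeta - z k) +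
      t ^+ 2 * dot (zeta - z k) (zeta - z k)) @ \oo -->
      0 + 2 * t * dot (s - f) (zeta - s) + t ^+ 2 * dot (zeta - s) (zeta - s).
    apply: cvgD; last by apply: cvgM => //; exact: cvg_cst.
    by apply: cvgD => //; apply: cvgM => //; exact: cvg_cst.
  rewrite -[X in _ <= X + _]add0r; apply: (cvgr_to_ge cc); apply: nearW => k.
  have Kt : K (z k + t *: (zeta - z k)).
    rewrite (_ : _ + _ = (1 - t) *: z k + t *: zeta); first exact: Kconv.
    by rewrite scalerBr scalerBl scale1r addrA addrAC.
  have := gK _ Kt; rewrite /G expand//.
  have := zg k; rewrite /G; lra.
rewrite -opprB dotNl// oppr_le0 leNgt; apply/negP => neg.
set A := dot (s - f) _ in neg tmain; set B := dot (zeta - s) _ in tmain.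
have B0 : 0 <= B := dot_ge0 _ _.
(* If [A < 0], this [t] satisfies [t * B < - A], so [2 * t * A + t ^+ 2 * B] is negative, against
   [tmain]. *)
pose t := Num.min 1 (- A / (B + 1)).
have t0 : 0 < t by rewrite lt_min ltr01/= divr_gt0//; lra.
have t1 : t <= 1 by rewrite ge_min lexx.
have tA : t * (B + 1) <= - A by rewrite -ler_pdivlMr ?ge_min ?lexx ?orbT//; lra.
have := tmain t; rewrite t1 ltW//= => /(_ isT).
nra.
Qed.

Lemma projK_dot_le f s g c : projK f s -> L2 g ->
  (forall z, K z -> dot g z <= c) -> dot g s <= c.
Proof.
move=> [Ls [z Kz zs] _] Lg gc.
have zs0 : (fun k => dot (z k - s) (z k - s)) @ \oo --> (0:R).
  apply: (@squeeze_cvgr _ _ _ _ (cst 0) _ _ _ _ _ half_sqr_cvg0); last exact: cvg_cst.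
  by apply: nearW => k; rewrite dot_ge0 zs.
have cg := dot_cvg (fun k => KL2 (Kz k)) Ls Lg zs0.
by apply: (cvgr_to_le cg); apply: nearW => k; apply/gc/Kz.
Qed.

Hypothesis Kint : forall z, K z -> dot (cst 1) z = 0.

Lemma projK_int0 f s : projK f s -> dot (cst 1) s = 0.
Proof.
move=> Ps; have L1 : L2 (cst 1) := L2_cst nu_fin 1.
have Ls : L2 s by case: Ps.
apply/eqP; rewrite eq_le; apply/andP; split.
  by apply: (projK_dot_le Ps L1) => z Kz; rewrite Kint.
rewrite -oppr_le0 -dotNl//; apply: (projK_dot_le Ps); first exact: L2N.
by move=> z Kz; rewrite dotNl ?Kint ?oppr0//; exact: KL2.
Qed.

(** Constants are orthogonal to [K] and to [s], hence invisible to the variational inequality. *)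
Lemma projK_shift f s (c : R) : L2 f -> projK f s -> projK (f + cst c) s.
Proof.
move=> Lf Ps; have s0 := projK_int0 Ps; case: Ps => Ls zs var; split => // zeta Kzeta.
have Lzeta := KL2 Kzeta; have L1 : L2 (cst 1) := L2_cst nu_fin 1.
have -> : f + cst c - s = (f - s) + c *: cst 1.
  by rewrite addrAC; congr (_ + _); apply/funext => x; rewrite !fctE -[RHS]/(c * 1) mulr1.
rewrite dotDl ?dotZl ?(dotBr Lzeta Ls L1) ?s0 ?Kint ?subrr ?mulr0 ?addr0 ?var//.
- exact: L2B.
- exact: L2B.
- exact: L2Z.
- exact: L2B.
Qed.

Variable H : R -> R.
Hypothesis mH : measurable_fun [set: R] H.
Hypothesis H_ge0 : forall t, 0 <= H t.
Hypothesis H_gt0 : forall t, 0 < t -> 0 < H t.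
Hypothesis H_npos : forall t, t <= 0 -> H t = 0.
Hypothesis H_le : forall t, `|H t| <= `|t|.
(* The submodularity of the support function of [K], with the modulus [H]. *)
Hypothesis Klat : forall h1 h2 c1 c2, L2 h1 -> L2 h2 ->
  (forall z, K z -> dot h1 z <= c1) -> (forall z, K z -> dot h2 z <= c2) ->
  forall z1 z2, K z1 -> K z2 ->
  dot h1 z1 + dot h2 z2 + dot (H \o (h1 - h2)) (z2 - z1) <= c1 + c2.

(** Thus [s] attains the support function of [K] at [f - s]; this value is the constant given to
    [Klat] in [projK_le]. *)
Lemma projK_var f s zeta : L2 f -> projK f s -> K zeta ->
  dot (f - s) zeta <= dot (f - s) s.
Proof.
move=> Lf [Ls _ var] Kzeta; have := var _ Kzeta.
have Lzeta := KL2 Kzeta.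
by rewrite dotBr ?subr_le0//; exact: L2B.
Qed.

(** Apply [Klat] to [h_i = f_i - s_i], with elements of [K] tending to [s_i] and the constants
    [dot h_i s_i]: what remains is [dot (H \o w) (s2 - s1) <= 0]. Since [f1 <= f2], also
    [w <= s2 - s1], so the nonnegative [H(w) * w] has integral 0, and [w <= 0] almost everywhere. *)
Lemma projK_le f1 f2 s1 s2 : L2 f1 -> L2 f2 -> projK f1 s1 -> projK f2 s2 ->
  (forall x, f1 x <= f2 x) -> {ae nu, forall x, f1 x - s1 x <= f2 x - s2 x}.
Proof.
move=> Lf1 Lf2 P1 P2 f12.
have [[Ls1 [z1 Kz1 zs1] _] [Ls2 [z2 Kz2 zs2] _]] := (P1, P2).
have Lh1 : L2 (f1 - s1) by apply: L2B.
have Lh2 : L2 (f2 - s2) by apply: L2B.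
pose w := (f1 - s1) - (f2 - s2).
have Lw : L2 w by apply: L2B.
have LHw : L2 (H \o w).
  split; first exact: (measurableT_comp mH Lw.1).
  apply: (@le_intg _ _ _ _ _ (w * w)); last exact: Lw.2.
    by apply: measurable_funM; exact: (measurableT_comp mH Lw.1).
  move=> x; rewrite !fctE normrM -[w x * w x]ger0_norm -?expr2 ?sqr_ge0// normrX.
  by rewrite expr2; apply: ler_pM.
have zs0 z s (zs : forall k, dot (z k - s) (z k - s) <= ((2^-1 : R) ^+ k) ^+ 2) :
    (fun k => dot (z k - s) (z k - s)) @ \oo --> (0:R).
  apply: (@squeeze_cvgr _ _ _ _ (cst 0) _ _ _ _ _ half_sqr_cvg0); last exact: cvg_cst.
  by apply: nearW => k; rewrite dot_ge0 zs.
have cg1 g (Lg : L2 g) := dot_cvg (fun k => KL2 (Kz1 k)) Ls1 Lg (zs0 _ _ zs1).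
have cg2 g (Lg : L2 g) := dot_cvg (fun k => KL2 (Kz2 k)) Ls2 Lg (zs0 _ _ zs2).
have lat : dot (f1 - s1) s1 + dot (f2 - s2) s2 + (dot (H \o w) s2 - dot (H \o w) s1)
    <= dot (f1 - s1) s1 + dot (f2 - s2) s2.
  have cv : (fun k => dot (f1 - s1) (z1 k) + dot (f2 - s2) (z2 k) +
      (dot (H \o w) (z2 k) - dot (H \o w) (z1 k))) @ \oo -->
      dot (f1 - s1) s1 + dot (f2 - s2) s2 + (dot (H \o w) s2 - dot (H \o w) s1).
    apply: cvgD; first by apply: cvgD; [exact: cg1|exact: cg2].
    by apply: cvgB; [exact: cg2|exact: cg1].
  apply: (cvgr_to_le cv); apply: nearW => k.
  rewrite -dotBr//; [|exact: KL2|exact: KL2].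
  by apply: Klat => // z Kz; exact: projK_var.
have {}lat : dot (H \o w) (s2 - s1) <= 0 by rewrite dotBr//; lra.
have Hw_ge0 x : 0 <= (H \o w) x * w x.
  rewrite /=; have [w0|w0] := leP (w x) 0; first by rewrite H_npos ?mul0r.
  by rewrite mulr_ge0// ltW.
have : {ae nu, forall x, ((H \o w) * w) x = 0}.
  apply: Int_ge0_eq0; [exact: L2M|exact: Hw_ge0|].
  apply: le_trans lat; rewrite /dot; apply: le_Int; [exact: L2M|exact/L2M/L2B|].
  move=> x; rewrite [leRHS]/GRing.mul /= [leLHS]/GRing.mul /=.
  apply: ler_wpM2l; first exact: H_ge0.
  by rewrite /w !fctE; have := f12 x; lra.
apply: filterS => x; rewrite fctE => /eqP; rewrite mulf_eq0 => w0.
suff : w x <= 0 by rewrite /w !fctE subr_le0.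
rewrite leNgt; apply/negP => wx0; move: w0.
by rewrite !gt_eqF ?orbF//=; exact: H_gt0.
Qed.

Theorem calibration E P : measurable E ->
  (forall z, K z -> dot \1_E z <= P) ->
  exists s, [/\ intg nu s,
    forall F c, measurable F -> (forall z, K z -> dot \1_F z <= c) ->
      dot \1_F s <= c &
    forall z, K z -> dot \1_E z <= dot \1_E s].
Proof.
move=> mE EP.
have LE : L2 \1_E := L2_indic nu_fin mE.
have L1 : L2 (cst 1) := L2_cst nu_fin 1.
have /choice[s Ps] : forall k : nat, exists s, projK (k%:R *: \1_E) s.
  by move=> k; apply/projK_exists/L2Z.
have Ls k : L2 (s k) by case: (Ps k).
pose p k := dot \1_E (s k).
have mono k : {ae nu, forall x, `|s k.+1 x - s k x| = ((2 *: \1_E - cst 1) * (s k.+1 - s k)) x}.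
  have LkE (l : nat) : L2 (l%:R *: \1_E) by apply: L2Z.
  have Lk1 : L2 (k%:R *: \1_E + cst 1) by apply: L2D.
  have E01 x : (\1_E x : R) = 1 \/ (\1_E x : R) = 0.
    by rewrite indicE; case: (_ \in _); [left|right].
  have [le1 le2] : (forall x, (k%:R *: \1_E : T -> R) x <= (k.+1%:R *: \1_E : T -> R) x) /\
      (forall x, (k.+1%:R *: \1_E : T -> R) x <= (k%:R *: \1_E + cst 1 : T -> R) x).
    by split=> x; rewrite !fctE /GRing.scale /= -natr1; case: (E01 x) => ->; lra.
  (* Each comparison is used where its two data agree: the first off [E], the second on [E]. *)
  have cmp1 := projK_le (LkE k) (LkE k.+1) (Ps k) (Ps k.+1) le1.
  have cmp2 := projK_le (LkE k.+1) Lk1 (Ps k.+1) (projK_shift 1 (LkE k) (Ps k)) le2.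
  apply: filterS2 cmp1 cmp2 => x.
  rewrite !fctE /GRing.scale /= -natr1.
  case: (E01 x) => -> c1 c2.
    by rewrite ger0_norm; lra.
  by rewrite ler0_norm; lra.
have dp k : \int[nu]_x `|s k.+1 x - s k x| = 2 * (p k.+1 - p k).
  have Lds : L2 (s k.+1 - s k) by apply: L2B.
  have L21 : L2 (2 *: \1_E - cst 1) by apply: L2B => //; apply: L2Z.
  rewrite (Int_ae _ _ (mono k)); [|exact/intg_abs/(L2_intg nu_fin)|exact: L2M].
  rewrite -[LHS]/(dot _ _) dotBl ?dotZl//; last exact: L2Z.
  rewrite dotBr// (dotBr (Ls k.+1) (Ls k) L1) !(projK_int0 (Ps _)) /p; ring.
have pP k : p k <= P by apply: (projK_dot_le (Ps k)).
have [|u [Iu _ su]] := @L1_limit _ _ _ nu s (2 * (P - p 0%N)) (fun k => L2_intg nu_fin (Ls k)).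
  move=> n; under eq_bigr do rewrite dp.
  by rewrite -mulr_sumr telescope_sumr// ler_wpM2l// lerB.
have ucvg F : measurable F -> (fun k => dot \1_F (s k)) @ \oo --> dot \1_F u.
  move=> mF; apply/cvgrPdist_le => e e0.
  move/cvgrPdist_le : su => /(_ _ e0); apply: filterS => k.
  rewrite sub0r normrN ger0_norm; last by apply: Rintegral_ge0 => x _; exact: normr_ge0.
  apply: le_trans; rewrite /dot -IntB; last 2 first.
  - by rewrite mulrC; apply: intg_indic.
  - by rewrite mulrC; apply: intg_indic => //; exact: L2_intg.
  have Isu : intg nu (s k - u) by apply: intgB => //; exact: L2_intg.
  apply: Int_abs_le.
  - by apply: intgB; rewrite mulrC; apply: intg_indic => //; exact: L2_intg.
  - exact: intg_abs Isu.
  - move=> x; rewrite !fctE -mulrBr normrM distrC indicE.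
    by case: (_ \in _); rewrite ?normr1 ?normr0 ?mul1r ?mul0r.
exists u; split => //.
  move=> F c mF Fc; apply: (cvgr_to_le (ucvg F mF)); apply: nearW => k.
  by apply: (projK_dot_le (Ps k)) => //; exact: L2_indic.
move=> z Kz; have Lz := KL2 Kz.
have ple k : p k <= dot \1_E u.
  have := nondecreasing_cvgn_le _ (cvgP _ (ucvg _ mE)).
  rewrite (cvg_lim _ (ucvg _ mE))//; apply.
  apply/nondecreasing_seqP => i; have : 0 <= \int[nu]_x `|s i.+1 x - s i x|.
    by apply: Rintegral_ge0 => x _; exact: normr_ge0.
  by rewrite dp /p; lra.
(* The variational inequality for the data [k *: \1_E], with [2 * dot (s k) z <= dot (s k) (s k) +
   dot z z], bounds [k] times the gap independently of [k]. No bound on the L2 norms of the [s k] is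
   involved. *)
have bound k : k%:R * (dot \1_E z - dot \1_E u) <= dot z z.
  have [_ _ var] := Ps k; have := var _ Kz.
  have LkE : L2 (k%:R *: \1_E) by apply: L2Z.
  have Lzs : L2 (z - s k) by apply: L2B.
  rewrite dotBl// dotZl// !dotBr// => vark.
  have := dot_ge0 nu (z - s k); rewrite dotBl// !dotBr//.
  rewrite (dotC _ z (s k)) => sq.
  have : k%:R * p k <= k%:R * dot \1_E u by rewrite ler_wpM2l.
  have := dot_ge0 nu (s k); have := dot_ge0 nu z.
  rewrite /p; set a := dot \1_E z in vark *; set b := dot \1_E (s k) in vark *.
  rewrite mulrBr in vark; rewrite mulrBr; lra.
rewrite leNgt; apply/negP; rewrite -subr_gt0 => d0.
have := bound (Num.bound (dot z z / (dot \1_E z - dot \1_E u))).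
apply/negP; rewrite -ltNge -ltr_pdivrMr//.
by apply: archi_boundP; rewrite divr_ge0 ?dot_ge0// ltW.
Qed.

End ROF.

(** * Integration on row vectors *)

Section rV_topology.
Context {R : realType} {n : nat}.
Implicit Types x y : 'rV[R]_n.

Lemma le_rV_norm x (e : R) : 0 <= e -> (forall i, `|x ord0 i| <= e) -> `|x| <= e.
Proof.
move=> e0 xe; rewrite [`|x|]mx_normrE; apply/bigmax_leP; split=> // -[i j] _ /=.
by rewrite ord1.
Qed.

Lemma lt_rV_norm x (e : R) : 0 < e -> (forall i, `|x ord0 i| < e) -> `|x| < e.
Proof.
move=> e0 xe; rewrite [`|x|]mx_normrE; apply/bigmax_ltP; split=> // -[i j] _ /=.
by rewrite ord1.
Qed.

Lemma coord_le_norm x i : `|x ord0 i| <= `|x|.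
Proof. by rewrite [leRHS]mx_normrE; exact: (le_bigmax _ _ (ord0, i)). Qed.

Definition box (a : 'rV[R]_n) (r : R) : set 'rV[R]_n :=
  [set x | forall i, `|x ord0 i - a ord0 i| < r].

Lemma boxE a r x : 0 < r -> box a r x <-> `|x - a| < r.
Proof.
move=> r0; split=> [xa|xa i].
  by apply: lt_rV_norm => // i; rewrite !mxE; exact: xa.
by apply: le_lt_trans xa; have := coord_le_norm (x - a) i; rewrite !mxE.
Qed.

Lemma measurable_box a r : measurable (box a r).
Proof.
rewrite (_ : box a r = \bigcap_(i in [set: 'I_n])
    ((fun x : 'rV[R]_n => x ord0 i : measurableTypeR R) @^-1` ball (a ord0 i) r)).
  apply: fin_bigcap_measurable => [|i _]; first exact: finite_finset.
  rewrite -[X in measurable X]setTI; apply: (measurable_coord i) => //.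
  exact: measurable_ball.
by apply/seteqP; split=> x xA i; [move=> _|have := xA i Logic.I];
  rewrite /= /ball/= distrC//; exact: xA.
Qed.

(** The sigma-algebra is generated by the coordinates. An open set is the countable union of the
    boxes it contains with rational centre and radius [1 / (k + 1)]. *)
Lemma open_measurable_rV (O : set 'rV[R]_n) : open O -> measurable O.
Proof.
move=> oO.
pose q2x (q : 'rV[rat]_n) : 'rV[R]_n := \row_i ratr (q ord0 i).
pose F (qk : 'rV[rat]_n * nat) : set 'rV[R]_n :=
  if pselect (box (q2x qk.1) qk.2.+1%:R^-1 `<=` O)
  then box (q2x qk.1) qk.2.+1%:R^-1 else set0.
have -> : O = \bigcup_qk F qk.
  apply/seteqP; split=> [x Ox|x [qk _]]; last first.
    by rewrite /F; case: pselect => // sub; exact: sub.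
  have /nbhs_ballP[e /= e0 eO] : nbhs x O by exact: open_nbhs_nbhs.
  have [k ke] : exists k : nat, k.+1%:R^-1 < e / 2.
    have e2 : 0 < e / 2 by rewrite divr_gt0.
    exists (Num.truncn (e / 2)^-1); rewrite -[ltRHS]invrK ltf_pV2 ?posrE ?invr_gt0//.
    exact: truncnS_gt.
  have kp : 0 < k.+1%:R^-1 :> R by rewrite invr_gt0.
  have /choice[q qP] : forall i, exists q : rat, `|x ord0 i - ratr q| < k.+1%:R^-1.
    move=> i; have : x ord0 i - k.+1%:R^-1 < x ord0 i + k.+1%:R^-1.
      by move: kp; set r := _^-1; lra.
    by move=> /rat_in_itvoo[q]; rewrite in_itv/= => qi; exists q; rewrite distrC ltr_distl.
  exists (\row_i q i, k) => //; rewrite /F; case: pselect => /=.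
    by move=> _ i; rewrite !mxE; exact: qP.
  case=> y /boxE -/(_ kp) yq; apply: eO; rewrite mx_norm_ball /ball_/=.
  have xq : `|x - q2x (\row_i q i)| < k.+1%:R^-1.
    by apply/boxE => // i; rewrite !mxE; exact: qP.
  rewrite -[x](subrK (q2x (\row_i q i))) -addrA (le_lt_trans (ler_normD _ _))//.
  rewrite [in X in _ + X]distrC.
  by move: xq yq ke; set r := _^-1; lra.
apply: countable_bigcupT_measurable => // -[q k]; rewrite /F.
by case: pselect => //= _; exact: measurable_box.
Qed.

Lemma continuous_measurable_rV (f : 'rV[R]_n -> R) : continuous f ->
  measurable_fun [set: 'rV[R]_n] f.
Proof.
move=> /continuousP cf; apply: (measurability _ (RGenOpens.measurableE R)) => //.
move=> _ [_ [a [b ->]] <-]; rewrite setTI.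
by apply: open_measurable_rV; apply: cf; exact: interval_open.
Qed.

End rV_topology.

Section lebesgue_rV.
Context {R : realType}.

Lemma lebesgue_rV_sigma_finite n : sigma_finite [set: lebesgue_type R n] (lebesgue_rV R n).
Proof.
exact: completed_measure_extension_sigma_finite (sigma_finiteT (borel_lebesgue_rV n)).
Qed.

HB.instance Definition _ n := Measure_isSigmaFinite.Build _ _ _
  (lebesgue_rV R n) (@lebesgue_rV_sigma_finite n).

Lemma borel_lebesgueE n (A : set 'rV[R]_n) : measurable A ->
  lebesgue_rV R n A = borel_lebesgue_rV n A.
Proof. exact: measurable_mu_extE. Qed.

Lemma borel_lebesgue_measurable_fun n d (T : measurableType d) (f : 'rV[R]_n -> T) :
  measurable_fun [set: 'rV[R]_n] f -> measurable_fun [set: lebesgue_type R n] f.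
Proof.
by move=> mf _ Y mY; rewrite setTI; apply: borel_lebesgue_measurable; rewrite -[X in measurable X]setTI; exact: mf.
Qed.

(** The identity is measurable from the completed space to the Borel one and pushes [lebesgue_rV]
    forward to the product measure. Integrals of Borel functions can thus be computed one coordinate
    at a time. *)
Lemma ge0_integral_borel_lebesgue n (f : 'rV[R]_n -> \bar R) :
  measurable_fun [set: 'rV[R]_n] f -> (forall x, 0 <= f x)%E ->
  (\int[lebesgue_rV R n]_x f x = \int[borel_lebesgue_rV n]_x f x)%E.
Proof.
move=> mf f0.
have mid : measurable_fun [set: lebesgue_type R n] (@id 'rV[R]_n).
  exact: borel_lebesgue_measurable_fun.
rewrite -[LHS](@ge0_integral_pushforward _ _ _ _ _ _ mid _ setT)//.
by apply: eq_measure_integral => A mA _; exact: borel_lebesgueE.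
Qed.

Lemma integral_borel_lebesgue n (f : 'rV[R]_n -> \bar R) :
  measurable_fun [set: 'rV[R]_n] f ->
  (\int[lebesgue_rV R n]_x f x = \int[borel_lebesgue_rV n]_x f x)%E.
Proof.
move=> mf; rewrite integralE [RHS]integralE.
by rewrite !ge0_integral_borel_lebesgue//; [exact: measurable_funeneg|exact: measurable_funepos].
Qed.

Lemma ge0_integral_rV_succ n (f : 'rV[R]_n.+1 -> \bar R) :
  measurable_fun [set: 'rV[R]_n.+1] f -> (forall x, 0 <= f x)%E ->
  (\int[borel_lebesgue_rV n.+1]_x f x =
   \int[lebesgue_measure]_s \int[borel_lebesgue_rV n]_x f (rV_cons (s, x)))%E.
Proof.
move=> mf f0.
rewrite [LHS](@ge0_integral_pushforward _ _ _ _ _ _ (@measurable_rV_cons R n) _ setT f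
  measurableT mf (fun x _ => f0 x)).
rewrite preimage_setT fubini_tonelli1//=.
by apply: measurableT_comp => //; exact: measurable_rV_cons.
Qed.

Lemma ge0_integral_prod_rV n (g : 'I_n -> R -> R) :
  (forall i, measurable_fun [set: R] (g i)) -> (forall i t, 0 <= g i t) ->
  (\int[borel_lebesgue_rV n]_x (\prod_(i < n) g i (x ord0 i))%:E =
   \prod_(i < n) \int[lebesgue_measure]_t (g i t)%:E)%E.
Proof.
elim: n g => [|n IH] g mg g0.
  rewrite big_ord0 (eq_integral (cst 1%E)); last by move=> x _; rewrite big_ord0.
  by rewrite integral_cst//= diracE mem_set// mul1e.
have mprod m (h : 'I_m -> R -> R) : (forall i, measurable_fun [set: R] (h i)) ->
    measurable_fun [set: 'rV[R]_m] (fun x => \prod_(i < m) h i (x ord0 i)).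
  by move=> mh; apply: measurable_prod => i _; exact: (measurableT_comp (mh i) (measurable_coord i)).
rewrite ge0_integral_rV_succ; first last.
- by move=> x; rewrite lee_fin; exact: prodr_ge0.
- by apply/measurable_EFinP; exact: mprod.
rewrite big_ord_recl -IH//.
have I0 : (0 <= \int[borel_lebesgue_rV n]_x (\prod_(i < n) g (lift ord0 i) (x ord0 i))%:E)%E.
  by apply: integral_ge0 => x _; rewrite lee_fin; exact: prodr_ge0.
rewrite -ge0_integralZr//; first last.
- by move=> t _; rewrite lee_fin.
- by apply/measurable_EFinP; exact: mg.
apply: eq_integral => s _; rewrite -ge0_integralZl//; first last.
- by rewrite lee_fin.
- by move=> x _; rewrite lee_fin; exact: prodr_ge0.
- by apply/measurable_EFinP; apply: (mprod n (fun i => g (lift ord0 i))) => i; exact: mg.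
apply: eq_integral => x _; rewrite -EFinM big_ord_recl rV_cons0; congr (_ * _)%:E.
by apply: eq_bigr => i _; rewrite rV_consS.
Qed.

End lebesgue_rV.

Lemma integrable_bounded_supp d (T : measurableType d) (R : realType)
    (m : {measure set T -> \bar R}) (f : T -> R) (A : set T) (c : R) :
  measurable_fun [set: T] f -> measurable A -> (m A < +oo)%E ->
  (forall x, `|f x| <= c) -> (forall x, ~ A x -> f x = 0) ->
  m.-integrable [set: T] (EFin \o f).
Proof.
move=> mf mA mAoo fc f0.
apply: (@le_intg _ _ _ _ _ (c *: \1_A)) => //.
  move=> x; rewrite !fctE /GRing.scale/= indicE.
  have [Ax|/[dup] /f0 -> nAx] := pselect (A x); first by rewrite mem_set// mulr1.
  by rewrite memNset// mulr0 normr0.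
apply: intgZ.
apply/integrableP; split; first exact/measurable_EFinP/measurable_indic.
rewrite (eq_integral (fun x => (\1_A x)%:E)); last first.
  by move=> x _ /=; rewrite ger0_norm.
by rewrite integral_indic// setIT.
Qed.

(** * Partial derivatives of compactly supported functions have integral zero *)

Section ibp.
Context {R : realType}.

Lemma integral_derive_compact (F F' : R -> R) (M : R) : 0 < M ->
  continuous F -> continuous F' -> (forall s : R, is_derive s 1 F (F' s)) ->
  (forall s, M <= `|s| -> F s = 0 /\ F' s = 0) ->
  (\int[lebesgue_measure]_s (F' s)%:E = 0)%E.
Proof.
move=> M0 cF cF' dF supp.
transitivity (\int[lebesgue_measure]_(s in `[(- M)%R, M]) (F' s)%:E)%E.
  rewrite [RHS]integral_mkcond; apply: eq_integral => s _; rewrite patchE.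
  case: ifPn => //; rewrite notin_setE /= in_itv/= -ler_norml => /negP.
  by rewrite -ltNge => /ltW /supp[_ ->].
rewrite (@continuous_FTC2 _ F' F).
- have -> : F M = 0 by apply: (supp M _).1; rewrite ger0_norm// ltW.
  have -> : F (- M) = 0 by apply: (supp (- M) _).1; rewrite normrN ger0_norm// ltW.
  by rewrite subee.
- lra.
- by apply: continuous_subspaceT.
- split.
  + by move=> s _; case: (dF s).
  + by apply: cvg_at_right_filter; exact: cF.
  + by apply: cvg_at_left_filter; exact: cF.
- by move=> s _; rewrite derive1E; case: (dF s).
Qed.

Lemma rV_consB n (s t : R) (x y : 'rV[R]_n) :
  rV_cons (s, x) - rV_cons (t, y) = rV_cons (s - t, x - y).
Proof. by apply/rowP => i; rewrite !mxE; case: unlift => [j|]; rewrite ?mxE. Qed.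

Lemma rV_cons_norm n (s : R) (x : 'rV[R]_n) :
  `|rV_cons (s, x)| <= Num.max `|s| `|x|.
Proof.
apply: le_rV_norm; first by rewrite le_max normr_ge0.
move=> i; rewrite mxE; case: unlift => [j|]; rewrite le_max ?lexx//.
by rewrite coord_le_norm orbT.
Qed.

Lemma continuous_rV_consl n (x : 'rV[R]_n) : continuous (fun s => rV_cons (s, x)).
Proof.
move=> s; apply/cvgrPdist_le => e e0; near=> t.
rewrite rV_consB subrr (le_trans (rV_cons_norm _ _))// normr0 ge_max (ltW e0) andbT.
by near: t; apply: cvgr_dist_le.
Unshelve. all: by end_near. Qed.

Lemma continuous_rV_consr n (s : R) : continuous (fun x : 'rV[R]_n => rV_cons (s, x)).
Proof.
move=> x; apply/(@cvgrPdist_le _ _ _ (nbhs x) _) => e e0.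
apply: filterS (nbhsx_ballx x _ e0) => y; rewrite mx_norm_ball /ball_ /= => xy.
by rewrite rV_consB subrr (le_trans (rV_cons_norm _ _))// normr0 ge_max (ltW e0) ltW.
Qed.

Lemma rV_cons_shiftl n (s h : R) (x : 'rV[R]_n) :
  rV_cons (h *: 1 + s, x) = h *: delta_mx ord0 ord0 + rV_cons (s, x).
Proof.
apply/rowP => i; rewrite !mxE; have [j|] := unliftP ord0 i => ->.
  by rewrite eqxx /= mulr0 add0r.
by rewrite !eqxx.
Qed.

Lemma rV_cons_shiftr n (s h : R) (x : 'rV[R]_n) (j : 'I_n) :
  rV_cons (s, h *: delta_mx ord0 j + x) =
  h *: delta_mx ord0 (lift ord0 j) + rV_cons (s, x).
Proof.
apply/rowP => i; rewrite !mxE; have [k|] := unliftP ord0 i => ->.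
  by rewrite !mxE (inj_eq lift_inj).
by rewrite eqxx /= mulr0 add0r.
Qed.

Lemma is_derive_rV_consl n (x : 'rV[R]_n) (g : 'rV[R]_n.+1 -> R) (s l : R) :
  is_derive (rV_cons (s, x)) (delta_mx ord0 ord0) g l ->
  is_derive s 1 (fun s => g (rV_cons (s, x))) l.
Proof.
have E : (fun h : R => h^-1 *: (((fun s => g (rV_cons (s, x))) \o shift s) (h *: 1) - g (rV_cons (s, x))))
    = (fun h : R => h^-1 *: ((g \o shift (rV_cons (s, x))) (h *: delta_mx ord0 ord0) - g (rV_cons (s, x)))).
  by apply/funext => h /=; rewrite rV_cons_shiftl.
by case=> dg <-; split; rewrite /derivable /derive E.
Qed.

Lemma is_derive_rV_consr n (s : R) (x : 'rV[R]_n) (j : 'I_n) (g : 'rV[R]_n.+1 -> R) (l : R) :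
  is_derive (rV_cons (s, x)) (delta_mx ord0 (lift ord0 j)) g l ->
  is_derive x (delta_mx ord0 j) (fun x => g (rV_cons (s, x))) l.
Proof.
have E : (fun h : R => h^-1 *: (((fun x => g (rV_cons (s, x))) \o shift x) (h *: delta_mx ord0 j) - g (rV_cons (s, x))))
    = (fun h : R => h^-1 *: ((g \o shift (rV_cons (s, x))) (h *: delta_mx ord0 (lift ord0 j)) - g (rV_cons (s, x)))).
  by apply/funext => h /=; rewrite rV_cons_shiftr.
by case=> dg <-; split; rewrite /derivable /derive E.
Qed.

Lemma box_measure_lty n (r : R) : (borel_lebesgue_rV n (box (0 : 'rV[R]_n) r) < +oo)%E.
Proof.
rewrite (_ : box 0 r = [set x : 'rV[R]_n | forall i, (fun=> ball (0:R) r) i (x ord0 i)]).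
  rewrite (@borel_lebesgue_rV_box R n (fun=> ball (0 : R) r)); last by move=> i; exact: measurable_ball.
  have : (\prod_(i < n) lebesgue_measure (ball (0%R : R) r) \is a fin_num)%E.
    elim/big_ind : _ => // [a b|i _]; first exact: fin_numM.
    have [r0|r0] := leP 0 r; first by rewrite lebesgue_measure_ball.
    by rewrite ((ball0 _ _).2 (ltW r0)) measure0.
  by move/fin_numPlt => /andP[].
by apply/seteqP; split=> x /= xA i; have := xA i; rewrite /ball/= mxE distrC.
Qed.

Lemma compact_continuous_bounded n (C : set 'rV[R]_n) (f : 'rV[R]_n -> R) :
  compact C -> continuous f -> exists c, forall x, C x -> `|f x| <= c.
Proof.
move=> cC cf; have : compact (f @` C) by apply: continuous_compact => //; exact: continuous_subspaceT.
move=> /compact_bounded[M [_ HM]]; exists (M + 1) => x Cx.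
by apply: (HM (M + 1)); [rewrite ltrDl|exists x].
Qed.

Lemma compact_box n (M : R) : compact [set x : 'rV[R]_n | forall i, `|x ord0 i| <= M].
Proof.
rewrite (_ : mkset _ = [set x : 'rV[R]_n | forall i, (fun=> `[(- M), M]%classic) i (x ord0 i)]).
  by apply: (@rV_compact _ n (fun=> `[(- M), M]%classic)) => _; exact: segment_compact.
by apply/seteqP; split=> x /= xM i; have := xM i; rewrite /= in_itv/= -ler_norml.
Qed.

Lemma continuous_bounded_supp n (f : 'rV[R]_n -> R) (M : R) : continuous f ->
  (forall (x : 'rV[R]_n) i, M <= `|x ord0 i| -> f x = 0) -> exists c, forall x, `|f x| <= c.
Proof.
move=> cf f0; have [c fc] := compact_continuous_bounded (@compact_box n M) cf.
exists (Num.max c 0) => x; rewrite le_max.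
have [xM|/existsNP[i /negP]] := pselect (forall i, `|x ord0 i| <= M); first by rewrite fc.
by rewrite -ltNge => /ltW /f0 ->; rewrite normr0 lexx orbT.
Qed.

(** Fubini's theorem, with the order chosen so that the differentiated coordinate lies in the inner
    integral: coordinate 0 falls to the fundamental theorem of calculus, the others to the induction
    hypothesis. *)
Lemma integral_partial_eq0 n (i : 'I_n) (g g' : 'rV[R]_n -> R) (M : R) : 0 < M ->
  continuous g -> continuous g' ->
  (forall x, is_derive x (delta_mx ord0 i) g (g' x)) ->
  (forall (x : 'rV[R]_n) j, M <= `|x ord0 j| -> g x = 0 /\ g' x = 0) ->
  (\int[borel_lebesgue_rV n]_x (g' x)%:E = 0)%E.
Proof.
elim: n i g g' => [[]//|n IH] i g g' M0 cg cg' dg supp.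
have mg' : measurable_fun [set: 'rV[R]_n.+1] g' by exact: continuous_measurable_rV.
have [c g'c] : exists c, forall x, `|g' x| <= c.
  by apply: continuous_bounded_supp cg' _ => x j /supp[].
pose h := g' \o @rV_cons R n.
have mh : measurable_fun setT h by apply: measurableT_comp => //; exact: measurable_rV_cons.
have Ih : (lebesgue_measure \x borel_lebesgue_rV n)%E.-integrable setT (EFin \o h).
  apply: (@integrable_bounded_supp _ _ _ _ _ (@rV_cons R n @^-1` box 0 M) c) => //.
  - by rewrite -[X in measurable X]setTI; apply: measurable_rV_cons => //; exact: measurable_box.
  - exact: (box_measure_lty n.+1 M).
  - by move=> p; exact: g'c.
  - move=> x; rewrite /= /box /= => /existsNP[j /negP]; rewrite -leNgt [X in _ - X]mxE subr0.
    by move=> /supp[].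
have -> : (\int[borel_lebesgue_rV n.+1]_x (g' x)%:E =
           \int[lebesgue_measure \x borel_lebesgue_rV n]_p (h p)%:E)%E.
  rewrite [LHS](@integral_pushforward _ _ _ _ _ _ (@measurable_rV_cons R n) _ setT)//.
  exact/measurable_EFinP.
have [j|] := unliftP ord0 i => ij; subst i.
  rewrite -integral12_prod_meas1//; apply: integral0_eq => s _.
  rewrite /fubini_F /h /=.
  apply: (IH j (fun x => g (rV_cons (s, x))) (fun x => g' (rV_cons (s, x)))) => //.
  - by move=> x; apply: continuous_comp; [exact: continuous_rV_consr|exact: cg].
  - by move=> x; apply: continuous_comp; [exact: continuous_rV_consr|exact: cg'].
  - by move=> x; exact: is_derive_rV_consr.
  - by move=> x k Mx; apply: (supp _ (lift ord0 k)); rewrite rV_consS.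
rewrite -integral21_prod_meas1//; apply: integral0_eq => x _.
rewrite /fubini_G /h /=.
apply: (@integral_derive_compact (fun s => g (rV_cons (s, x))) (fun s => g' (rV_cons (s, x))) M) => //.
- by move=> s; apply: continuous_comp; [exact: continuous_rV_consl|exact: cg].
- by move=> s; apply: continuous_comp; [exact: continuous_rV_consl|exact: cg'].
- by move=> s; exact: is_derive_rV_consl.
- by move=> s Ms; apply: (supp _ ord0); rewrite rV_cons0.
Qed.

End ibp.

(** * Integrals against a density, and finiteness of [mu_] *)

Section density.
Context d (T : measurableType d) (R : realType).
Variables (m nu : {measure set T -> \bar R}) (W : T -> R).
Hypothesis mW : measurable_fun [set: T] W.
Hypothesis W0 : forall x, 0 <= W x.
Hypothesis nuE : forall A, measurable A -> (nu A = \int[m]_(x in A) (W x)%:E)%E.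

Import HBNNSimple.
Local Open Scope ereal_scope.

(** Simple functions and monotone convergence reduce the claim to indicators, where it is [nuE]. *)
Lemma ge0_integral_density (f : T -> \bar R) : measurable_fun [set: T] f ->
  (forall x, 0 <= f x) ->
  \int[nu]_x f x = \int[m]_x (f x * (W x)%:E).
Proof.
move=> mf f0; pose h := nnsfun_approx measurableT mf.
have mWE : measurable_fun [set: T] (EFin \o W) by exact/measurable_EFinP.
have hf x : (EFin \o h n) x @[n --> \oo] --> f x by exact: cvg_nnsfun_approx.
have -> : \int[nu]_x f x = lim (\int[nu]_x (EFin \o h n) x @[n --> \oo]).
  under eq_integral => x _ do rewrite -(cvg_lim _ (hf x))//.
  apply: monotone_convergence => //.
  - by move=> n; exact/measurable_EFinP.
  - by move=> n x _ /=; rewrite lee_fin.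
  - by move=> x _ a b ab; rewrite lee_fin; exact/lefP/nd_nnsfun_approx.
have -> : \int[m]_x (f x * (W x)%:E) =
    lim (\int[m]_x ((EFin \o h n) x * (W x)%:E) @[n --> \oo]).
  have hW x : (EFin \o h n) x * (W x)%:E @[n --> \oo] --> f x * (W x)%:E.
    by apply: cvgeZr => //; exact: hf.
  under eq_integral => x _ do rewrite -(cvg_lim _ (hW x))//.
  apply: monotone_convergence => //.
  - by move=> n; apply: emeasurable_funM => //; exact/measurable_EFinP.
  - by move=> n x _; rewrite mule_ge0 ?lee_fin.
  - move=> x _ a b ab; rewrite lee_wpmul2r ?lee_fin//.
    exact/lefP/nd_nnsfun_approx.
congr (lim (_ @ \oo)); apply/funext => n.
have mpre y : measurable (h n @^-1` [set y]) by rewrite -[X in measurable X]setTI; apply: measurable_funP.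
have mind y : measurable_fun [set: T] (fun x => (y * \1_(h n @^-1` [set y]) x)%:E).
  by apply/measurable_EFinP/measurable_funM.
transitivity (\int[nu]_x
   (\sum_(y \in range (h n)) (y * \1_(h n @^-1` [set y]) x)%:E)).
  by apply: eq_integral => t _; rewrite /= fimfunE -fsumEFin.
rewrite ge0_integral_fsum//; last by move=> y x _; exact: nnfun_muleindic_ge0.
transitivity (\int[m]_x (\sum_(y \in range (h n))
    (y * \1_(h n @^-1` [set y]) x)%:E * (W x)%:E)); last first.
  apply: eq_integral => x _.
  rewrite -ge0_mule_fsuml => [|y]; last exact: nnfun_muleindic_ge0.
  by rewrite fsumEFin // -(fimfunE _ x).
rewrite ge0_integral_fsum//; last 2 first.
- by move=> y; apply: emeasurable_funM.
- by move=> y x _; apply: mule_ge0; [exact: nnfun_muleindic_ge0|rewrite lee_fin].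
apply: eq_fsbigr => y /[!inE] -[t _ hty].
under [LHS]eq_integral do rewrite EFinM.
rewrite [LHS]ge0_integralZl//; first last.
- by rewrite lee_fin -hty.
- exact/measurable_EFinP.
under [RHS]eq_integral do rewrite EFinM -muleA.
rewrite [RHS]ge0_integralZl//; first last.
- by rewrite lee_fin -hty.
- by move=> x _; rewrite mule_ge0// lee_fin.
- by apply: emeasurable_funM => //; exact/measurable_EFinP.
congr (_ * _); rewrite integral_indic// setIT nuE// integral_mkcond.
by apply: eq_integral => x _; rewrite epatch_indic muleC.
Qed.

Lemma intg_density (f : T -> R) : measurable_fun [set: T] f ->
  intg nu f <-> intg m (f * W)%R.
Proof.
move=> mf; have E : \int[nu]_x `|(f x)%:E| = \int[m]_x `|((f * W)%R x)%:E|.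
  rewrite ge0_integral_density//; last exact/measurableT_comp/measurable_EFinP.
  by apply: eq_integral => x _; rewrite fctE EFinM abseM [`|(W x)%:E|]gee0_abs ?lee_fin.
split => /integrableP[_ If]; apply/integrableP; split.
- exact/measurable_EFinP/measurable_funM.
- by rewrite -E.
- exact/measurable_EFinP.
- by rewrite E.
Qed.

Lemma Int_density (f : T -> R) : measurable_fun [set: T] f ->
  (\int[nu]_x f x)%R = (\int[m]_x (f * W)%R x)%R.
Proof.
move=> mf; rewrite /Rintegral; congr fine; rewrite integralE [RHS]integralE.
have mfE : measurable_fun [set: T] (EFin \o f) by exact/measurable_EFinP.
rewrite !ge0_integral_density//; last 2 first.
- exact: measurable_funeneg.
- exact: measurable_funepos.
congr (_ - _); apply: eq_integral => x _.
  rewrite !funeposE fctE EFinM.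
  have [f0|f0] := leP 0%R (f x).
    by rewrite !max_l// ?mule_ge0 ?lee_fin.
  by rewrite !max_r ?mul0e ?mule_le0_ge0 ?lee_fin ?(ltW f0).
rewrite !funenegE fctE EFinM.
have [f0|f0] := leP 0%R (f x).
  by rewrite !max_r ?mul0e ?oppe_le0 ?mule_ge0 ?lee_fin.
by rewrite !max_l ?mulNe ?oppe_ge0 ?mule_le0_ge0 ?lee_fin ?(ltW f0).
Qed.

End density.

Lemma Gamma_ge0 (R : realType) (s : R) : 0 <= Gamma s.
Proof. by apply: Rintegral_ge0 => t _; rewrite mulr_ge0 ?powR_ge0 ?expR_ge0. Qed.

Section mu_finite.
Context {R : realType} {d : nat}.
Variable alpha : 'I_d -> R.

Definition weight (x : 'rV[R]_d) : R := omega alpha x * \1_orthant x.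

Lemma weight_ge0 x : 0 <= weight x.
Proof. by rewrite mulr_ge0// omega_ge0. Qed.

Lemma measurable_weight : measurable_fun [set: lebesgue_type R d] weight.
Proof.
apply: measurable_funM; first exact: measurable_omega.
exact/measurable_indic/measurable_orthant.
Qed.

Lemma mu_weight A : measurable A ->
  (mu_ alpha A = \int[lebesgue_rV R d]_(x in A) (weight x)%:E)%E.
Proof.
move=> mA; rewrite /mu_ integral_mkcondr; apply: eq_integral => x _.
rewrite patchE /weight indicE; case: ifPn => _; rewrite ?mulr1 ?mulr0//.
Qed.

Let g (i : 'I_d) (t : R) : R :=
  (t `^ alpha i * expR (- t) / Gamma (alpha i + 1)) * \1_(`]0, +oo[%classic) t.

Let mpow (i : 'I_d) : measurable_fun [set: R] (fun t : R => t `^ alpha i * expR (- t)).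
Proof.
apply: measurable_funM; first exact: measurable_powR.
by apply: measurableT_comp => //; apply: measurableT_comp.
Qed.

Let mg i : measurable_fun [set: R] (g i).
Proof. by apply: measurable_funM => //; apply: measurable_funM => //; exact: mpow. Qed.

Let g0 i t : 0 <= g i t.
Proof.
by rewrite mulr_ge0// divr_ge0 ?Gamma_ge0// mulr_ge0 ?powR_ge0 ?expR_ge0.
Qed.

Let g_fin i : (\int[lebesgue_measure]_t (g i t)%:E < +oo)%E.
Proof.
set I := (\int[lebesgue_measure]_(t in `]0%R, +oo[) (t `^ alpha i * expR (- t))%:E)%E.
have GI : Gamma (alpha i + 1) = fine I.
  by rewrite /Gamma /I; under eq_Rintegral do rewrite addrK.
have I0 : (0 <= I)%E by apply: integral_ge0 => t _; rewrite lee_fin mulr_ge0 ?powR_ge0 ?expR_ge0.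
have gE : (\int[lebesgue_measure]_t (g i t)%:E = I * (Gamma (alpha i + 1))^-1%:E)%E.
  rewrite -ge0_integralZr//; last 3 first.
  - by apply/measurable_EFinP; apply: measurable_funTS; exact: mpow.
  - by move=> t _; rewrite lee_fin mulr_ge0 ?powR_ge0 ?expR_ge0.
  - rewrite lee_fin invr_ge0 GI fine_ge0//.
  rewrite [RHS]integral_mkcond; apply: eq_integral => t _.
  by rewrite patchE /g indicE; case: ifPn => _; rewrite ?mulr1 ?mulr0.
(* If the integral diverges, [Gamma] is [fine +oo], that is 0; its inverse is then 0 as well, and
   the product of [+oo] and 0 is 0. *)
rewrite gE GI {gE GI}; case: I I0 => [r| |] I0 //=.
- by rewrite -EFinM ltry.
- by rewrite invr0 mule0 ltry.
Qed.

Lemma mu_lty : (mu_ alpha [set: 'rV[R]_d] < +oo)%E.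
Proof.
rewrite mu_weight//.
have wE x : weight x = \prod_(i < d) g i (x ord0 i).
  rewrite /weight /omega /g [RHS]big_split/=; congr (_ * _).
  rewrite indicE; have [ox|ox] := pselect (orthant x).
    rewrite mem_set// big1// => i _; rewrite indicE mem_set//= in_itv/= andbT.
    exact: ox.
  rewrite memNset//; move/existsNP : ox => [i /negP nx].
  rewrite (bigD1 i)//= indicE memNset ?mul0r//= in_itv/= andbT.
  exact/negP.
under eq_integral do rewrite wE.
rewrite ge0_integral_borel_lebesgue; last 2 first.
- apply/measurable_EFinP/measurable_prod => i _.
  exact: (measurableT_comp (mg i) (measurable_coord i)).
- by move=> x; rewrite lee_fin; exact: prodr_ge0.
rewrite ge0_integral_prod_rV//.
have : (\prod_(i < d) \int[lebesgue_measure]_t (g i t)%:E \is a fin_num)%E.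
  elim/big_ind : _ => // [a b|i _]; first exact: fin_numM.
  by rewrite ge0_fin_numE ?g_fin//; apply: integral_ge0 => t _; rewrite lee_fin.
by move/fin_numPlt => /andP[].
Qed.

End mu_finite.

(** * Mollification *)

Section compact_uniform.
Context {R : realType} {n : nat}.
Implicit Types (C U : set 'rV[R]_n) (f : 'rV[R]_n -> R).

(** Continuity is assumed at the points of [C] only, and [y] may lie outside [C]. Balls of half the
    radius form the cover from which compactness extracts a common [r]. *)
Lemma compact_unif_continuous C f : compact C ->
  (forall x, C x -> {for x, continuous f}) ->
  forall e, 0 < e -> exists2 r, 0 < r &
    forall x y, C x -> `|x - y| < r -> `|f x - f y| <= e.
Proof.
move=> cC cf e e0.
have : \forall r \near (0:R)^'+, C `<=` (fun x => forall y, `|x - y| < r -> `|f x - f y| <= e).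
  move/compact_near_coveringP : cC; apply => x Cx.
  have e2 : 0 < e / 2 by rewrite divr_gt0.
  have /cvgrPdist_lt/(_ _ e2)/nbhs_ballP[r /= r0 rf] := cf _ Cx.
  rewrite mx_norm_ball in rf.
  have r2 : 0 < r / 2 by rewrite divr_gt0.
  exists (ball x (r / 2), [set s | 0 < s < r / 2]).
    split; first exact: nbhsx_ballx.
    by apply: filterS2 (nbhs_right_gt _) (nbhs_right_lt r2) => s /= -> ->.
  move=> [z s] /= [+ /andP[s0 sr]] y zy; rewrite mx_norm_ball /ball_/= => xz.
  have fz : `|f x - f z| < e / 2 by apply: rf; rewrite /ball_/=; lra.
  have fy : `|f x - f y| < e / 2.
    apply: rf; rewrite /ball_/= -[x](subrK z) -addrA.
    by rewrite (le_lt_trans (ler_normD _ _))//; lra.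
  have -> : f z - f y = (f x - f y) - (f x - f z) by ring.
  by rewrite (le_trans (ler_normB _ _))//; lra.
move=> h; have [r [rC r0]] := filter_ex (filterI h (nbhs_right_gt (0:R))).
by exists r => // x y Cx; exact: rC.
Qed.

Lemma compact_sub_open C U : compact C -> open U -> C `<=` U ->
  exists2 r, 0 < r & forall x y, C x -> `|x - y| < r -> U y.
Proof.
move=> cC oU CU.
have : \forall r \near (0:R)^'+, C `<=` (fun x => forall y, `|x - y| < r -> U y).
  move/compact_near_coveringP : cC; apply => x Cx.
  have /nbhs_ballP[r /= r0 rf] : nbhs x U by apply: open_nbhs_nbhs; split => //; exact: CU.
  rewrite mx_norm_ball in rf.
  have r2 : 0 < r / 2 by rewrite divr_gt0.
  exists (ball x (r / 2), [set s | 0 < s < r / 2]).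
    split; first exact: nbhsx_ballx.
    by apply: filterS2 (nbhs_right_gt _) (nbhs_right_lt r2) => s /= -> ->.
  move=> [z s] /= [+ /andP[s0 sr]] y zy; rewrite mx_norm_ball /ball_/= => xz.
  apply: rf; rewrite /ball_/= -[x](subrK z) -addrA.
  by rewrite (le_lt_trans (ler_normD _ _))//; lra.
move=> h; have [r [rC r0]] := filter_ex (filterI h (nbhs_right_gt (0:R))).
by exists r => // x y Cx; exact: rC.
Qed.

Lemma compact_supp_unif_continuous C f : compact C -> continuous f ->
  (forall x, ~ C x -> f x = 0) ->
  forall e, 0 < e -> exists2 r, 0 < r &
    forall x y, `|x - y| < r -> `|f x - f y| <= e.
Proof.
move=> cC cf f0 e e0.
have [r r0 rf] := compact_unif_continuous cC (fun x _ => cf x) e0.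
exists r => // x y xy; have [Cx|Cx] := pselect (C x); first exact: rf.
have [Cy|Cy] := pselect (C y); last by rewrite !f0// subrr normr0 ltW.
by rewrite distrC; apply: rf => //; rewrite distrC.
Qed.

Lemma rV_continuous f :
  (forall x e, 0 < e -> exists2 r, 0 < r & forall y, `|x - y| < r -> `|f x - f y| <= e) ->
  continuous f.
Proof.
move=> h x; apply/(@cvgrPdist_le _ _ _ (nbhs x) _) => e e0.
have [r r0 rf] := h x _ e0.
by apply: filterS (nbhsx_ballx x _ r0) => y; rewrite mx_norm_ball => /rf.
Qed.

End compact_uniform.

(** * Directional derivatives and one-variable profiles *)

(** A directional derivative depends only on the restriction to a line. This converts derivatives in
    a coordinate direction into derivatives of one real variable, and back. *)
Lemma is_derive_line (R : realType) (V W : normedModType R) (F : W -> R) (f : V -> R)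
    (s w : W) (x v : V) (a : R) :
  (forall h : R, f (h *: v + x) = F (h *: w + s)) -> f x = F s ->
  is_derive s w F a -> is_derive x v f a.
Proof.
move=> fF fF0 [dF <-].
have E : (fun h : R => h^-1 *: ((f \o shift x) (h *: v) - f x)) =
         (fun h : R => h^-1 *: ((F \o shift s) (h *: w) - F s)).
  by apply/funext => h /=; rewrite fF fF0.
by split; rewrite /derivable /derive E.
Qed.

Section pointwise_derive.
Context {R : realType} {V : normedModType R}.
Implicit Types (f g : V -> R) (x v : V) (a b : R).

Lemma is_derive_pow f x v n a : is_derive x v f a ->
  is_derive x v (fun y => f y ^+ n) (n%:R * f x ^+ n.-1 * a).
Proof. by move=> df; have := is_deriveX n df; rewrite exprfctE. Qed.

Lemma is_derive_mul f g x v a b : is_derive x v f a -> is_derive x v g b ->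
  is_derive x v (fun y => f y * g y) (f x * b + g x * a).
Proof. exact: is_deriveM. Qed.

Lemma is_derive_add f g x v a b : is_derive x v f a -> is_derive x v g b ->
  is_derive x v (fun y => f y + g y) (a + b).
Proof. exact: is_deriveD. Qed.

Lemma is_derive_sub f g x v a b : is_derive x v f a -> is_derive x v g b ->
  is_derive x v (fun y => f y - g y) (a - b).
Proof. exact: is_deriveB. Qed.

Lemma is_derive_mulr f x v a c : is_derive x v f a ->
  is_derive x v (fun y => f y * c) (a * c).
Proof.
move=> df; have := is_derive_mul df (is_derive_cst (c : R) x v).
by rewrite mulr0 add0r mulrC.
Qed.

(** Only a directional derivative of [f] is assumed: on the line through [x] this is the chain rule
    in one variable. *)
Lemma is_derive_outer (phi : R -> R) f x v a b : is_derive (f x) 1 phi a ->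
  is_derive x v f b -> is_derive x v (fun y => phi (f y)) (a * b).
Proof.
move=> dphi df.
have df0 : is_derive (0 : R) 1 (fun h : R => f (h *: v + x)) b.
  apply: (is_derive_line _ _ df) => [h|]; last by rewrite scale0r add0r.
  by rewrite addr0 /GRing.scale/= mulr1.
have dphi0 : is_derive (f (0 *: v + x)) 1 phi a by rewrite scale0r add0r.
have := is_derive1_comp dphi0 df0.
apply: is_derive_line => [h|]; last by rewrite /= scale0r add0r.
by rewrite /= addr0 /GRing.scale/= mulr1.
Qed.

End pointwise_derive.

Section one_dim.
Context {R : realType}.

Definition pos (s : R) := Num.max s 0.

Lemma pos_ge0 s : 0 <= pos s. Proof. by rewrite le_max lexx orbT. Qed.

Lemma continuous_pos : continuous pos.
Proof. by move=> s; apply: continuous_max; [exact: cvg_id|exact: cvg_cst]. Qed.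

(** At 0 the difference quotient is at most [|h| ^+ k.+1] in absolute value; elsewhere the function
    is locally 0 or a power. *)
Lemma is_derive_pos k (s : R) :
  is_derive s 1 (fun s => pos s ^+ k.+2) (k.+2%:R * pos s ^+ k.+1).
Proof.
have [s0|s0|->] := ltgtP s 0.
- have -> : k.+2%:R * pos s ^+ k.+1 = 0.
    by rewrite /pos max_r ?expr0n ?mulr0// ltW.
  apply: (@near_eq_is_derive _ _ _ (cst 0)).
  near=> t; rewrite /pos max_r ?expr0n// ltW//; near: t; exact: lt_nbhsl.
- rewrite /pos (max_l (ltW s0)).
  have h : is_derive s 1 (fun t : R => t ^+ k.+2) (k.+2%:R * s ^+ k.+1).
    by have := is_derive_pow k.+2 (is_derive_id s 1); rewrite mulr1.
  apply: near_eq_is_derive h.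
  by near=> t; rewrite max_l// ltW//; near: t; exact: lt_nbhsr.
- rewrite /pos maxxx expr0n mulr0.
  have cv : (fun h : R => h^-1 *: ((fun s : R => Num.max s 0 ^+ k.+2) (h *: (1 : R) + (0 : R)) -
      (fun s : R => Num.max s 0 ^+ k.+2) (0 : R))) @ 0^' --> (0:R).
    apply/cvgrPdist_le => e e0; near=> h.
    rewrite /= maxxx expr0n subr0 addr0 sub0r normrN /GRing.scale/= mulr1.
    have h0 : h != 0 by near: h; exact: nbhs_dnbhs_neq.
    have h1 : `|h| <= Num.min e 1.
      near: h; apply/nbhs_ballP; exists (Num.min e 1) => /=.
        by rewrite lt_min e0 ltr01.
      by move=> t; rewrite /ball/= sub0r normrN => /ltW.
    move: h1; rewrite le_min => /andP[he h1].
    rewrite normrM normfV normrX exprS mulrA.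
    have ph : `|Num.max h 0| <= `|h| by have [|] := leP h 0; rewrite ?normr0.
    have -> : e = e * 1 by rewrite mulr1.
    rewrite exprS mulrA; apply: ler_pM => //.
    + apply: le_trans he; rewrite -mulrA ler_pdivrMl ?normr_gt0//.
      exact: ler_pM.
    + by rewrite exprn_ile1// (le_trans ph).
  by apply: DeriveDef; [apply/cvg_ex; eexists; exact: cv|exact/cvg_lim].
Unshelve. all: by end_near. Qed.

End one_dim.

Lemma is_derive_inv (R : realType) (V : normedModType R) (f : V -> R) (x v : V) (a : R) :
  f x != 0 -> is_derive x v f a ->
  is_derive x v (fun y => (f y)^-1) (- a / f x ^+ 2).
Proof.
move=> fx0 [df <-]; split; first exact: derivableV.
by rewrite deriveV// /GRing.scale/= mulNr mulrC mulNr.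
Qed.

Lemma cvgX (R : realType) (T : Type) (F : set_system T) (FF : Filter F) (f : T -> R) (a : R) n :
  f @ F --> a -> (fun x => f x ^+ n) @ F --> a ^+ n.
Proof.
move=> fa; elim: n => [|n IH]; first exact: cvg_cst.
by rewrite exprS; under eq_fun do rewrite exprS; exact: cvgM.
Qed.

Lemma continuous_prod (R : realType) (T : topologicalType) (I : eqType) (r : seq I) (P : pred I)
    (F : I -> T -> R) : (forall i, continuous (F i)) ->
  continuous (fun x => \prod_(i <- r | P i) F i x).
Proof.
move=> cF; elim: r => [|i r IH].
  rewrite (_ : (fun _ => _) = cst 1); first exact: cst_continuous.
  by apply/funext => x; rewrite big_nil.
rewrite (_ : (fun _ => _) = (fun x => (if P i then F i x else 1) * \prod_(i <- r | P i) F i x)).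
  move=> x; apply: cvgM; last exact: IH.
  by case: (P i); [exact: cF|exact: cvg_cst].
by apply/funext => x; rewrite big_cons; case: (P i); rewrite ?mul1r.
Qed.

Section eta.
Context {R : realType}.
Implicit Types s t : R.

(* A smoothed positive part; its derivative [eta] is of class C^1 with values in
   [0, 1], which makes it usable as a weight between two test fields. *)
Definition ramp s : R := pos s ^+ 3 / (2 * (1 + pos s ^+ 2)).
Definition eta s : R := (3 * pos s ^+ 2 + pos s ^+ 4) / (2 * (1 + pos s ^+ 2) ^+ 2).
Definition deta s : R := (3 - pos s ^+ 2) * pos s / (1 + pos s ^+ 2) ^+ 3.

Lemma pos_sqr_gt0 s : 0 < 1 + pos s ^+ 2.
Proof. by rewrite ltr_pwDl// sqr_ge0. Qed.

Lemma is_derive_pos_sqr s : is_derive s 1 (fun s => 1 + pos s ^+ 2) (2 * pos s).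
Proof.
have := is_derive_add (is_derive_cst (1 : R) s 1) (is_derive_pos 0 s).
by rewrite add0r expr1.
Qed.

Lemma is_derive_ramp s : is_derive s 1 ramp (eta s).
Proof.
have q0 := pos_sqr_gt0 s.
have d1 := is_derive_mul (is_derive_cst (2 : R) s 1) (is_derive_pos_sqr s).
have d2 := @is_derive_inv _ _ _ _ _ _ _ d1.
have := is_derive_mul (is_derive_pos 1 s) (d2 _).
rewrite /cst/= => /(_ _)/is_derive_eq; apply; first by rewrite mulf_neq0// gt_eqF.
rewrite /eta; field; by rewrite gt_eqF.
Qed.

Lemma is_derive_eta s : is_derive s 1 eta (deta s).
Proof.
have q0 := pos_sqr_gt0 s.
have d1 := is_derive_mul (is_derive_cst (2 : R) s 1) (is_derive_pow 2 (is_derive_pos_sqr s)).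
have d2 := @is_derive_inv _ _ _ _ _ _ _ d1.
have d3 := is_derive_add (is_derive_mul (is_derive_cst (3 : R) s 1) (is_derive_pos 0 s))
  (is_derive_pos 2 s).
have := is_derive_mul d3 (d2 _).
rewrite /cst/= => /(_ _)/is_derive_eq; apply; first by rewrite mulf_neq0// expf_neq0// gt_eqF.
rewrite /deta; field; by rewrite gt_eqF.
Qed.

Lemma continuous_deta : continuous deta.
Proof.
move=> s; apply: cvgM.
  apply: cvgM; last exact: continuous_pos.
  by apply: cvgB; [exact: cvg_cst|apply: cvgX; exact: continuous_pos].
apply: cvgV; first by rewrite expf_neq0// gt_eqF// pos_sqr_gt0.
by apply: cvgX; apply: cvgD; [exact: cvg_cst|apply: cvgX; exact: continuous_pos].
Qed.

(** The maximum is 9/16, at [pos s ^+ 2 = 3]; without the factor 2 in [ramp] it would be 9/8, too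
    large for a weight. *)
Lemma eta_itv s : 0 <= eta s <= 1.
Proof.
have q0 := pos_sqr_gt0 s; have p0 : 0 <= pos s ^+ 2 := sqr_ge0 _.
rewrite /eta (_ : pos s ^+ 4 = (pos s ^+ 2) ^+ 2); last by rewrite -exprM.
have q2 : 0 < 2 * (1 + pos s ^+ 2) ^+ 2 by apply: mulr_gt0 => //; exact: exprn_gt0.
apply/andP; split; first by apply: divr_ge0; [nra|exact: ltW].
rewrite ler_pdivrMr//; nra.
Qed.

Lemma ramp_ge0 s : 0 <= ramp s.
Proof. by rewrite divr_ge0// ?exprn_ge0 ?pos_ge0 ?mulr_ge0// ltW// pos_sqr_gt0. Qed.

Lemma ramp_gt0 s : 0 < s -> 0 < ramp s.
Proof.
move=> s0; apply: divr_gt0; last by rewrite mulr_gt0// pos_sqr_gt0.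
by rewrite exprn_gt0// /pos lt_max s0.
Qed.

Lemma ramp_npos s : s <= 0 -> ramp s = 0.
Proof. by move=> s0; rewrite /ramp /pos max_r// expr0n mul0r. Qed.

Lemma continuous_ramp : continuous ramp.
Proof.
by move=> s; apply: differentiable_continuous; apply/derivable1_diffP; case: (is_derive_ramp s).
Qed.

Lemma ramp_lipschitz s t : `|ramp s - ramp t| <= `|s - t|.
Proof.
wlog st : s t / s <= t.
  by move=> h; have [/h//|/ltW/h] := leP s t; rewrite (distrC (ramp t)) (distrC t).
have [c _ Hc] := MVT_segment st (fun x _ => is_derive_ramp x) (continuous_subspaceT continuous_ramp).
rewrite distrC Hc normrM (distrC t) distrC.
have /andP[c0 c1] := eta_itv c.
by rewrite ger0_norm// ler_piMl.
Qed.

Lemma ramp_le s : `|ramp s| <= `|s|.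
Proof. by have := ramp_lipschitz s 0; rewrite (ramp_npos (lexx _)) !subr0. Qed.

End eta.

Section biweight.
Context {R : realType}.
Variable e : R.
Hypothesis e0 : 0 < e.

(* The constant 15 / 16 normalizes the integral to 1. *)
Definition biweight (s : R) : R := 15 / 16 / e * pos (1 - (s / e) ^+ 2) ^+ 2.
Definition dbiweight (s : R) : R :=
  15 / 16 / e * (2 * pos (1 - (s / e) ^+ 2) * (- (2 * (s / e) / e))).

Lemma biweight_ge0 s : 0 <= biweight s.
Proof. by rewrite mulr_ge0 ?sqr_ge0// divr_ge0// ltW. Qed.

Lemma biweightN s : biweight (- s) = biweight s.
Proof. by rewrite /biweight mulNr sqrrN. Qed.

Let pos0 s : e <= `|s| -> pos (1 - (s / e) ^+ 2) = 0.
Proof.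
move=> es; rewrite /pos max_r// subr_le0 -real_normK ?num_real//.
by rewrite exprn_ege1// normrM normfV (gtr0_norm e0) ler_pdivlMr ?mul1r.
Qed.

Lemma biweight_supp s : e <= `|s| -> biweight s = 0.
Proof. by move=> es; rewrite /biweight pos0// expr0n mulr0. Qed.

Lemma dbiweight_supp s : e <= `|s| -> dbiweight s = 0.
Proof. by move=> es; rewrite /dbiweight pos0// mulr0 mul0r mulr0. Qed.

Lemma is_derive_biweight (s : R) : is_derive s 1 biweight (dbiweight s).
Proof.
have d1 : is_derive s 1 (fun s : R => 1 - (s / e) ^+ 2) (- (2 * (s / e) / e)).
  have d2 := is_derive_pow 2 (is_derive_mulr e^-1 (is_derive_id s (1 : R))).
  have := is_derive_sub (is_derive_cst (1 : R) s 1) d2.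
  by move/is_derive_eq; apply; rewrite /= expr1 sub0r mul1r mulrA.
have d2 := is_derive_outer (is_derive_pos 0 _) d1.
have := is_derive_mul (is_derive_cst (15 / 16 / e : R) s 1) d2.
by move/is_derive_eq; apply; rewrite /= mulr0 addr0 expr1.
Qed.

Lemma continuous_biweight : continuous biweight.
Proof.
by move=> s; apply: differentiable_continuous; apply/derivable1_diffP; case: (is_derive_biweight s).
Qed.

Lemma continuous_dbiweight : continuous dbiweight.
Proof.
have cdiv : continuous (fun s : R => s / e).
  by move=> s; apply: cvgM; [exact: cvg_id|exact: cvg_cst].
have cp : continuous (fun s : R => pos (1 - (s / e) ^+ 2)).
  move=> s; apply: (@continuous_comp _ _ _ (fun s : R => 1 - (s / e) ^+ 2) pos); last exact: continuous_pos.
  by apply: cvgB; [exact: cvg_cst|apply: cvgX; exact: cdiv].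
move=> s; apply: cvgM; first exact: cvg_cst.
apply: cvgM; first by apply: cvgM; [exact: cvg_cst|exact: cp].
apply: cvgN; apply: cvgM; last exact: cvg_cst.
by apply: cvgM; [exact: cvg_cst|exact: cdiv].
Qed.

(** The kernel is reflected and centred at [a], as it occurs in a convolution. [B] is the odd
    primitive of [15 / 16 * (1 - u ^+ 2) ^+ 2], and [B 1 = 1 / 2]. *)
Lemma integral_biweight (a : R) : (\int[lebesgue_measure]_t (biweight (a - t))%:E = 1)%E.
Proof.
pose p t : R := 15 / 16 / e * (1 - ((a - t) / e) ^+ 2) ^+ 2.
pose B u : R := 15 / 16 * (u - 2 / 3 * u ^+ 3 + 1 / 5 * u ^+ 5).
pose F t : R := - B ((a - t) / e).
have dB (u : R) : is_derive u 1 B (15 / 16 * (1 - u ^+ 2) ^+ 2).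
  have id_ := is_derive_id u (1 : R).
  have d3 := is_derive_mul (is_derive_cst (2 / 3 : R) u 1) (is_derive_pow 3 id_).
  have d5 := is_derive_mul (is_derive_cst (1 / 5 : R) u 1) (is_derive_pow 5 id_).
  have := is_derive_mul (is_derive_cst (15 / 16 : R) u 1) (is_derive_add (is_derive_sub id_ d3) d5).
  by move/is_derive_eq; apply; rewrite /=; field.
have dF (t : R) : is_derive t 1 F (p t).
  have d1 := is_derive_mulr e^-1 (is_derive_sub (is_derive_cst (a : R) t 1) (is_derive_id t (1 : R))).
  have := is_derive_sub (is_derive_cst (0 : R) t 1) (is_derive_outer (dB _) d1).
  rewrite (_ : (fun y => _ - _) = F); last by apply/funext => y; rewrite /F /= sub0r.
  by move/is_derive_eq; apply; rewrite /p /=; field; rewrite gt_eqF.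
have cF : continuous F.
  by move=> t; apply: differentiable_continuous; apply/derivable1_diffP; case: (dF t).
have cp : continuous p.
  move=> t; apply: cvgM; first exact: cvg_cst.
  apply: cvgX; apply: cvgB; first exact: cvg_cst.
  apply: cvgX; apply: cvgM; last exact: cvg_cst.
  by apply: cvgB; [exact: cvg_cst|exact: cvg_id].
transitivity (\int[lebesgue_measure]_(t in `[(a - e)%R, (a + e)%R]) (p t)%:E)%E.
  rewrite [RHS]integral_mkcond; apply: eq_integral => t _; rewrite patchE.
  case: ifPn.
    rewrite inE /= in_itv/= => /andP[at1 at2]; congr EFin; rewrite /biweight /p /pos max_l//.
    rewrite subr_ge0 -real_normK ?num_real// exprn_ile1// normrM normfV (gtr0_norm e0).
    by rewrite ler_pdivrMr// mul1r ler_norml; lra.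
  rewrite notin_setE /= in_itv/= => nt; rewrite biweight_supp//.
  rewrite leNgt; apply/negP => h; apply: nt; move: h; rewrite ltr_norml => /andP[? ?].
  by apply/andP; split; lra.
rewrite (@continuous_FTC2 _ p F).
- rewrite -EFinB; congr EFin; rewrite /F /B.
  have -> : (a - (a + e)) / e = - 1 by field; rewrite gt_eqF.
  have -> : (a - (a - e)) / e = 1 by field; rewrite gt_eqF.
  by field.
- by rewrite ltrBlDr -addrA ltrDl addr_gt0.
- exact: continuous_subspaceT.
- split.
  + by move=> t _; case: (dF t).
  + by apply: cvg_at_right_filter; exact: cF.
  + by apply: cvg_at_left_filter; exact: cF.
- by move=> t _; rewrite derive1E; case: (dF t).
Qed.

End biweight.

Section pointwise_continuous.
Context {R : realType} {T : topologicalType}.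
Implicit Types f g : T -> R.

Lemma continuous_mul f g : continuous f -> continuous g ->
  continuous (fun x => f x * g x).
Proof. by move=> cf cg x; apply: cvgM; [exact: cf|exact: cg]. Qed.

Lemma continuous_add f g : continuous f -> continuous g ->
  continuous (fun x => f x + g x).
Proof. by move=> cf cg x; apply: cvgD; [exact: cf|exact: cg]. Qed.

Lemma continuous_sub f g : continuous f -> continuous g ->
  continuous (fun x => f x - g x).
Proof. by move=> cf cg x; apply: cvgB; [exact: cf|exact: cg]. Qed.

Lemma continuous_opp f : continuous f -> continuous (fun x => - f x).
Proof. by move=> cf x; apply: cvgN; exact: cf. Qed.

Lemma continuous_norm f : continuous f -> continuous (fun x => `|f x|).
Proof. by move=> cf x; apply: cvg_norm; exact: cf. Qed.

Lemma continuous_fun_comp f (phi : R -> R) : continuous phi -> continuous f ->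
  continuous (fun x => phi (f x)).
Proof. by move=> cphi cf x; apply: (@continuous_comp _ _ _ f phi); [exact: cf|exact: cphi]. Qed.

End pointwise_continuous.

Section C1.
Context {R : realType} {n : nat}.
Implicit Types (f g h k : 'rV[R]_n -> R) (dg dh dk : 'I_n -> 'rV[R]_n -> R).

(** The partial derivatives are carried as explicit functions, so that products, compositions and
    convolutions return the formulas to be integrated. *)
Definition C1 g dg := [/\ continuous g, forall i, continuous (dg i) &
  forall i x, is_derive x (delta_mx ord0 i) g (dg i x)].

Lemma C1_cst (c : R) : C1 (cst c) (fun _ => cst 0).
Proof. by split=> [|i|i x]; [exact: cst_continuous|exact: cst_continuous|exact: is_derive_cst]. Qed.

Lemma C1M g dg h dh : C1 g dg -> C1 h dh ->
  C1 (fun x => g x * h x) (fun i x => g x * dh i x + h x * dg i x).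
Proof.
move=> [cg cdg dgE] [ch cdh dhE]; split=> [|i|i x].
- exact: continuous_mul.
- by apply: continuous_add; apply: continuous_mul.
- exact: is_derive_mul.
Qed.

Lemma C1D g dg h dh : C1 g dg -> C1 h dh ->
  C1 (fun x => g x + h x) (fun i x => dg i x + dh i x).
Proof.
move=> [cg cdg dgE] [ch cdh dhE]; split=> [|i|i x].
- exact: continuous_add.
- exact: continuous_add.
- exact: is_derive_add.
Qed.

Lemma C1B g dg h dh : C1 g dg -> C1 h dh ->
  C1 (fun x => g x - h x) (fun i x => dg i x - dh i x).
Proof.
move=> [cg cdg dgE] [ch cdh dhE]; split=> [|i|i x].
- exact: continuous_sub.
- exact: continuous_sub.
- exact: is_derive_sub.
Qed.

Lemma C1_comp (phi dphi : R -> R) g dg : continuous dphi ->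
  (forall s : R, is_derive s 1 phi (dphi s)) -> C1 g dg ->
  C1 (fun x => phi (g x)) (fun i x => dphi (g x) * dg i x).
Proof.
move=> cdphi dphiE [cg cdg dgE].
have cphi : continuous phi.
  by move=> s; apply: differentiable_continuous; apply/derivable1_diffP; case: (dphiE s).
split=> [|i|i x].
- exact: continuous_fun_comp.
- by apply: continuous_mul => //; exact: continuous_fun_comp.
- exact: is_derive_outer.
Qed.

Lemma continuous_subl f (x : 'rV[R]_n) : continuous f -> continuous (fun y : 'rV[R]_n => f (x - y)).
Proof.
move=> cf; apply: rV_continuous => y e e0.
have /cvgrPdist_le/(_ _ e0)/nbhs_ballP[r /= r0 rf] := cf (x - y).
exists r => // z yz; apply: rf; rewrite mx_norm_ball /ball_/= opprB addrC addrA subrK.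
by rewrite distrC.
Qed.

Lemma C1_subl g dg (x : 'rV[R]_n) : C1 g dg ->
  C1 (fun y => g (x - y)) (fun i y => - dg i (x - y)).
Proof.
move=> [cg cdg dgE]; split=> [|i|i y].
- exact: continuous_subl.
- by apply/continuous_opp/continuous_subl.
- have d1 : is_derive (0 : R) 1 (fun h : R => g (h *: delta_mx ord0 i + (x - y))) (dg i (x - y)).
    apply: is_derive_line (dgE i (x - y)) => [h|]; last by rewrite scale0r add0r.
    by rewrite addr0 /GRing.scale/= mulr1.
  have d1' : is_derive (- (0 : R)) 1 (fun h : R => g (h *: delta_mx ord0 i + (x - y))) (dg i (x - y)).
    by rewrite oppr0.
  have d2 := is_derive_outer d1' (is_deriveNid (0 : R) 1).
  rewrite -[X in is_derive _ _ _ X]mulrN1; apply: is_derive_line d2 => [h|].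
    by rewrite -[h *: 1]/(h * 1) mulr1 addr0 scaleNr opprD addrCA.
  by rewrite oppr0 scale0r add0r.
Qed.

End C1.

Section kernel.
Context {R : realType} {n : nat}.
Variable e : R.
Hypothesis e0 : 0 < e.

(** A product kernel: its integral splits into one-variable integrals, and it vanishes off a cube,
    which is a ball of the norm of row vectors. *)
Definition ker (x : 'rV[R]_n) : R := \prod_(i < n) biweight e (x ord0 i).
Definition dker (i : 'I_n) (x : 'rV[R]_n) : R :=
  dbiweight e (x ord0 i) * \prod_(j < n | j != i) biweight e (x ord0 j).

Lemma continuous_coordf (f : R -> R) (i : 'I_n) : continuous f ->
  continuous (fun x : 'rV[R]_n => f (x ord0 i)).
Proof.
by move=> cf; apply: continuous_fun_comp => //; exact: coord_continuous.
Qed.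

Lemma C1_ker : C1 ker dker.
Proof.
split=> [|i|i x].
- by apply: continuous_prod => i; apply: continuous_coordf; exact: continuous_biweight.
- apply: continuous_mul; first exact/continuous_coordf/continuous_dbiweight.
  by apply: continuous_prod => j; apply: continuous_coordf; exact: continuous_biweight.
- pose c := \prod_(j < n | j != i) biweight e (x ord0 j).
  apply: (@is_derive_line _ _ _ (fun s => biweight e s * c) _ (x ord0 i) 1).
  + move=> h; rewrite /ker (bigD1 i)//= !mxE !eqxx mulr1; congr (_ * _).
      by rewrite /GRing.scale/= mulr1.
    by apply: eq_bigr => j ji; rewrite !mxE (negbTE ji) mulr0 add0r.
  + by rewrite /ker (bigD1 i).
  + by apply: is_derive_mulr; exact: is_derive_biweight.
Qed.

Lemma ker_ge0 x : 0 <= ker x.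
Proof. by apply: prodr_ge0 => i _; exact: biweight_ge0. Qed.

Lemma kerN x : ker (- x) = ker x.
Proof. by apply: eq_bigr => i _; rewrite mxE biweightN. Qed.

Lemma ker_supp (x : 'rV[R]_n) i : e <= `|x ord0 i| -> ker x = 0.
Proof. by move=> xi; rewrite /ker (bigD1 i)//= biweight_supp// mul0r. Qed.

Lemma dker_supp j (x : 'rV[R]_n) i : e <= `|x ord0 i| -> dker j x = 0.
Proof.
move=> xi; rewrite /dker; have [<-|ij] := eqVneq i j.
  by rewrite dbiweight_supp ?mul0r.
by rewrite (bigD1 i)//= biweight_supp// mul0r mulr0.
Qed.

Lemma norm_supp (f : 'rV[R]_n -> R) r : 0 < r ->
  (forall (x : 'rV[R]_n) i, r <= `|x ord0 i| -> f x = 0) -> forall x : 'rV[R]_n, r <= `|x| -> f x = 0.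
Proof.
move=> r0 f0 x rx; apply: contrapT => fx; move: rx; apply/negP; rewrite -ltNge.
apply: lt_rV_norm => // i; rewrite ltNge; apply/negP => xi.
exact/fx/f0/xi.
Qed.

Lemma measurable_ker_sub x : measurable_fun [set: 'rV[R]_n] (fun y => ker (x - y)).
Proof.
apply: continuous_measurable_rV; have [c _ _] := C1_subl x C1_ker; exact: c.
Qed.

Lemma integral_ker x : (\int[lebesgue_rV R n]_y (ker (x - y))%:E = 1)%E.
Proof.
rewrite ge0_integral_borel_lebesgue; last 2 first.
- by apply/measurable_EFinP; exact: measurable_ker_sub.
- by move=> y; rewrite lee_fin ker_ge0.
transitivity (\int[borel_lebesgue_rV n]_y
    (\prod_(i < n) (fun t => biweight e (x ord0 i - t)) (y ord0 i))%:E)%E.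
  by apply: eq_integral => y _; congr EFin; apply: eq_bigr => i _; rewrite !mxE.
rewrite (@ge0_integral_prod_rV R n (fun i t => biweight e (x ord0 i - t))).
- by rewrite big1// => i _; exact: integral_biweight.
- move=> i; apply: continuous_measurable_fun => t.
  apply: (@continuous_comp _ _ _ (fun t => x ord0 i - t) (biweight e)); last exact: continuous_biweight.
  by apply: cvgB; [exact: cvg_cst|exact: cvg_id].
- by move=> i t; exact: biweight_ge0.
Qed.

End kernel.

(** * Convolution with compactly supported kernels *)

Section convolution.
Context {R : realType} {n : nat}.
Implicit Types (v k f g : 'rV[R]_n -> R) (x y : 'rV[R]_n).

Local Notation L := (lebesgue_rV R n).

Definition lintg v := @intg _ (lebesgue_type R n) R L v.

Definition convol k v x : R := \int[L]_y (v y * k (x - y)).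

(** Continuous functions of compact support, the support being controlled coordinatewise, as in
    [integral_partial_eq0]. *)
Definition cc k := continuous k /\
  exists2 M, 0 < M & forall (x : 'rV[R]_n) i, M <= `|x ord0 i| -> k x = 0.

Lemma cc_bounded k : cc k -> exists2 c, 0 <= c & forall x, `|k x| <= c.
Proof.
move=> [ck [M M0 kM]]; have [c kc] := continuous_bounded_supp ck kM.
by exists c => //; rewrite (le_trans (normr_ge0 _) (kc 0)).
Qed.

Lemma cc_unif k : cc k -> forall e, 0 < e -> exists2 r, 0 < r &
  forall x y, `|x - y| < r -> `|k x - k y| <= e.
Proof.
move=> [ck [M M0 kM]]; apply: (compact_supp_unif_continuous (@compact_box _ _ M) ck).
move=> x /= /existsNP[i /negP]; rewrite -ltNge => /ltW; exact: kM.
Qed.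

Lemma measurable_lebesgue f : continuous f ->
  measurable_fun [set: lebesgue_type R n] f.
Proof. by move=> cf; apply: borel_lebesgue_measurable_fun; exact: continuous_measurable_rV. Qed.

Lemma cc_intg k : cc k -> lintg k.
Proof.
move=> kk; have [c c0 kc] := cc_bounded kk; have [ck [M M0 kM]] := kk.
apply: (@integrable_bounded_supp _ _ _ L k (box 0 M) c) => //.
- exact: measurable_lebesgue.
- by apply: borel_lebesgue_measurable; exact: measurable_box.
- by rewrite /= borel_lebesgueE; [exact: box_measure_lty|exact: measurable_box].
- by move=> x /existsNP[i /negP]; rewrite -leNgt mxE subr0; exact: kM.
Qed.

Lemma intg_convE k v x : cc k -> lintg v -> lintg (fun y => v y * k (x - y)).
Proof.
move=> kk Iv; have [c c0 kc] := cc_bounded kk.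
apply: (@intg_bdM _ (lebesgue_type R n) R L v (fun y => k (x - y)) c); [|by move=> y|exact: Iv].
by apply: measurable_lebesgue; apply: continuous_subl; case: kk.
Qed.

Lemma convolDr k v f x : cc k -> lintg v -> lintg f ->
  convol k (v + f) x = convol k v x + convol k f x.
Proof.
move=> kk Iv If; rewrite /convol -RintegralD//; [|exact: intg_convE|exact: intg_convE].
by apply: eq_Rintegral => y _; rewrite fctE mulrDl.
Qed.

Lemma convolBr k v f x : cc k -> lintg v -> lintg f ->
  convol k (v - f) x = convol k v x - convol k f x.
Proof.
move=> kk Iv If; rewrite /convol -RintegralB//; [|exact: intg_convE|exact: intg_convE].
by apply: eq_Rintegral => y _; rewrite fctE mulrBl.
Qed.

Lemma convolZr k v a x : cc k -> lintg v -> convol k (a *: v) x = a * convol k v x.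
Proof.
move=> kk Iv; rewrite /convol -RintegralZl//; last exact: intg_convE.
by apply: eq_Rintegral => y _; rewrite fctE /GRing.scale/= mulrA.
Qed.

Lemma continuous_convol k v : cc k -> lintg v -> continuous (convol k v).
Proof.
move=> kk Iv; apply: rV_continuous => x e e0.
pose I := \int[L]_y `|v y|.
have I0 : 0 <= I by apply: Rintegral_ge0 => y _; exact: normr_ge0.
have eI : 0 < e / (I + 1) by rewrite divr_gt0//; lra.
have [r r0 kr] := cc_unif kk eI.
exists r => // x' xx'; rewrite /convol -RintegralB//; [|exact: intg_convE|exact: intg_convE].
apply: (@le_trans _ _ (\int[L]_y (e / (I + 1) * `|v y|))).
  apply: (@Int_abs_le _ _ _ L).
  - by apply: (@intgB _ _ _ L); exact: intg_convE.
  - exact/intgZ/intg_abs.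
  - move=> y; rewrite -mulrBr normrM mulrC ler_wpM2r//; apply: kr.
    by rewrite opprB addrA subrK.
rewrite (@RintegralZl _ _ _ L)//; last exact: intg_abs.
rewrite -/I mulrAC ler_pdivrMr; last by lra.
by rewrite ler_wpM2l; lra.
Qed.

(** Differentiation under the integral along the line through [x], with the parameter in []-1, 1[]
    and the dominating function [c * |v|]. *)
Lemma is_derive_convol k dk v i x : cc k -> cc dk ->
  (forall x, is_derive x (delta_mx ord0 i) k (dk x)) -> lintg v ->
  is_derive x (delta_mx ord0 i) (convol k v) (convol dk v x).
Proof.
move=> kk kdk dkE Iv; have [c c0 dkc] := cc_bounded kdk.
pose f (t : R) y := v y * k (t *: delta_mx ord0 i + x - y).
have df (t : R) y : is_derive t 1 (f ^~ y) (v y * dk (t *: delta_mx ord0 i + x - y)).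
  have d1 : is_derive t 1 (fun t : R => k (t *: delta_mx ord0 i + x - y))
      (dk (t *: delta_mx ord0 i + x - y)).
    apply: is_derive_line (dkE _) => // h.
    by rewrite -[h *: 1]/(h * 1) mulr1 scalerDl !addrA.
  have := is_derive_mul (is_derive_cst (v y) t (1:R)) d1.
  by move/is_derive_eq; apply; rewrite mulr0 addr0.
have d1E t y : partial1of2 f t y = v y * dk (t *: delta_mx ord0 i + x - y).
  by rewrite partial1of2E; case: (df t y).
have I0 : (`](-1)%R, 1%R[%classic : set R) 0 by rewrite /= in_itv/= ltrN10 ltr01.
have If (t : R) : (`](-1)%R, 1%R[%classic : set R) t -> L.-integrable setT (EFin \o f t).
  by move=> _; exact: intg_convE.
have Df (t : R) y : (`](-1)%R, 1%R[%classic : set R) t -> [set: 'rV[R]_n] y -> derivable (f ^~ y) t 1.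
  by move=> _ _; case: (df t y).
have G0 y : 0 <= c * `|v y| by rewrite mulr_ge0.
have IG : L.-integrable setT (EFin \o (fun y => c * `|v y|)) by exact/intgZ/intg_abs.
have Gub (t : R) y : (`](-1)%R, 1%R[%classic : set R) t -> [set: 'rV[R]_n] y -> `|partial1of2 f t y| <= c * `|v y|.
  by move=> _ _; rewrite d1E normrM mulrC ler_wpM2r.
have dF := derivable_under_integral (measurableT : measurable [set: lebesgue_type R n]) I0 If Df G0 IG Gub.
have dFE := differentiation_under_integral (measurableT : measurable [set: lebesgue_type R n]) I0 If Df G0 IG Gub.
have d0 : is_derive (0 : R) 1 (fun t => convol k v (t *: delta_mx ord0 i + x)) (convol dk v x).
  split => //; rewrite -derive1E dFE; apply: eq_Rintegral => y _.
  by rewrite d1E scale0r add0r.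
apply: is_derive_line d0 => [h|]; last by rewrite scale0r add0r.
by rewrite addr0 -[h *: 1]/(h * 1) mulr1.
Qed.

Lemma C1_convol k dk v : C1 k dk -> cc k -> (forall i, cc (dk i)) -> lintg v ->
  C1 (convol k v) (fun i => convol (dk i) v).
Proof.
move=> [ck cdk dkE] kk kdk Iv; split=> [|i|i x].
- exact: continuous_convol.
- exact: continuous_convol.
- exact: is_derive_convol.
Qed.

Lemma measurable_sub_prod f : continuous f ->
  measurable_fun [set: lebesgue_type R n * lebesgue_type R n]
    (fun p : 'rV[R]_n * 'rV[R]_n => f (p.1 - p.2)).
Proof.
move=> cf; apply: (measurableT_comp (continuous_measurable_rV cf)).
apply: measurable_fun_rV => i; under eq_fun do rewrite !mxE.
apply: measurable_funB.
  exact: (measurableT_comp (measurable_coord_lebesgue i) measurable_fst).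
exact: (measurableT_comp (measurable_coord_lebesgue i) measurable_snd).
Qed.

(** Fubini's theorem and the evenness of [k]; on the product space the integrand is dominated by
    [c * |v y| * |f x|]. It serves to move a mollification from a function to the field that tests
    it. *)
Lemma convol_sym k v f : cc k -> (forall x, k (- x) = k x) -> lintg v -> lintg f ->
  \int[L]_x (convol k v x * f x) = \int[L]_y (v y * convol k f y).
Proof.
move=> kk kN Iv If; have [c c0 kc] := cc_bounded kk.
pose F (p : 'rV[R]_n * 'rV[R]_n) : \bar R := (v p.2 * k (p.1 - p.2) * f p.1)%:E.
have mF : measurable_fun [set: lebesgue_type R n * lebesgue_type R n] F.
  apply/measurable_EFinP; apply: measurable_funM; first apply: measurable_funM.
  - exact: (measurableT_comp (intg_measurable Iv) measurable_snd).
  - by apply: measurable_sub_prod; case: kk.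
  - exact: (measurableT_comp (intg_measurable If) measurable_fst).
have IF : (L \x L)%E.-integrable setT F.
  apply/integrable12ltyP => //.
  have Iav := intg_abs Iv; have Iaf := intg_abs If.
  pose I := \int[L]_y `|v y|.
  have I0 : 0 <= I by apply: Rintegral_ge0 => y _; exact: normr_ge0.
  apply: (@le_lt_trans _ _ (\int[L]_x (I * c * `|f x|)%:E)%E).
    have in0 x : (0 <= \int[L]_y `|F (x, y)|)%E by apply: integral_ge0.
    have inle x : (\int[L]_y `|F (x, y)| <= (I * c * `|f x|)%:E)%E.
      have I1 : lintg (fun y => `|f x| * `|v y * k (x - y)|).
        exact: (@intgZ _ _ _ L `|f x| _ (intg_abs (intg_convE x kk Iv))).
      have I2 : lintg (fun y => c * `|f x| * `|v y|) by exact: (@intgZ _ _ _ L _ _ Iav).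
      rewrite (eq_integral (fun y : lebesgue_type R n => (`|f x| * `|v y * k (x - y)|)%:E)); last first.
        by move=> y _; rewrite /F /= normrM mulrC.
      rewrite (Int_EFin I1) lee_fin.
      apply: (le_trans (le_Int I1 I2 _)) => [y|].
        rewrite normrM (_ : c * _ * _ = `|f x| * (`|v y| * c)); last by ring.
        by rewrite ler_wpM2l// ler_wpM2l.
      by rewrite (@RintegralZl _ _ _ L)// -/I mulrC mulrA.
    have m1 : measurable_fun [set: lebesgue_type R n] (fun x => \int[L]_y `|F (x, y)|)%E.
      apply: (@measurable_fun_fubini_tonelli_F _ _ (lebesgue_type R n) (lebesgue_type R n) _ L (fun p => `|F p|%E)).
        exact: measurableT_comp.
      by [].
    have m2 : measurable_fun [set: lebesgue_type R n] (fun x => (I * c * `|f x|)%:E).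
      apply/measurable_EFinP; apply: measurable_funM; first exact: measurable_cst.
      exact: intg_measurable Iaf.
    apply: ge0_le_integral; [exact: measurableT|by move=> x _; exact: in0|exact: m1|exact: m2|by move=> x _; exact: inle].
  have := Int_EFin (intgZ (I * c) Iaf); rewrite /GRing.scale/= => ->.
  exact: ltry.
have := Fubini IF.
have -> : (\int[L]_x \int[L]_y F (x, y) = \int[L]_x (convol k v x * f x)%:E)%E.
  apply: eq_integral => x _; rewrite /F /=.
  have Ix : lintg (fun y => v y * k (x - y) * f x).
    rewrite (_ : (fun _ => _) = f x *: (fun y => v y * k (x - y))).
      by apply: intgZ; exact: intg_convE.
    by apply/funext => y; rewrite fctE mulrC.
  by rewrite (Int_EFin Ix) (@RintegralZr _ _ _ L)//; exact: intg_convE.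
have -> : (\int[L]_y \int[L]_x F (x, y) = \int[L]_y (v y * convol k f y)%:E)%E.
  apply: eq_integral => y _; rewrite /F /=.
  have Iy : lintg (fun x => v y * (f x * k (y - x))).
    by apply: (@intgZ _ _ _ L (v y) (fun x => f x * k (y - x))); exact: intg_convE.
  transitivity (\int[L]_x (v y * (f x * k (y - x)))%:E)%E.
    by apply: eq_integral => x _; congr EFin; rewrite -(kN (y - x)) opprB; ring.
  by rewrite (Int_EFin Iy) (@RintegralZl _ _ _ L)//; exact: intg_convE.
by move=> h; rewrite /Rintegral h.
Qed.

(** Integration by parts: the partial derivative in [y] of [g y * k (x - y)] has integral 0, which
    moves the derivative from the kernel to [g]. *)
Lemma convol_dker k dk g dg i x : C1 k dk -> cc k -> cc (dk i) -> C1 g dg ->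
  (exists2 M, 0 < M & forall (x : 'rV[R]_n) j, M <= `|x ord0 j| -> g x = 0 /\ dg i x = 0) ->
  convol (dk i) g x = convol k (dg i) x.
Proof.
move=> kk ck cdk gg [M M0 gM].
have cg : cc g by split; [case: gg|exists M => // y j /gM[]].
have cdg : cc (dg i) by split; [case: gg|exists M => // y j /gM[]].
have [c1 c2 c3] := C1M gg (C1_subl x kk).
have := integral_partial_eq0 M0 c1 (c2 i) (c3 i) _.
rewrite -integral_borel_lebesgue; last by apply/measurable_EFinP; apply: continuous_measurable_rV; exact: (c2 i).
have h1 : lintg (fun y => g y * dk i (x - y)) by apply: intg_convE => //; exact: cc_intg.
have h2 : lintg (fun y => dg i y * k (x - y)) by apply: intg_convE => //; exact: cc_intg.
have h12 : lintg (fun y => dg i y * k (x - y) - g y * dk i (x - y)) by exact: (intgB h2 h1).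
have <- : (\int[L]_y (dg i y * k (x - y) - g y * dk i (x - y))%:E =
    \int[L]_y (g y * - dk i (x - y) + k (x - y) * dg i y)%:E)%E.
  by apply: eq_integral => y _; congr EFin; ring.
rewrite (Int_EFin h12) => h.
apply/esym/eqP; rewrite -subr_eq0 /convol -(@RintegralB _ _ _ L)//.
have {}h : (\int[L]_y (dg i y * k (x - y) - g y * dk i (x - y)))%R%:E = 0%E.
  by apply: h => y j /gM[-> ->]; rewrite !(mul0r, mulr0) addr0.
by case: h => ->.
Qed.

End convolution.

(** * L1 convergence of mollifications *)

Section mollification.
Context {R : realType} {n : nat}.
Implicit Types (v k f g : 'rV[R]_n -> R) (x y : 'rV[R]_n).

Local Notation L := (lebesgue_rV R n).

Lemma cc_ker e : 0 < e -> cc (@ker R n e).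
Proof.
move=> e0; split; first by have [? ? ?] := @C1_ker R n e.
by exists e => // x i; exact: ker_supp.
Qed.

Lemma cc_dker e i : 0 < e -> cc (@dker R n e i).
Proof.
move=> e0; split; first by have [? ? ?] := @C1_ker R n e.
by exists e => // x j; exact: dker_supp.
Qed.

Lemma integral_ker_l e y : 0 < e -> (\int[L]_x (ker e (x - y))%:E = 1)%E.
Proof.
move=> e0; rewrite -(integral_ker e0 y); apply: eq_integral => x _.
by rewrite -kerN opprB.
Qed.

Lemma Int_ker e x : 0 < e -> \int[L]_y ker e (x - y) = 1.
Proof. by move=> e0; rewrite /Rintegral integral_ker. Qed.

Lemma lintg_ker e x : 0 < e -> lintg (fun y => ker e (x - y)).
Proof.
move=> e0; apply/integrableP; split.
  by apply/measurable_EFinP; apply: borel_lebesgue_measurable_fun; exact: measurable_ker_sub.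
rewrite (eq_integral (fun y : lebesgue_type R n => (ker e (x - y))%:E)).
  by rewrite integral_ker// ltry.
by move=> y _ /=; rewrite ger0_norm ?ker_ge0.
Qed.

(** Tonelli's theorem and the unit mass of the kernel: mollification is an L1 contraction, which is
    what makes [moll] stable under L1 limits. *)
Lemma convol_ker_le e v : 0 < e -> lintg v ->
  (\int[L]_x `|convol (ker e) v x|%:E <= (\int[L]_y `|v y|)%R%:E)%E.
Proof.
move=> e0 Iv; have kk := cc_ker e0; have Iav := intg_abs Iv.
pose F (p : lebesgue_type R n * lebesgue_type R n) : \bar R :=
  (`|v p.2| * ker e (p.1 - p.2))%:E.
have mF : measurable_fun [set: lebesgue_type R n * lebesgue_type R n] F.
  apply/measurable_EFinP; apply: measurable_funM.
    exact: (measurableT_comp (intg_measurable Iav) measurable_snd).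
  by apply: measurable_sub_prod; case: kk.
have F0 p : (0 <= F p)%E by rewrite lee_fin mulr_ge0 ?ker_ge0.
have FT := @fubini_tonelli _ _ (lebesgue_type R n) (lebesgue_type R n) R L L F mF F0.
have mc : measurable_fun [set: lebesgue_type R n] (fun x => `|convol (ker e) v x|%:E).
  by apply/measurable_EFinP; apply: measurable_lebesgue; apply: continuous_norm; exact: continuous_convol.
have mi : measurable_fun [set: lebesgue_type R n] (fun x => \int[L]_y F (x, y))%E.
  exact: (measurable_fun_fubini_tonelli_F F mF F0).
apply: (@le_trans _ _ (\int[L]_x \int[L]_y F (x, y))%E).
  apply: ge0_le_integral; [exact: measurableT|by move=> x _; rewrite lee_fin|exact: mc|exact: mi|].
  move=> x _; have Ix : lintg (fun y => `|v y| * ker e (x - y)) by exact: intg_convE.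
  rewrite (_ : (\int[L]_y F (x, y))%E = (\int[L]_y (`|v y| * ker e (x - y)))%R%:E); last first.
    by rewrite -(Int_EFin Ix).
  rewrite lee_fin; apply: (@Int_abs_le _ _ _ L _ _ (intg_convE x kk Iv) Ix) => y.
  by rewrite normrM (ger0_norm (ker_ge0 e0 _)).
rewrite FT -(Int_EFin Iav) le_eqVlt; apply/orP; left; apply/eqP.
apply: eq_integral => y _; rewrite /F /=.
have mk : measurable_fun [set: lebesgue_type R n] (fun x => (ker e (x - y))%:E).
  apply/measurable_EFinP.
  rewrite (_ : (fun x => _) = (fun x => ker e (y - x))).
    by apply: borel_lebesgue_measurable_fun; exact: measurable_ker_sub.
  by apply/funext => x; rewrite -kerN opprB.
under eq_integral do rewrite EFinM.
rewrite (ge0_integralZl L measurableT mk).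
- by rewrite (integral_ker_l y e0) mule1.
- by move=> x _; rewrite lee_fin ker_ge0.
- by rewrite lee_fin.
Qed.

Lemma lintg_convol_ker e v : 0 < e -> lintg v -> lintg (convol (ker e) v).
Proof.
move=> e0 Iv; apply/integrableP; split.
  by apply/measurable_EFinP; apply: measurable_lebesgue; apply: continuous_convol => //; exact: cc_ker.
exact: (le_lt_trans (convol_ker_le e0 Iv) (ltry _)).
Qed.

Lemma Int_convol_ker_le e v : 0 < e -> lintg v ->
  \int[L]_x `|convol (ker e) v x| <= \int[L]_y `|v y|.
Proof.
move=> e0 Iv; rewrite -lee_fin -(Int_EFin (intg_abs (lintg_convol_ker e0 Iv))).
exact: convol_ker_le.
Qed.

(** The functions that are L1 limits of their mollifications. The class is enlarged step by step, up
    to all integrable functions that vanish off a box. *)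
Definition moll v := lintg v /\ forall d, 0 < d -> exists2 r, 0 < r &
  forall e, 0 < e -> e < r -> \int[L]_x `|convol (ker e) v x - v x| <= d.

Lemma moll_lim v : lintg v ->
  (forall d, 0 < d -> exists2 f, moll f & \int[L]_x `|v x - f x| <= d) -> moll v.
Proof.
move=> Iv h; split=> // d d0; have d3 : 0 < d / 3 by rewrite divr_gt0.
have [f [If fd] vf] := h _ d3; have [r r0 fr] := fd _ d3.
exists r => // e e0 er; have kk := cc_ker e0.
have Ivf : lintg (v - f) by exact: intgB.
have I1 := intg_abs (lintg_convol_ker e0 Ivf).
have I2 := intg_abs (intgB (lintg_convol_ker e0 If) If).
have I3 := intg_abs Ivf.
apply: (@le_trans _ _ (\int[L]_x ((fun x => `|convol (ker e) (v - f) x|) +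
    (fun x => `|(convol (ker e) f - f) x|) + (fun x => `|(v - f) x|)) x)).
  apply: (@le_Int _ _ _ L) => [|//|x].
  - exact: (intg_abs (intgB (lintg_convol_ker e0 Iv) Iv)).
  - by apply: intgD => //; apply: intgD.
  - rewrite !fctE convolBr//.
    set a := convol _ v x; set b := convol _ f x.
    have -> : a - v x = (a - b) + (b - f x) - (v x - f x) by ring.
    by rewrite (le_trans (ler_normB _ _))// lerD2r ler_normD.
rewrite (IntD (intgD I1 I2) I3) (IntD I1 I2).
apply: (@le_trans _ _ (d / 3 + d / 3 + d / 3)); last by lra.
apply: lerD; last exact: vf.
by apply: lerD; [exact: (le_trans (Int_convol_ker_le e0 Ivf) vf)|exact: fr].
Qed.

Lemma mollD v f : moll v -> moll f -> moll (v + f).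
Proof.
move=> [Iv mv] [If mf]; split; first exact: intgD.
move=> d d0; have d2 : 0 < d / 2 by rewrite divr_gt0.
have [r1 r10 h1] := mv _ d2; have [r2 r20 h2] := mf _ d2.
exists (Num.min r1 r2); first by rewrite lt_min r10.
move=> e e0; rewrite lt_min => /andP[/(h1 _ e0) {}h1 /(h2 _ e0) {}h2].
have kk := cc_ker e0.
have I1 := intg_abs (intgB (lintg_convol_ker e0 Iv) Iv).
have I2 := intg_abs (intgB (lintg_convol_ker e0 If) If).
have Ivf : lintg (v + f) by exact: intgD.
apply: (@le_trans _ _ (\int[L]_x ((fun x => `|(convol (ker e) v - v) x|) + (fun x => `|(convol (ker e) f - f) x|)) x)).
  apply: (@le_Int _ _ _ L) => [| |x].
  - exact: (intg_abs (intgB (lintg_convol_ker e0 Ivf) Ivf)).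
  - exact: intgD.
  - rewrite !fctE convolDr// opprD addrACA; exact: ler_normD.
rewrite (IntD I1 I2); apply: (@le_trans _ _ (d / 2 + d / 2)); last by lra.
exact: lerD.
Qed.

Lemma moll0 : moll 0.
Proof.
split; first exact: intg0.
move=> d d0; exists 1 => // e e0 _.
rewrite (_ : \int[L]_x _ = 0) ?ltW//.
rewrite (@eq_Rintegral _ _ _ L _ (cst 0)); first by rewrite Rintegral_cst ?mul0r.
move=> x _; rewrite /convol (@eq_Rintegral _ _ _ L _ (cst 0)).
  by rewrite Rintegral_cst ?mul0r// subrr normr0.
by move=> y _; rewrite fctE mul0r.
Qed.

Lemma mollZ a v : moll v -> moll (a *: v).
Proof.
move=> [Iv mv]; split; first exact: intgZ.
move=> d d0; have d2 : 0 < d / (`|a| + 1) by rewrite divr_gt0// ltr_pwDr.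
have [r r0 h] := mv _ d2; exists r => // e e0 /(h _ e0) {}h; have kk := cc_ker e0.
have I1 := intg_abs (intgB (lintg_convol_ker e0 Iv) Iv).
apply: (@le_trans _ _ (`|a| * \int[L]_x `|convol (ker e) v x - v x|)).
  rewrite -(@RintegralZl _ _ _ L)//.
  rewrite le_eqVlt; apply/orP; left; apply/eqP; apply: eq_Rintegral => x _.
  by rewrite convolZr// fctE /GRing.scale/= -mulrBr normrM.
apply: (le_trans (ler_wpM2l (normr_ge0 a) h)); rewrite mulrCA ler_piMr ?(ltW d0)//.
by rewrite ler_pdivrMr ?mul1r ?lerDl// ltr_pwDr.
Qed.

Lemma mollB v f : moll v -> moll f -> moll (v - f).
Proof. by move=> mv mf; apply: mollD => //; rewrite -scaleN1r; exact: mollZ. Qed.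

(** For [e < 1] both [f] and its mollification vanish off the box [Q]; on [Q], uniform continuity
    bounds their difference by [d / (m + 1)], where [m] is the volume of [Q]. *)
Lemma moll_cc f : cc f -> moll f.
Proof.
move=> cf; have If := cc_intg cf; have [_ [M M0 fM]] := cf; split=> // d d0.
pose Q := box (0 : 'rV[R]_n) (M + 1).
have mQ : measurable (Q : set (lebesgue_type R n)).
  by apply: borel_lebesgue_measurable; exact: measurable_box.
have Qoo : (L Q < +oo)%E.
  by rewrite borel_lebesgueE; [exact: box_measure_lty|exact: measurable_box].
pose m := fine (L Q); have m0 : 0 <= m by rewrite fine_ge0.
have dm : 0 < d / (m + 1) by rewrite divr_gt0// ltr_pwDr.
have [r r0 fr] := cc_unif cf dm.
exists (Num.min r 1); first by rewrite lt_min r0 ltr01.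
move=> e e0; rewrite lt_min => /andP[er e1]; have kk := cc_ker e0.
have I1Q : lintg \1_Q.
  apply: (@integrable_bounded_supp _ _ _ L _ Q 1) => //.
  - by move=> x; rewrite indicE; case: (_ \in _); rewrite ?normr0 ?normr1.
  - by move=> x Qx; rewrite indicE memNset.
apply: (@le_trans _ _ (\int[L]_x (d / (m + 1) * \1_Q x))).
  apply: (@le_Int _ _ _ L) => [| |x].
  - exact: (intg_abs (intgB (lintg_convol_ker e0 If) If)).
  - exact: (intgZ _ I1Q).
  - have Ik := lintg_ker x e0.
    have fxE : f x = \int[L]_y (f x * ker e (x - y)).
      by rewrite (@RintegralZl _ _ _ L)// Int_ker// mulr1.
    rewrite [in X in `|_ - X|]fxE /convol -(@RintegralB _ _ _ L)//; last 2 first.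
    - exact: intg_convE.
    - exact: (intgZ _ Ik).
    have [Qx|Qx] := pselect (Q x).
      rewrite indicE mem_set// mulr1.
      apply: (@le_trans _ _ (\int[L]_y (d / (m + 1) * ker e (x - y)))).
        apply: (@Int_abs_le _ _ _ L).
        - exact: (intgB (intg_convE x kk If) (intgZ (f x) Ik)).
        - exact: (intgZ _ Ik).
        - move=> y; rewrite -mulrBl normrM (ger0_norm (ker_ge0 e0 _)).
          have [xy|xy] := ltP `|x - y| e.
            rewrite ler_wpM2r ?ker_ge0// distrC fr//; exact: lt_trans xy er.
          by rewrite (norm_supp e0 (@ker_supp _ _ _ e0) xy) !mulr0.
      by rewrite (@RintegralZl _ _ _ L)// Int_ker// mulr1.
    rewrite (@eq_Rintegral _ _ _ L _ (cst 0)).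
      by rewrite Rintegral_cst// mul0r normr0 mulr_ge0// ltW.
    move=> y _; move/existsNP : Qx => [i /negP]; rewrite -leNgt mxE subr0 => xi.
    rewrite (fM x i); last by rewrite (le_trans _ xi)// lerDl.
    rewrite mul0r subr0; have [yi|yi] := leP M `|y ord0 i|; first by rewrite (fM _ _ yi) mul0r.
    rewrite (@ker_supp _ _ _ e0 (x - y) i) ?mulr0// !mxE.
    rewrite -(lerD2r `|y ord0 i|).
    apply: (@le_trans _ _ (M + 1)); first by lra.
    apply: (le_trans xi); rewrite -[X in `|X|](subrK (y ord0 i)).
    exact: ler_normD.
rewrite (@RintegralZl _ _ _ L)//.
rewrite (_ : \int[L]_x \1_Q x = m); last first.
  by rewrite /Rintegral integral_indic// setIT.
by rewrite mulrAC ler_pdivrMr ?ltr_pwDr// ler_wpM2l ?lerDl// ltW.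
Qed.

End mollification.

Lemma L1_dominated d (T : measurableType d) (R : realType) (nu : {measure set T -> \bar R})
    (f_ : nat -> T -> R) (f g : T -> R) :
  (forall k, measurable_fun [set: T] (f_ k)) -> intg nu g ->
  (forall x, f_ ^~ x @ \oo --> f x) -> (forall k x, `|f_ k x| <= g x) ->
  intg nu f /\ (fun k => \int[nu]_x `|f_ k x - f x|) @ \oo --> (0:R).
Proof.
move=> mf_ Ig cf fg.
have mf : measurable_fun [set: T] f by apply: (@measurable_fun_cvg _ _ _ _ f_).
have acf : {ae nu, forall x, [set: T] x -> (fun k => (f_ k x)%:E) @ \oo --> (f x)%:E}.
  by apply: aeW => x _; apply/fine_cvgP; split; [exact: nearW|exact: cf].
have afg : {ae nu, forall x k, [set: T] x -> (`|(f_ k x)%:E| <= (g x)%:E)%E}.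
  by apply: aeW => x k _; rewrite lee_fin.
have mfE k : measurable_fun [set: T] (fun x => (f_ k x)%:E) by exact/measurable_EFinP.
have [If f0 _] := dominated_convergence measurableT mfE ((measurable_EFinP _ _).2 mf) acf Ig afg.
by split=> //; exact: (fine_cvg f0).
Qed.

Section mollification_cvg.
Context {R : realType} {n : nat}.
Implicit Types (v f g : 'rV[R]_n -> R) (x y : 'rV[R]_n).

Local Notation L := (lebesgue_rV R n).

Variable M : R.
Hypothesis M0 : 0 < M.
Let Q := box (0 : 'rV[R]_n) M.

Let QE x : Q x <-> `|x| < M.
Proof. by have := boxE 0 x M0; rewrite subr0. Qed.

Let mQ : measurable (Q : set (lebesgue_type R n)).
Proof. by apply: borel_lebesgue_measurable; exact: measurable_box. Qed.

Let Qoo : (L Q < +oo)%E.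
Proof. by rewrite borel_lebesgueE; [exact: box_measure_lty|exact: measurable_box]. Qed.

Lemma indic_norm_le1 (A : set 'rV[R]_n) x : `|(\1_A x : R)| <= 1.
Proof. by rewrite indicE; case: (_ \in _); rewrite ?normr0 ?normr1. Qed.

Lemma lintg_indicQ (A : set 'rV[R]_n) : measurable (A : set (lebesgue_type R n)) ->
  lintg (\1_(A `&` Q) : 'rV[R]_n -> R).
Proof.
move=> mA; apply: (@integrable_bounded_supp _ _ _ L _ Q 1).
- by apply: measurable_indic; exact: measurableI.
- exact: mQ.
- exact: Qoo.
- exact: indic_norm_le1.
- by move=> x Qx; rewrite indicE memNset// => -[].
Qed.

Definition mollset (A : set 'rV[R]_n) := moll (\1_(A `&` Q) : 'rV[R]_n -> R).

Lemma moll_dominated (f_ : nat -> 'rV[R]_n -> R) f g :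
  (forall k, moll (f_ k)) -> lintg g ->
  (forall x, f_ ^~ x @ \oo --> f x) -> (forall k x, `|f_ k x| <= g x) -> moll f.
Proof.
move=> mf_ Ig cf fg.
have mf k : measurable_fun [set: lebesgue_type R n] (f_ k) := intg_measurable (mf_ k).1.
have [If f0] := L1_dominated mf Ig cf fg.
apply: moll_lim => // d d0; move/cvgrPdist_le : f0 => /(_ _ d0) [N _ /(_ N (leqnn N))].
rewrite /= sub0r normrN ger0_norm; last by apply: Rintegral_ge0 => x _; exact: normr_ge0.
move=> h; exists (f_ N) => //; apply: le_trans h; rewrite le_eqVlt; apply/orP; left; apply/eqP.
by apply: eq_Rintegral => x _; exact: distrC.
Qed.

(** The continuous function [h] is positive exactly on the part in [Q] of the set where [0 < g x],
    and the truncations [min 1 (k * h)] increase to the indicator of that part. *)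
Lemma mollset_cozero g : continuous g -> mollset [set x | 0 < g x].
Proof.
move=> cg; pose h x := pos (g x) * pos (M - `|x|).
have ch : continuous h.
  apply: continuous_mul; first exact: (continuous_fun_comp continuous_pos cg).
  apply: (continuous_fun_comp continuous_pos); apply: continuous_sub; first exact: cst_continuous.
  exact: norm_continuous.
have h0 x : 0 <= h x by rewrite mulr_ge0 ?pos_ge0.
have pos_gt0 (s : R) : (0 < pos s) = (0 < s) by rewrite /pos lt_max ltxx orbF.
have hP x : (0 < h x) <-> ([set x | 0 < g x] `&` Q) x.
  rewrite /h; split=> [hx|[/= gx /QE xM]].
    have p1 : pos (g x) != 0 by apply: contraTneq hx => ->; rewrite mul0r ltxx.
    have p2 : pos (M - `|x|) != 0 by apply: contraTneq hx => ->; rewrite mulr0 ltxx.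
    split; first by rewrite /= -pos_gt0 lt_neqAle eq_sym p1 pos_ge0.
    by apply/QE; rewrite -subr_gt0 -pos_gt0 lt_neqAle eq_sym p2 pos_ge0.
  by rewrite mulr_gt0 ?pos_gt0 ?subr_gt0.
pose th (k : nat) x := Num.min 1 (k%:R * h x).
have th_supp k x : ~ Q x -> th k x = 0.
  move=> Qx; have -> : h x = 0 -> th k x = 0.
    by move=> hx; rewrite /th hx mulr0 min_r.
    by [].
  apply/eqP; rewrite eq_le h0 andbT leNgt; apply/negP => /hP[_]; exact: Qx.
have th01 k x : 0 <= th k x <= 1.
  by rewrite /th ge_min lexx le_min ler01 mulr_ge0.
apply: (@moll_dominated th _ (\1_([set: 'rV[R]_n] `&` Q))).
- move=> k; apply: moll_cc; split.
    have cmin : continuous (fun s : R => Num.min 1 s).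
      by move=> s; apply: continuous_min; [exact: cvg_cst|exact: cvg_id].
    apply: (continuous_fun_comp cmin).
    by apply: (@continuous_mul _ _ (cst k%:R) h) => //; exact: cst_continuous.
  exists M => // x i Mx; apply: th_supp => /(_ i); rewrite mxE subr0; apply/negP.
  by rewrite -leNgt.
- by apply: lintg_indicQ; exact: measurableT.
- move=> x; have [hx|hx] := ltP 0 (h x).
    rewrite indicE mem_set; last exact/hP.
    apply: cvg_near_cst.
    exists (Num.bound (h x)^-1) => // k /= hk; rewrite /th min_l//.
    rewrite -ler_pdivrMr// mul1r; apply: ltW; apply: (lt_le_trans (archi_boundP _)).
      by rewrite invr_ge0.
    by rewrite ler_nat.
  rewrite indicE memNset; last by move/hP; rewrite ltNge hx.
  have hx0 : h x = 0 by apply/eqP; rewrite eq_le hx h0.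
  by apply: cvg_near_cst; apply: nearW => k; rewrite /th hx0 mulr0 min_r.
- move=> k x; have [Qx|Qx] := pselect (Q x).
    rewrite indicE mem_set//=; have /andP[t0 t1] := th01 k x.
    by rewrite ger0_norm.
  by rewrite th_supp// normr0.
Qed.

(** The positivity sets of continuous functions are stable under intersection and generate the Borel
    sigma-algebra: they start a lambda-system argument. *)
Let cozero : set (set 'rV[R]_n) :=
  [set A | exists2 g : 'rV[R]_n -> R, continuous g & A = [set x | 0 < g x]].

Let cozeroI : setI_closed cozero.
Proof.
move=> A B [g cg ->] [h ch ->]; exists (fun x => Num.min (g x) (h x)).
  apply: rV_continuous => x e e0.
  have /cvgrPdist_le/(_ _ e0)/nbhs_ballP[r1 /= r10 f1] := cg x.
  have /cvgrPdist_le/(_ _ e0)/nbhs_ballP[r2 /= r20 f2] := ch x.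
  exists (Num.min r1 r2); first by rewrite lt_min r10.
  rewrite mx_norm_ball in f1; rewrite mx_norm_ball in f2.
  move=> y; rewrite lt_min => /andP[/f1 {}f1 /f2 {}f2]; move: f1 f2.
  rewrite !ler_norml; have [? | ?] := leP (g x) (h x); have [? | ?] := leP (g y) (h y);
    by move=> /andP[? ?] /andP[? ?]; apply/andP; split; lra.
by apply/seteqP; split=> x /=; rewrite lt_min; [move=> [-> ->]|move=> /andP[]].
Qed.

Let measurable_cozero : (@measurable _ 'rV[R]_n : set (set 'rV[R]_n)) `<=` <<s cozero >>.
Proof.
apply: smallest_sub; first exact: smallest_sigma_algebra.
rewrite -bigcup_seq => A [i _ [C mC <-]].
pose T := g_sigma_algebraType cozero.
have mc : measurable_fun [set: T] (fun x : 'rV[R]_n => x ord0 i : measurableTypeR R).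
  apply: (measurability _ (RGenOInfty.measurableE R)) => //.
  move=> _ [_ [a ->] <-]; rewrite setTI; apply: sub_sigma_algebra.
  exists (fun x => x ord0 i - a).
    by apply: continuous_sub; [exact: coord_continuous|exact: cst_continuous].
  by apply/seteqP; split=> x; rewrite /= in_itv/= andbT subr_gt0.
exact: (mc measurableT C mC).
Qed.

Let mollset_borel (A : set 'rV[R]_n) : measurable A -> mollset A.
Proof.
move=> mA; suff : <<s cozero >> `<=` [set A | measurable (A : set 'rV[R]_n) /\ mollset A].
  by move=> /(_ _ (measurable_cozero mA))[].
apply: lambda_system_subset => //.
  split=> //.
  - split=> //; rewrite (_ : [set: _] = [set x : 'rV[R]_n | 0 < (cst 1 : _ -> R) x]).
      by apply: mollset_cozero; exact: cst_continuous.
    by apply/seteqP; split=> x //= _; exact: ltr01.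
  - move=> B C CB [mB hB] [mC hC]; split; first exact: measurableD.
    rewrite /mollset (_ : \1_ _ = (\1_(B `&` Q) - \1_(C `&` Q) : 'rV[R]_n -> R)).
      exact: mollB.
    apply/funext => x; rewrite !fctE !indicE.
    have [Qx|Qx] := pselect (Q x); last by rewrite !memNset ?subrr// => -[].
    have [Cx|Cx] := pselect (C x).
      by rewrite memNset ?mem_set ?subrr//; [split=> //; exact: CB|case=> -[]].
    rewrite (memNset (_ : ~ (C `&` Q) x)) ?subr0; last by case.
    have [Bx|Bx] := pselect (B x); first by rewrite !mem_set.
    have n1 : ~ ((B `\` C) `&` Q) x by case=> -[].
    have n2 : ~ (B `&` Q) x by case.
    by rewrite (memNset n1) (memNset n2).
  - move=> F ndF hF; split; first by apply: bigcupT_measurable => k; case: (hF k).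
    apply: (@moll_dominated (fun k => \1_(F k `&` Q)) _ (\1_([set: 'rV[R]_n] `&` Q))).
    + by move=> k; case: (hF k).
    + by apply: lintg_indicQ; exact: measurableT.
    + move=> x; have [[N _ FNx]|nF] := pselect ((\bigcup_i F i) x).
        apply: cvg_near_cst; exists N => // k /= Nk.
        have Fkx : F k x by move/subsetPset : (ndF _ _ Nk); exact.
        by rewrite !indicE !in_setI (mem_set Fkx) (@mem_set _ (\bigcup_i F i))//; exists N.
      apply: cvg_near_cst; apply: nearW => k.
      have nFk : ~ F k x by move=> Fk; apply: nF; exists k.
      by rewrite !indicE !in_setI (memNset nFk) (memNset nF).
    + move=> k x; rewrite !indicE !in_setI in_setT /=.
      by case: (_ \in F k); rewrite /= ?normr0// ger0_norm.
- move=> B [g cg ->]; split; last exact: mollset_cozero.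
  have := continuous_measurable_rV cg measurableT (@measurable_itv R `]0, +oo[).
  rewrite setTI (_ : _ @^-1` _ = [set x | 0 < g x])//.
  by apply/seteqP; split=> x; rewrite /= in_itv/= andbT.
Qed.

(** The measure of [A'] is an infimum over Borel covers: some Borel [B] containing [A'] exceeds it
    by at most [e] in measure, so the two indicators are [e]-close in L1. *)
Let mollset_lebesgue (A : set 'rV[R]_n) : measurable (A : set (lebesgue_type R n)) ->
  mollset A.
Proof.
move=> mA; apply: moll_lim; first exact: lintg_indicQ.
move=> e e0; pose A' := A `&` Q.
have mA' : measurable (A' : set (lebesgue_type R n)) by apply: measurableI.
have LA' : L A' \is a fin_num.
  rewrite ge0_fin_numE//; apply: le_lt_trans Qoo; apply: le_measure; rewrite ?inE//.
  exact: subIsetr.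
have [_ [F [mF A'F] <-] Fe] := lb_ereal_inf_adherent e0 LA'.
pose B := \bigcup_k F k.
have mB : measurable (B : set 'rV[R]_n) by exact: bigcupT_measurable.
have mBL : measurable (B : set (lebesgue_type R n)) by exact: borel_lebesgue_measurable.
have mB' : measurable (B `&` Q : set (lebesgue_type R n)) by apply: measurableI.
have LB : (L B <= L A' + e%:E)%E.
  apply: le_trans (ltW Fe).
  rewrite borel_lebesgueE//; apply: measure_sigma_subadditive => //.
exists (\1_(B `&` Q)); first exact: mollset_borel.
have A'B : A' `<=` B `&` Q by move=> x A'x; split; [exact: A'F|case: A'x].
have IB := lintg_indicQ mBL; have IA := lintg_indicQ mA.
have LBE : \int[L]_x (\1_(B `&` Q) x) = fine (L (B `&` Q)).
  by rewrite /Rintegral integral_indic// setIT.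
have LAE : \int[L]_x (\1_A' x) = fine (L A').
  by rewrite /Rintegral integral_indic// setIT.
have LB' : L (B `&` Q) \is a fin_num.
  rewrite ge0_fin_numE//; apply: le_lt_trans Qoo.
  by apply: (le_measure L (mem_set mB') (mem_set mQ)); exact: subIsetr.
rewrite (@eq_Rintegral _ _ _ L _ (fun x => \1_(B `&` Q) x - \1_A' x)); last first.
  move=> x _; rewrite distrC ger0_norm// subr_ge0 !indicE -/A'.
  have [A'x|A'x] := boolP (x \in A'); last by case: (_ \in _).
  by rewrite mem_set//; apply: A'B; move: A'x; rewrite inE.
rewrite (@RintegralB _ _ _ L)// LBE LAE lerBlDl -lee_fin EFinD !fineK//.
apply: le_trans LB.
by apply: (le_measure L (mem_set mB') (mem_set mBL)); exact: subIsetl.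
Qed.

Lemma moll_sum (I : Type) (r : seq I) (F : I -> 'rV[R]_n -> R) :
  (forall i, moll (F i)) -> moll (fun x => \sum_(i <- r) F i x).
Proof.
move=> mF; elim: r => [|i r IH].
  rewrite (_ : (fun _ => _) = 0); first exact: moll0.
  by apply/funext => x; rewrite big_nil.
rewrite (_ : (fun _ => _) = F i + (fun x => \sum_(i <- r) F i x)); first exact: mollD.
by apply/funext => x; rewrite big_cons.
Qed.

Import HBSimple.

(** Simple functions are dense in L1; multiplying one by the indicator of [Q] does not increase its
    distance to [v], which vanishes off [Q]. *)
Theorem moll_supp v : lintg v -> (forall x, ~ Q x -> v x = 0) -> moll v.
Proof.
move=> Iv v0; apply: moll_lim => // d d0.
have [g_ [Ig _ cg]] := approximation_sfun_integrable (measurableT : measurable [set: lebesgue_type R n]) Iv.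
have {cg}[N _ /(_ N (leqnn N))] : \forall k \near \oo, (\int[L]_z `|(v z)%:E - (g_ k z)%:E| < d%:E)%E.
  have := cg; move/fine_cvgP => [fg /cvgrPdist_lt/(_ _ d0)].
  apply: filterS2 fg => k fk; rewrite /= sub0r normrN => h.
  rewrite -(fineK fk) lte_fin; exact: le_lt_trans (ler_norm _) h.
move=> /= gd; exists (fun x => g_ N x * \1_Q x).
  rewrite (_ : (fun _ => _) = (fun x => \sum_(y <- finmap.enum_fset (fset_set (range (g_ N))))
      (y *: (\1_(g_ N @^-1` [set y] `&` Q) : 'rV[R]_n -> R)) x)).
    apply: moll_sum => y; apply: mollZ; apply: mollset_lebesgue.
    by rewrite -[X in measurable X]setTI; exact: measurable_funP.
  apply/funext => x; rewrite fimfunE fsbig_finite//= mulr_suml.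
  by apply: eq_bigr => y _; rewrite fctE /GRing.scale/= -mulrA !indicE in_setI -natrM mulnb.
have Ig1 : lintg (fun x => g_ N x * \1_Q x).
  by apply: (@intg_indic _ _ _ L (g_ N)); [exact: mQ|exact: Ig].
have Ivg : lintg (fun x => v x - g_ N x) by exact: (intgB Iv (Ig N)).
apply: (@le_trans _ _ (\int[L]_x `|v x - g_ N x|)).
  apply: (@le_Int _ _ _ L) => [| |x].
  - exact: (intg_abs (intgB Iv Ig1)).
  - exact: (intg_abs Ivg).
  - have [Qx|Qx] := pselect (Q x); first by rewrite indicE mem_set// mulr1.
    by rewrite indicE memNset// mulr0 v0// subrr normr0.
apply: ltW; rewrite -lte_fin -(Int_EFin (intg_abs Ivg)).
exact: gd.
Qed.

End mollification_cvg.

(** * Continuously differentiable fields with compact support *)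

Lemma continuous_sum (R : realType) (T : topologicalType) (I : eqType) (r : seq I)
    (F : I -> T -> R) : (forall i, continuous (F i)) ->
  continuous (fun x => \sum_(i <- r) F i x).
Proof.
move=> cF; elim: r => [|i r IH].
  rewrite (_ : (fun _ => _) = cst 0); first exact: cst_continuous.
  by apply/funext => x; rewrite big_nil.
by under eq_fun do rewrite big_cons; exact: continuous_add.
Qed.

Lemma mean_value0 (R : realType) (F dF : R -> R) (t : R) :
  (forall s : R, `|s| <= `|t| -> is_derive s 1 F (dF s)) ->
  exists2 c, `|c| <= `|t| & F t - F 0 = dF c * t.
Proof.
move=> dFE.
have cF (s : R) : `|s| <= `|t| -> {for s, continuous F}.
  by move=> /dFE[dF0 _]; apply: differentiable_continuous; exact/derivable1_diffP.
have cw a b : (forall s, s \in `[a, b] -> `|s| <= `|t|) -> {within `[a, b], continuous F}.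
  move=> ab; apply: continuous_in_subspaceT => s; rewrite inE/= => sab.
  by apply: cF; exact: ab.
have [t0|t0] := leP 0 t.
  have h s : s \in `[0, t] -> `|s| <= `|t|.
    by rewrite in_itv/= => /andP[s0 st]; rewrite !ger0_norm.
  have [|c ct ->] := @MVT_segment R F dF 0 t t0 _ (cw _ _ h).
    by move=> s s0t; apply: dFE; apply: h; exact: subset_itv_oo_cc.
  by exists c; [exact: h|rewrite subr0].
have h s : s \in `[t, 0] -> `|s| <= `|t|.
  by rewrite in_itv/= => /andP[ts s0]; rewrite ler0_norm// (ltr0_norm t0) lerN2.
have [|c ct E] := @MVT_segment R F dF t 0 (ltW t0) _ (cw _ _ h).
  by move=> s s0t; apply: dFE; apply: h; exact: subset_itv_oo_cc.
exists c; first exact: h.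
by rewrite -opprB E sub0r mulrN opprK.
Qed.

Lemma linear_approx_differentiable (R : realType) (V W : normedModType R)
    (f : V -> W) (D : {linear V -> W}) (x : V) : continuous D ->
  (forall e, 0 < e -> \forall h \near (0 : V), `|f (h + x) - f x - D h| <= e * `|h|) ->
  differentiable f x.
Proof.
move=> cD fD.
have E : f \o shift x = cst (f x) + D +o_ 0 id.
  apply/eqaddoP => e e0; apply: filterS (fD e e0) => h.
  by rewrite !fctE /= opprD addrA.
by apply/diff_locallyP; rewrite (diff_unique cD E).
Qed.

Lemma near_eq_continuous (T U : topologicalType) (f g : T -> U) (x : T) :
  (\forall y \near x, g y = f y) -> {for x, continuous g} -> {for x, continuous f}.
Proof.
move=> gf cg; have E : g x = f x := nbhs_singleton gf.
suff : f @ x --> g x by rewrite E.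
by apply: cvg_trans cg; apply: near_eq_cvg.
Qed.

Section continuous_at.
Context {R : realType} {T : topologicalType} (x : T).
Implicit Types f g : T -> R.

Lemma continuous_at_mul f g : {for x, continuous f} -> {for x, continuous g} ->
  {for x, continuous (fun y => f y * g y)}.
Proof. exact: cvgM. Qed.

Lemma continuous_at_add f g : {for x, continuous f} -> {for x, continuous g} ->
  {for x, continuous (fun y => f y + g y)}.
Proof. exact: cvgD. Qed.

Lemma continuous_at_opp f : {for x, continuous f} ->
  {for x, continuous (fun y => - f y)}.
Proof. exact: cvgN. Qed.

Lemma continuous_at_inv f : f x != 0 -> {for x, continuous f} ->
  {for x, continuous (fun y => (f y)^-1)}.
Proof. exact: cvgV. Qed.

Lemma continuous_at_cst (c : R) : {for x, continuous (fun _ => c)}.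
Proof. exact: cvg_cst. Qed.

End continuous_at.

Section C1on.
Context {R : realType} {n : nat}.
Implicit Types (U C : set 'rV[R]_n) (f g : 'rV[R]_n -> R) (x : 'rV[R]_n).
Implicit Types (df dg : 'I_n -> 'rV[R]_n -> R).

Definition C1on U f df := forall x, U x -> [/\ {for x, continuous f},
  forall j, {for x, continuous (df j)} &
  forall j, is_derive x (delta_mx ord0 j) f (df j x)].

(* Telescoping along the coordinate directions, with the mean value theorem in
   each of them. *)
Lemma C1on_increment U f df x e : open U -> C1on U f df -> U x -> 0 < e ->
  exists2 r, 0 < r & forall h, `|h| < r ->
    `|f (h + x) - f x - \sum_(j < n) h ord0 j * df j x| <= e * `|h|.
Proof.
move=> oU Cf Ux e0.
(* Each of the [n] coordinate steps may cost [e / n.+1] times the norm of [h]; the successor covers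
   [n = 0]. *)
have e'0 : 0 < e / n.+1%:R by rewrite divr_gt0.
have : \forall y \near x, U y /\ forall j, `|df j x - df j y| <= e / n.+1%:R.
  apply: filterI; first by apply: open_nbhs_nbhs; split.
  apply: (@filter_forall _ _ (fun j y => `|df j x - df j y| <= e / n.+1%:R) (nbhs x)) => j.
  by have [_ /(_ j) c _] := Cf _ Ux; move/cvgrPdist_le : c => /(_ _ e'0).
move=> /nbhs_ballP[r /= r0 rP]; exists r => // h hr.
pose p k : 'rV[R]_n := \row_j (if (j < k)%N then h ord0 j else 0).
suff S k : (k <= n)%N -> `|f (p k + x) - f x -
    \sum_(j < n | (j < k)%N) h ord0 j * df j x| <= k%:R * (e / n.+1%:R * `|h|).
  have pn : p n = h by apply/rowP => j; rewrite /p mxE ltn_ord.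
  have sn : \sum_(j < n | (j < n)%N) h ord0 j * df j x = \sum_(j < n) h ord0 j * df j x.
    by apply: eq_bigl => j; rewrite ltn_ord.
  have := S n (leqnn n); rewrite pn sn => /le_trans; apply.
  rewrite mulrA ler_wpM2r// mulrCA ler_piMr ?(ltW e0)//.
  by rewrite ler_pdivrMr// mul1r ler_nat.
elim: k => [_|k IH kn].
  rewrite (_ : p 0%N = 0); last by apply/rowP => j; rewrite /p !mxE.
  by rewrite add0r subrr sub0r big_pred0// oppr0 normr0 mul0r.
pose i := Ordinal kn.
have hi : `|h ord0 i| <= `|h| := coord_le_norm h i.
pose q (s : R) := s *: delta_mx ord0 i + (p k + x).
have qnorm s : `|s| <= `|h ord0 i| -> `|x - q s| < r.
  move=> sh; rewrite (le_lt_trans _ hr)// /q addrA opprD [_ - x]addrC addrA subrr sub0r normrN.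
  apply: le_rV_norm => // j; rewrite /p !mxE/=.
  have [->|ji] := eqVneq j i.
    by rewrite ltnn addr0 mulr1 (le_trans sh).
  by rewrite mulr0 add0r; case: ifP => _; rewrite ?normr0// coord_le_norm.
have qU s : `|s| <= `|h ord0 i| -> U (q s) /\ forall j, `|df j x - df j (q s)| <= e / n.+1%:R.
  by move=> /qnorm sr; apply: rP; rewrite mx_norm_ball.
have [|c ch] := @mean_value0 R (f \o q) (df i \o q) (h ord0 i).
  move=> s sh; have [Uq _] := qU _ sh; have [_ _ /(_ i) dq] := Cf _ Uq.
  apply: (is_derive_line _ _ dq) => //= t.
  by rewrite -[t *: 1]/(t * 1) mulr1 /q scalerDl -addrA.
have q0 : q 0 = p k + x by rewrite /q scale0r add0r.
have q1 : q (h ord0 i) = p k.+1 + x.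
  rewrite /q addrA; congr (_ + _); apply/rowP => j; rewrite /p !mxE ltnS [(j <= k)%N]leq_eqVlt/=.
  have [->|ji] := eqVneq j i; first by rewrite ltnn mulr1 addr0 eqxx.
  by rewrite mulr0 add0r; have -> : (j == k :> nat) = false by apply/negbTE.
rewrite /= q0 q1 => E.
have [_ /(_ i) dc] := qU _ ch.
rewrite (bigD1 i)//= (eq_bigl (fun j : 'I_n => (j < k)%N)); last first.
  move=> j; rewrite ltnS [(j <= k)%N]leq_eqVlt; have [->|ji] := eqVneq j i; first by rewrite ltnn andbF.
  have -> : (j == k :> nat) = false by exact/negbTE.
  by rewrite andbT.
rewrite (_ : _ - _ = (df i (q c) - df i x) * h ord0 i + (f (p k + x) - f x -
   \sum_(j < n | (j < k)%N) h ord0 j * df j x)); last first.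
  by rewrite mulrBl -E; ring.
rewrite (le_trans (ler_normD _ _))// addrC.
have -> : k.+1%:R * (e / n.+1%:R * `|h|) = k%:R * (e / n.+1%:R * `|h|) + e / n.+1%:R * `|h|.
  by rewrite -(natr1 k); ring.
rewrite lerD ?IH ?(ltnW kn)//.
by rewrite normrM distrC ler_pM.
Qed.

(** This closes the distance between the flux side, which handles partial derivatives, and [C1c],
    which asks for [differentiable]. *)
Lemma C1on_differentiable U f df x : open U -> C1on U f df -> U x ->
  differentiable f x.
Proof.
move=> oU Cf Ux.
pose D (h : 'rV[R]_n) : R := \sum_(j < n) h ord0 j * df j x.
have linD : linear D.
  move=> a u v; rewrite /D scaler_sumr -big_split/=; apply: eq_bigr => j _.
  by rewrite !mxE /GRing.scale/=; ring.
pose DM := GRing.isLinear.Build _ _ _ _ _ linD.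
pose DL : {linear 'rV[R]_n -> R} := HB.pack D DM.
have cD : continuous DL.
  have : continuous (fun h : 'rV[R]_n => \sum_(j < n) h ord0 j * df j x).
    apply: continuous_sum => j.
    by apply: continuous_mul; [exact: coord_continuous|exact: cst_continuous].
  by [].
apply: (linear_approx_differentiable cD) => e e0.
have [r r0 rP] := C1on_increment oU Cf Ux e0.
apply: filterS (nbhsx_ballx (0 : 'rV[R]_n) r r0) => h.
rewrite mx_norm_ball /ball_/= sub0r normrN; exact: rP.
Qed.

(** The open set [U] and the complement of [C] cover the space, and [f] is locally 0 on the
    latter. *)
Lemma C1on_ext0 U C f df : open U -> closed C -> C `<=` U -> C1on U f df ->
  (forall x, ~ C x -> f x = 0) ->
  C1 f (fun j => 'D_(delta_mx ord0 j) f).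
Proof.
move=> oU cC CU Cf f0.
have nC x : ~ C x -> \forall y \near x, f y = 0.
  move=> Cx; have : nbhs x (~` C) by apply: open_nbhs_nbhs; split; [exact: closed_openC|].
  by apply: filterS => y; exact: f0.
have nU x : U x -> \forall y \near x, U y by move=> Ux; apply: open_nbhs_nbhs.
have D0 x j : ~ C x -> is_derive x (delta_mx ord0 j) f 0.
  move=> Cx; apply: (@near_eq_is_derive _ _ _ (cst 0)).
  by apply: filterS (nC _ Cx) => y ->.
have DU x j : U x -> 'D_(delta_mx ord0 j) f x = df j x.
  by move=> Ux; have [_ _ /(_ j) d] := Cf _ Ux; exact: derive_val.
split=> [x|j x|j x].
- have [/CU/Cf[]//|Cx] := pselect (C x).
  apply: (@near_eq_continuous _ _ _ (cst 0)); last exact: cst_continuous.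
  by apply: filterS (nC _ Cx) => y ->.
- have [/CU Ux|Cx] := pselect (C x).
    apply: (@near_eq_continuous _ _ _ (df j)); last by have [_ + _] := Cf _ Ux; exact.
    by apply: filterS (nU _ Ux) => y Uy; rewrite DU.
  apply: (@near_eq_continuous _ _ _ (cst 0)); last exact: cst_continuous.
  have : nbhs x (~` C) by apply: open_nbhs_nbhs; split; [exact: closed_openC|].
  by apply: filterS => y /(D0 y j)d; rewrite derive_val.
- have [/CU Ux|Cx] := pselect (C x).
    by rewrite DU//; have [_ _ +] := Cf _ Ux; exact.
  by have d := D0 x j Cx; rewrite derive_val.
Qed.

Lemma C1onM U f df g dg : C1on U f df -> C1on U g dg ->
  C1on U (fun x => f x * g x) (fun j x => f x * dg j x + g x * df j x).
Proof.
move=> Cf Cg x Ux; have [cf cdf fE] := Cf _ Ux; have [cg cdg gE] := Cg _ Ux.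
split=> [|j|j].
- exact: continuous_at_mul.
- by apply: continuous_at_add; exact: continuous_at_mul.
- exact: is_derive_mul.
Qed.

Lemma C1onV U f df : C1on U f df -> (forall x, U x -> f x != 0) ->
  C1on U (fun x => (f x)^-1) (fun j x => - df j x / f x ^+ 2).
Proof.
move=> Cf f0 x Ux; have [cf cdf fE] := Cf _ Ux; have fx0 := f0 _ Ux.
split=> [|j|j].
- exact: continuous_at_inv.
- apply: continuous_at_mul; first exact: continuous_at_opp.
  apply: continuous_at_inv; first by rewrite expf_neq0.
  exact: (continuous_at_mul cf cf).
- exact: is_derive_inv.
Qed.

Lemma C1on_prod U (r : seq 'I_n) (F : 'I_n -> 'rV[R]_n -> R) :
  (forall i, exists df, C1on U (F i) df) ->
  exists df, C1on U (fun x => \prod_(i <- r) F i x) df.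
Proof.
move=> CF; elim: r => [|i r [df IH]].
  exists (fun _ => cst 0) => x _.
  rewrite (_ : (fun _ => _) = cst 1); last by apply/funext => y; rewrite big_nil.
  by split=> [|j|j]; [exact: cst_continuous|exact: cst_continuous|exact: is_derive_cst].
have [dg Fi] := CF i; eexists.
rewrite (_ : (fun x => _) = (fun x => F i x * \prod_(j <- r) F j x)); last first.
  by apply/funext => x; rewrite big_cons.
exact: C1onM Fi IH.
Qed.

Lemma C1_C1on U f df : C1 f df -> C1on U f df.
Proof.
by move=> [cf cdf dfE] x _; split=> [|j|j]; [exact: cf|exact: cdf|exact: dfE].
Qed.

Lemma C1on_sub U V f df : V `<=` U -> C1on U f df -> C1on V f df.
Proof. by move=> VU Cf x /VU/Cf. Qed.

Lemma C1on_coord U (F dF : R -> R) (i : 'I_n) :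
  (forall x, U x -> is_derive (x ord0 i : R) 1 F (dF (x ord0 i))) ->
  (forall x, U x -> {for (x ord0 i : R), continuous dF}) ->
  C1on U (fun x => F (x ord0 i)) (fun j x => dF (x ord0 i) * (i == j)%:R).
Proof.
move=> FE cdF x Ux; split=> [|j|j].
- apply: (@continuous_comp _ _ _ (fun x : 'rV[R]_n => x ord0 i) F); first exact: coord_continuous.
  by apply: differentiable_continuous; apply/derivable1_diffP; case: (FE x Ux).
- apply: continuous_at_mul; last exact: continuous_at_cst.
  by apply: (@continuous_comp _ _ _ (fun x : 'rV[R]_n => x ord0 i) dF); [exact: coord_continuous|exact: cdF].
- apply: is_derive_outer; first exact: FE.
  apply: (@is_derive_line _ _ _ (fun s : R => s * (i == j)%:R + x ord0 i) _ 0 1).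
  + by move=> h; rewrite !mxE/= addr0 -[h *: 1]/(h * 1) mulr1.
  + by rewrite mul0r add0r.
  + have := is_derive_add (is_derive_mulr (i == j)%:R (is_derive_id (0 : R) (1 : R)))
      (is_derive_cst (x ord0 i : R) (0 : R) (1 : R)).
    by rewrite addr0 mul1r.
Qed.

End C1on.

(** * Coefficients of the flux coordinates *)

Section coefficients.
Context {R : realType} {n : nat}.
Variable alpha : 'I_n -> R.
Hypothesis Gamma_gt0 : forall i, 0 < Gamma (alpha i + 1).
Implicit Types x : 'rV[R]_n.

Definition coef (i : 'I_n) x : R := Num.sqrt (x ord0 i) * omega alpha x.

Let w (i : 'I_n) (s : R) : R := s `^ alpha i * expR (- s) / Gamma (alpha i + 1).
Let dw (i : 'I_n) (s : R) : R :=
  (s `^ alpha i * (- expR (- s)) + expR (- s) * (alpha i * s `^ (alpha i - 1)))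
    / Gamma (alpha i + 1).

Let is_derive_w i (s : R) : 0 < s -> is_derive s 1 (w i) (dw i s).
Proof.
move=> s0; apply: is_derive_mulr; apply: is_derive_mul; first exact: is_derive1_powR.
have h := is_derive_outer (is_derive_expR (- s)) (is_deriveN (is_derive_id s (1 : R))).
by move: h; rewrite mulrN1.
Qed.

Let continuous_pow (b s : R) : 0 < s -> {for s, continuous (fun s : R => s `^ b)}.
Proof.
move=> s0; apply: differentiable_continuous; apply/derivable1_diffP.
by have [] := is_derive1_powR b s0.
Qed.

Let continuous_expN : continuous (fun s : R => expR (- s)).
Proof.
move=> s; apply: continuous_comp; last exact: continuous_expR.
exact: opp_continuous.
Qed.

Let continuous_dw i (s : R) : 0 < s -> {for s, continuous (dw i)}.
Proof.
move=> s0; have cp (b : R) : {for s, continuous (fun s : R => s `^ b)} by exact: continuous_pow.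
have ce := @continuous_expN s.
apply: continuous_at_mul; last exact: continuous_at_cst.
apply: continuous_at_add; apply: continuous_at_mul => //.
  exact: continuous_at_opp.
by apply: continuous_at_mul => //; exact: continuous_at_cst.
Qed.

Lemma C1on_omega : exists df, C1on (@orthant R n) (omega alpha) df.
Proof.
apply: (@C1on_prod _ _ _ _ (fun i x => w i (x ord0 i))) => i; eexists.
apply: C1on_coord => x xo; first exact/is_derive_w/xo.
exact/continuous_dw/xo.
Qed.

Lemma C1on_coef i : exists df, C1on (@orthant R n) (coef i) df.
Proof.
have [df w1] := C1on_omega; eexists; apply: C1onM w1.
apply: (@C1on_coord _ _ _ Num.sqrt (fun s => (2 * Num.sqrt s)^-1)) => x xo.
  exact: is_derive1_sqrt.
apply: continuous_at_inv.
  by rewrite mulf_neq0// gt_eqF// sqrtr_gt0; exact: xo.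
by apply: continuous_at_mul; [exact: continuous_at_cst|exact: sqrt_continuous].
Qed.

Lemma omega_gt0 x : orthant x -> 0 < omega alpha x.
Proof.
move=> xo; apply: prodr_gt0 => i _.
by rewrite divr_gt0// mulr_gt0 ?powR_gt0 ?expR_gt0//; exact: xo.
Qed.

Lemma weight_orthant x : orthant x -> weight alpha x = omega alpha x.
Proof. by move=> xo; rewrite /weight indicE mem_set// mulr1. Qed.

Lemma coef_gt0 i x : orthant x -> 0 < coef i x.
Proof. by move=> xo; rewrite mulr_gt0 ?omega_gt0// sqrtr_gt0; exact: xo. Qed.

(** The logarithmic derivative of [coef i] in direction [i] is the zeroth-order coefficient of
    [delta_star]. Hence [omega] times [delta_star] of [f] is minus the partial derivative of
    [coef i * f]. *)
Lemma is_derive_coef i x : orthant x ->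
  is_derive x (delta_mx ord0 i) (coef i)
    (coef i x * ((alpha i + 2^-1 - x ord0 i) / x ord0 i)).
Proof.
move=> xo; have xi := xo i.
pose c := \prod_(j < n | j != i) w j (x ord0 j).
have omegaE y : omega alpha y = w i (y ord0 i) * \prod_(j < n | j != i) w j (y ord0 j).
  by rewrite /omega (bigD1 i).
have d1 := is_derive_mulr c (is_derive_mul (is_derive1_sqrt xi) (is_derive_w i xi)).
apply: (is_derive_eq (is_derive_line _ _ d1)).
- move=> h; rewrite /coef omegaE !mxE !eqxx /= -[h *: 1]/(h * 1) !mulr1 -mulrA; congr (_ * (_ * _)).
  by apply: eq_bigr => j /negbTE ji; rewrite !mxE ji andbF mulr0 add0r.
- by rewrite /coef omegaE -mulrA.
- rewrite /coef omegaE -/c /dw /w powRB; last by rewrite (gt_eqF xi) implybT.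
  rewrite powRr1 ?ltW//.
  have s0 : Num.sqrt (x ord0 i) != 0 by rewrite gt_eqF// sqrtr_gt0.
  have G0 : Gamma (alpha i + 1) != 0 by rewrite gt_eqF.
  have xs : x ord0 i = Num.sqrt (x ord0 i) ^+ 2 by rewrite sqr_sqrtr// ltW.
  move: (x ord0 i `^ alpha i) (expR (- x ord0 i)) (Gamma (alpha i + 1)) G0 => p e G G0.
  move: (Num.sqrt (x ord0 i)) xs s0 => s -> s0; field.
  by rewrite s0 G0.
Qed.

End coefficients.

(** * Test fields and their fluxes *)

Lemma continuous_mx (R : realType) (T : topologicalType) m n (f : T -> 'M[R]_(m, n)) (x : T) :
  (forall i j, {for x, continuous (fun y => f y i j)}) -> {for x, continuous f}.
Proof.
move=> cf; apply/(@cvgrPdist_le _ _ _ (nbhs x)) => e e0.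
have : \forall y \near x, forall ij : 'I_m * 'I_n, `|f x ij.1 ij.2 - f y ij.1 ij.2| <= e.
  apply: filter_forall => ij.
  by have /cvgrPdist_le/(_ _ e0) := cf ij.1 ij.2.
apply: filterS => y h; rewrite [leLHS]/Num.Def.normr/= mx_normrE.
by apply: (bigmax_le _ (ltW e0)) => ij _; rewrite !mxE; exact: h.
Qed.

Section flux.
Context {R : realType} {n : nat}.
Variable alpha : 'I_n -> R.
Hypothesis Gamma_gt0 : forall i, 0 < Gamma (alpha i + 1).
Variable U : set 'rV[R]_n.
Hypothesis oU : open U.
Hypothesis Uorthant : U `<=` orthant.
Implicit Types (x : 'rV[R]_n) (phi : 'rV[R]_n -> 'rV[R]_n).
Implicit Types (g : 'I_n -> 'rV[R]_n -> R) (dg : 'I_n -> 'I_n -> 'rV[R]_n -> R).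

Let a := coef alpha.

(* The vector field [g = (sqrt x_i * omega x * phi_i x)_i] attached to a test
   field [phi], with the partial derivatives [dg i j] of its components:
   multiplying by these coefficients turns the Laguerre divergence against
   [mu_ alpha] into the ordinary divergence against the Lebesgue measure. *)
Definition flux g dg := [/\ forall i, C1 (g i) (dg i),
  exists C, [/\ compact C, C `<=` U & forall i x, ~ C x -> g i x = 0] &
  forall x, U x -> \sum_(i < n) (g i x / a i x) ^+ 2 <= 1].

Definition flux_div dg x : R := - (\sum_(i < n) dg i i x) / weight alpha x.

Lemma C1_eq0 (C : set 'rV[R]_n) (f : 'rV[R]_n -> R) df : closed C -> C1 f df ->
  (forall x, ~ C x -> f x = 0) -> forall j x, ~ C x -> df j x = 0.
Proof.
move=> cC [_ _ dfE] f0 j x Cx.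
have : is_derive x (delta_mx ord0 j) f 0.
  apply: (@near_eq_is_derive _ _ _ (cst 0)).
  have : nbhs x (~` C) by apply: open_nbhs_nbhs; split; [exact: closed_openC|].
  by apply: filterS => y /f0 ->.
by move=> [_ <-]; have [_ <-] := dfE j x.
Qed.

(** On [U] this is the product rule with [is_derive_coef]; off [C] both sides vanish, as [phi] and
    [g] are locally 0. The equality thus holds on the whole space. *)
Lemma laguerre_div_flux C phi g dg : closed C -> C `<=` U ->
  (forall x, ~ C x -> phi x = 0) -> (forall i x, ~ C x -> g i x = 0) ->
  (forall i x, U x -> g i x = a i x * phi x ord0 i) ->
  (forall i, C1 (g i) (dg i)) ->
  (forall i x, U x -> derivable (fun y => phi y ord0 i) x (delta_mx ord0 i)) ->
  laguerre_div alpha phi = flux_div dg.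
Proof.
move=> cC CU phi0 g0 gE Cg dphi; apply/funext => x.
have [Cx|Cx] := pselect (C x); last first.
  rewrite /flux_div big1 ?oppr0 ?mul0r => [|i _]; last first.
    by apply: (C1_eq0 cC (Cg i)) => // y; exact: g0.
  apply: big1 => i _; rewrite /delta_star phi0// mxE mulr0 addr0.
  have d0 : is_derive x (delta_mx ord0 i) (fun y => phi y ord0 i) 0.
    apply: (@near_eq_is_derive _ _ _ (cst 0)).
    have : nbhs x (~` C) by apply: open_nbhs_nbhs; split; [exact: closed_openC|].
    by apply: filterS => y /phi0 ->; rewrite mxE.
  by rewrite derive_val mulr0.
have Ux := CU _ Cx; have xo := Uorthant Ux.
have o0 := omega_gt0 Gamma_gt0 xo.
rewrite /flux_div weight_orthant// -sumrN mulr_suml; apply: eq_bigr => i _.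
set b := 'D_(delta_mx ord0 i) (fun y => phi y ord0 i) x.
have db : is_derive x (delta_mx ord0 i) (fun y => phi y ord0 i) b.
  by split => //; exact: dphi.
have : is_derive x (delta_mx ord0 i) (g i)
    (a i x * b + phi x ord0 i * (a i x * ((alpha i + 2^-1 - x ord0 i) / x ord0 i))).
  apply: near_eq_is_derive (is_derive_mul (is_derive_coef Gamma_gt0 i xo) db).
  by apply: filterS (open_nbhs_nbhs (conj oU Ux)) => y Uy; rewrite gE.
have [_ _ /(_ i x)[_ <-]] := Cg i; move=> [_ ->].
rewrite /delta_star -/b /a /coef.
have x0 : x ord0 i != 0 by rewrite gt_eqF//; exact: xo.
by field; rewrite gt_eqF// x0.
Qed.

Lemma test_fields_flux phi : test_fields U phi ->
  exists g dg, flux g dg /\ laguerre_div alpha phi = flux_div dg.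
Proof.
move=> [[dphi jphi cC CU] sup1]; set C := closure _ in cC CU.
have clC : closed C by exact: closed_closure.
have phi0 x : ~ C x -> phi x = 0.
  by move=> Cx; apply: contrapT => px; apply: Cx; apply: subset_closure; apply/eqP.
have Cphi i : C1on U (fun x => phi x ord0 i) (fun j x => jacobian phi x j i).
  move=> x Ux; have dx := dphi _ Ux; split=> [|j|j].
  - apply: (@continuous_comp _ _ _ phi (fun y : 'rV[R]_n => y ord0 i)); last exact: coord_continuous.
    exact: differentiable_continuous.
  - apply: (@continuous_comp _ _ _ (jacobian phi) (fun y : 'M[R]_n => y j i)); last exact: coord_continuous.
    exact: jphi.
  - have dv := @diff_derivable _ _ _ phi x (delta_mx ord0 j) dx.
    split; first by have/derivable_mxP := dv; exact.
    have := deriveEjacobian (delta_mx ord0 j) dx.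
    by rewrite (derive_mx dv) -rowE => /matrixP/(_ ord0 i); rewrite !mxE.
have Cg i : C1 (fun x => a i x * phi x ord0 i)
    (fun j => 'D_(delta_mx ord0 j) (fun x => a i x * phi x ord0 i)).
  have [da Ca] := C1on_coef alpha i.
  apply: (C1on_ext0 oU clC CU (C1onM (C1on_sub Uorthant Ca) (Cphi i))).
  by move=> x /phi0 ->; rewrite mxE mulr0.
exists (fun i x => a i x * phi x ord0 i).
exists (fun i j => 'D_(delta_mx ord0 j) (fun x => a i x * phi x ord0 i)); split.
  split=> //.
    by exists C; split => // i x /phi0 ->; rewrite mxE mulr0.
  move=> x Ux; have xo := Uorthant Ux.
  have : euclidean_norm (phi x) <= 1.
    by rewrite -lee_fin (le_trans _ sup1)//; apply: ereal_sup_ubound; exists x.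
  move=> norm1.
  have : \sum_(i < n) `|phi x ord0 i| ^+ 2 <= 1 by rewrite -ler_sqrt// sqrtr1.
  apply: le_trans; apply: ler_sum => i _.
  by rewrite mulrAC divff ?mul1r ?gt_eqF ?coef_gt0// real_normK ?num_real.
apply: (@laguerre_div_flux C phi (fun i x => a i x * phi x ord0 i) _ clC CU phi0) => //.
- by move=> i x /phi0 ->; rewrite mxE mulr0.
- by move=> i x /(Cphi i)[_ _ /(_ i)[]].
Qed.

(** The way back divides by the coefficients, positive on the orthant; off [C] the quotient is 0
    because [g] is, whatever the coefficient. *)
Lemma flux_test_fields g dg : flux g dg ->
  exists2 phi, test_fields U phi & laguerre_div alpha phi = flux_div dg.
Proof.
move=> [Cg [C [cC CU g0]] g1].
have clC : closed C by apply: compact_closed => //; exact: norm_hausdorff.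
pose f i x := g i x * (a i x)^-1.
pose phi x := \row_i f i x.
have phi0 x : ~ C x -> phi x = 0.
  by move=> Cx; apply/rowP => i; rewrite !mxE /f g0// mul0r.
have Cf i : exists df, C1on U (f i) df.
  have [da Ca] := C1on_coef alpha i; eexists.
  apply: C1onM; first exact: C1_C1on (Cg i).
  apply: C1onV; first exact: C1on_sub Uorthant Ca.
  by move=> x /Uorthant xo; rewrite gt_eqF ?coef_gt0.
have {Cf} [df Cf] := choice Cf.
have phiE : phi = \sum_(i < n) (fun x => f i x *: delta_mx ord0 i).
  apply/funext => x; rewrite fct_sumE; apply/rowP => j.
  rewrite summxE (bigD1 j)//= !mxE !eqxx mulr1 big1 ?addr0// => i /negbTE ij.
  by rewrite !mxE [j == i]eq_sym ij andbF mulr0.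
have dphi x : U x -> differentiable phi x.
  move=> Ux; rewrite phiE; apply: differentiable_sum => i.
  apply: differentiableZl; exact: C1on_differentiable oU (Cf i) Ux.
have dphii i j x : U x -> is_derive x (delta_mx ord0 j) (fun y => phi y ord0 i) (df i j x).
  move=> Ux; have [_ _ /(_ j)] := Cf i _ Ux.
  by rewrite (_ : (fun y => _) = f i)//; apply/funext => y; rewrite mxE.
have jphi x : U x -> jacobian phi x = \matrix_(j, i) df i j x.
  move=> Ux; apply/matrixP => j i; rewrite mxE.
  have dx := dphi _ Ux; have := deriveEjacobian (delta_mx ord0 j) dx.
  rewrite (derive_mx (@diff_derivable _ _ _ phi x (delta_mx ord0 j) dx)) -rowE => /matrixP/(_ ord0 i).
  by rewrite !mxE => <-; have [_] := dphii i j x Ux.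
have suppC : closure [set x | phi x != 0] `<=` C.
  rewrite [X in _ `<=` X]((closure_id C).1 clC); apply: closure_subset => x /= px.
  by apply: contrapT => /phi0 E; rewrite E eqxx in px.
exists phi.
  split; first split.
  - exact: dphi.
  - move=> x Ux; apply: (@near_eq_continuous _ _ _ (fun x => \matrix_(j, i) df i j x)).
      by apply: filterS (open_nbhs_nbhs (conj oU Ux)) => y Uy; rewrite jphi.
    apply: continuous_mx => j i; have [_ /(_ j) + _] := Cf i _ Ux.
    by rewrite (_ : (fun y => _) = df i j)//; apply/funext => y; rewrite mxE.
  - by apply: subclosed_compact suppC; [exact: closed_closure|].
  - exact: subset_trans suppC CU.
  apply: ub_ereal_sup => _ [x Ux <-]; rewrite lee_fin /euclidean_norm -[leRHS]sqrtr1 ler_sqrt//.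
  apply: le_trans (g1 _ Ux); apply: ler_sum => i _.
  by rewrite mxE real_normK ?num_real.
apply: (@laguerre_div_flux C phi g _ clC CU phi0) => //.
- by move=> i x Ux; rewrite mxE /f mulrCA divff ?mulr1// gt_eqF// coef_gt0//; exact: Uorthant.
- by move=> i x Ux; have [] := dphii i i x Ux.
Qed.

End flux.

Section flux_basics.
Context {R : realType} {n : nat}.
Variable alpha : 'I_n -> R.
Hypothesis Gamma_gt0 : forall i, 0 < Gamma (alpha i + 1).
Variable U : set 'rV[R]_n.
Hypothesis Uorthant : U `<=` orthant.
Implicit Types (x : 'rV[R]_n).
Implicit Types (g k : 'I_n -> 'rV[R]_n -> R) (dg dk : 'I_n -> 'I_n -> 'rV[R]_n -> R).

Let L := lebesgue_rV R n.

Lemma compact_box_supp (C : set 'rV[R]_n) : compact C ->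
  exists2 M, 0 < M & forall x i, M <= `|x ord0 i| -> ~ C x.
Proof.
move=> /compact_bounded[M [_ HM]]; exists (`|M| + 2); first by rewrite ltr_wpDl.
move=> x i xM Cx; have : `|x| <= `|M| + 1.
  by apply: HM => //; rewrite (le_lt_trans (ler_norm _))// ltrDl.
apply/negP; rewrite -ltNge (lt_le_trans _ (coord_le_norm x i))// (lt_le_trans _ xM)//.
by rewrite ltrD2l ltr1n.
Qed.

Lemma C1_cc (C : set 'rV[R]_n) (f : 'rV[R]_n -> R) df : compact C -> C1 f df ->
  (forall x, ~ C x -> f x = 0) -> cc f /\ forall j, cc (df j).
Proof.
move=> cC Cf f0; have [M M0 CM] := compact_box_supp cC.
have clC : closed C by apply: compact_closed => //; exact: norm_hausdorff.
have [cf cdf _] := Cf; split=> [|j]; split => //; exists M => // x i /CM.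
  exact: f0.
exact: (C1_eq0 clC Cf f0).
Qed.

Lemma Int_partial_eq0 (C : set 'rV[R]_n) (f : 'rV[R]_n -> R) df j : compact C -> C1 f df ->
  (forall x, ~ C x -> f x = 0) -> \int[L]_x df j x = 0.
Proof.
move=> cC Cf f0; have [M M0 CM] := compact_box_supp cC.
have clC : closed C by apply: compact_closed => //; exact: norm_hausdorff.
have [cf cdf dfE] := Cf.
rewrite /Rintegral integral_borel_lebesgue; last first.
  by apply/measurable_EFinP; exact: continuous_measurable_rV.
rewrite (@integral_partial_eq0 R n j f (df j) M)// => x i /CM Cx.
by split; [exact: f0|exact: (C1_eq0 clC Cf f0)].
Qed.

Lemma flux_cc g dg : flux alpha U g dg ->
  forall i, cc (g i) /\ forall j, cc (dg i j).
Proof. by move=> [Cg [C [cC CU g0]] _] i; exact: (C1_cc cC (Cg i) (g0 i)). Qed.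

Lemma flux_dsupp g dg : flux alpha U g dg -> exists C, [/\ compact C, C `<=` U &
  forall x, ~ C x -> forall i, g i x = 0 /\ forall j, dg i j x = 0].
Proof.
move=> [Cg [C [cC CU g0]] _]; exists C; split => // x Cx i; split; first exact: g0.
have clC : closed C by apply: compact_closed => //; exact: norm_hausdorff.
by move=> j; exact: (C1_eq0 clC (Cg i) (g0 i)).
Qed.

Lemma flux0 : flux alpha U (fun _ _ => 0) (fun _ _ _ => 0).
Proof.
split.
- by move=> i; exact: C1_cst.
- by exists set0; split => //; exact: compact0.
- by move=> x _; rewrite big1// => i _; rewrite mul0r expr0n.
Qed.

(** The weight may depend on the point because the norm constraint is pointwise and the square is
    convex, with defect [t * (1 - t) * (p - q) ^+ 2]; that [t] is C^1 keeps the combination C^1. *)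
Lemma flux_conv g dg k dk (t : 'rV[R]_n -> R) dt : C1 t dt ->
  (forall x, 0 <= t x <= 1) -> flux alpha U g dg -> flux alpha U k dk ->
  flux alpha U (fun i x => g i x + t x * (k i x - g i x))
    (fun i j x => dg i j x + (t x * (dk i j x - dg i j x) + (k i x - g i x) * dt j x)).
Proof.
move=> Ct t01 [Cg [C [cC CU g0]] g1] [Ck [D [cD DU k0]] k1]; split.
- by move=> i; apply: (C1D (Cg i)); apply: C1M => //; exact: C1B.
- exists (C `|` D); split; [exact: compactU|by rewrite subUset|].
  by move=> i x /not_orP[/(g0 i) -> /(k0 i) ->]; rewrite subrr mulr0 addr0.
- move=> x Ux; have /andP[t0 t1] := t01 x.
  apply: (@le_trans _ _ (\sum_(i < n) ((1 - t x) * (g i x / coef alpha i x) ^+ 2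
      + t x * (k i x / coef alpha i x) ^+ 2))).
    apply: ler_sum => i _.
    rewrite mulrDl -mulrA mulrBl; set p := g i x / _; set q := k i x / _.
    rewrite -subr_ge0 (_ : _ - _ = t x * (1 - t x) * (p - q) ^+ 2); last by ring.
    by apply: mulr_ge0; [apply: mulr_ge0; rewrite ?subr_ge0|exact: sqr_ge0].
  rewrite big_split/= -!mulr_sumr.
  have := g1 _ Ux; have := k1 _ Ux; set p := \sum_(i < n) _; set q := \sum_(i < n) _.
  by move=> p1 q1; have : 0 <= 1 - t x by [rewrite subr_ge0]; nra.
Qed.

Lemma weight_gt0 x : orthant x -> 0 < weight alpha x.
Proof. by move=> xo; rewrite weight_orthant// omega_gt0. Qed.

Lemma weight_lb (C : set 'rV[R]_n) : compact C -> C `<=` orthant ->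
  exists2 c, 0 < c & forall x, C x -> c <= weight alpha x.
Proof.
move=> cC Co; have [dw Cw] := C1on_omega alpha.
have cw : {within C, continuous (fun x => (omega alpha x)^-1)}.
  apply: continuous_in_subspaceT => x; rewrite inE => /Co xo; have [cx _ _] := Cw _ xo.
  by apply: continuous_at_inv => //; rewrite gt_eqF ?omega_gt0.
have /compact_bounded[M [_ HM]] := continuous_compact cw cC.
exists (`|M| + 1)^-1; first by rewrite invr_gt0 ltr_wpDl.
move=> x Cx; have w0 := omega_gt0 Gamma_gt0 (Co _ Cx).
have : `|(omega alpha x)^-1| <= `|M| + 1.
  by apply: (HM (`|M| + 1)); [rewrite (le_lt_trans (ler_norm _))// ltrDl|exists x].
rewrite normfV (gtr0_norm w0) => wM; rewrite weight_orthant; last exact: Co.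
have M0 : 0 < `|M| + 1 by rewrite ltr_wpDl.
by rewrite invf_ple// posrE.
Qed.

(** Outside the orthant, where the weight is 0, both sides vanish: a flux lives in [U]. *)
Lemma flux_div_weight g dg x : flux alpha U g dg ->
  flux_div alpha dg x * weight alpha x = - (\sum_(i < n) dg i i x).
Proof.
move=> fg; have [xo|xo] := pselect (orthant x).
  by rewrite /flux_div divfK// gt_eqF// weight_gt0.
rewrite /flux_div big1 ?oppr0 ?mul0r// => i _; have [C [_ CU C0]] := flux_dsupp fg.
have [|_ ->//] := C0 x _ i.
by move=> /CU/Uorthant.
Qed.

Lemma cc_sum (r : seq 'I_n) (f : 'I_n -> 'rV[R]_n -> R) : (forall i, cc (f i)) ->
  cc (fun x => \sum_(i <- r) f i x).
Proof.
move=> cf; split; first by apply: continuous_sum => i; case: (cf i).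
elim: r => [|i r [M M0 IH]]; first by exists 1 => // x i _; rewrite big_nil.
have [_ [N N0 fN]] := cf i; exists (Num.max M N); first by rewrite lt_max M0.
move=> x j; rewrite ge_max => /andP[xM xN].
by rewrite big_cons (IH x j xM) (fN x j xN) addr0.
Qed.

Lemma cc_div g dg : flux alpha U g dg -> cc (fun x => \sum_(i < n) dg i i x).
Proof. by move=> fg; apply: cc_sum => i; have [_] := flux_cc fg i; exact. Qed.

Lemma flux_div_bounded g dg : flux alpha U g dg ->
  exists c, forall x, `|flux_div alpha dg x| <= c.
Proof.
move=> fg; have [C [cC CU C0]] := flux_dsupp fg.
have [c c0 wc] := weight_lb cC (subset_trans CU Uorthant).
have [b b0 db] := cc_bounded (cc_div fg).
exists (b / c) => x; have [Cx|Cx] := pselect (C x); last first.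
  by rewrite /flux_div big1 ?oppr0 ?mul0r ?normr0 ?divr_ge0 ?(ltW c0)// => i _; have [] := C0 _ Cx i.
have w0 := weight_gt0 (Uorthant (CU _ Cx)).
rewrite /flux_div normrM normrN normfV (gtr0_norm w0) ler_pM ?invr_ge0 ?(ltW w0)//.
by rewrite lef_pV2 ?posrE// wc.
Qed.

Lemma measurable_flux_div g dg : flux alpha U g dg ->
  measurable_fun [set: lebesgue_type R n] (flux_div alpha dg).
Proof.
(* The inverse is written as the power [-1], which is measurable; the two agree on nonnegative
   numbers, 0 included. *)
move=> fg; rewrite (_ : flux_div alpha dg =
    (fun x => - (\sum_(i < n) dg i i x) * weight alpha x `^ (-1))); last first.
  by apply/funext => x; rewrite powR_inv1// weight_ge0.
apply: measurable_funM.
  by apply: measurable_lebesgue; apply: continuous_opp; case: (cc_div fg).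
by apply: (measurableT_comp (measurable_powR _)); exact: measurable_weight.
Qed.

Lemma flux_div_L2 g dg : flux alpha U g dg -> L2 (mu_ alpha) (flux_div alpha dg).
Proof.
move=> fg; have [c dc] := flux_div_bounded fg.
by apply: (L2_bounded (mu_lty alpha) _ dc); exact: measurable_flux_div fg.
Qed.

Lemma dot_flux_div g dg (h : lebesgue_type R n -> R) : flux alpha U g dg ->
  measurable_fun [set: lebesgue_type R n] h ->
  dot (mu_ alpha) h (flux_div alpha dg) = \int[L]_x (h x * - \sum_(i < n) dg i i x).
Proof.
move=> fg mh; rewrite /dot.
have mhd : measurable_fun [set: lebesgue_type R n] (h * flux_div alpha dg).
  exact: (measurable_funM mh (measurable_flux_div fg)).
rewrite (Int_density (measurable_weight alpha) (@weight_ge0 _ _ alpha) (@mu_weight _ _ alpha) mhd).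
apply: (@eq_Rintegral _ _ _ L) => x _.
by rewrite !fctE -mulrA (flux_div_weight _ fg).
Qed.

Lemma Int_sum_eq0 (r : seq 'I_n) (f : 'I_n -> 'rV[R]_n -> R) :
  (forall i, lintg (f i) /\ \int[L]_x f i x = 0) ->
  lintg (fun x => \sum_(i <- r) f i x) /\ \int[L]_x (\sum_(i <- r) f i x) = 0.
Proof.
move=> f0; elim: r => [|i r [Ir IH]].
  rewrite (_ : (fun x => _) = 0); last by apply/funext => x; rewrite big_nil.
  by split; [exact: intg0|rewrite (Rintegral_cst L measurableT 0) mul0r].
have [If fi0] := f0 i.
rewrite (_ : (fun x => _) = f i + (fun x => \sum_(i <- r) f i x)); last first.
  by apply/funext => x; rewrite big_cons.
split; first exact: intgD.
by rewrite IntD// IH fi0 addr0.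
Qed.

Lemma Int_flux_div g dg : flux alpha U g dg ->
  dot (mu_ alpha) (cst 1) (flux_div alpha dg) = 0.
Proof.
move=> fg; rewrite (dot_flux_div fg); last exact: measurable_cst.
have [Cg [C [cC CU g0]] _] := fg.
have [I1 E1] : lintg (fun x => \sum_(i < n) dg i i x) /\
    \int[L]_x (\sum_(i < n) dg i i x) = 0.
  apply: Int_sum_eq0 => i; split; last exact: (Int_partial_eq0 i cC (Cg i) (g0 i)).
  by apply: cc_intg; have [_] := flux_cc fg i; exact.
rewrite (@eq_Rintegral _ _ _ L _ (fun x => -1 * \sum_(i < n) dg i i x)); last first.
  by move=> x _; rewrite mulN1r mul1r.
by rewrite RintegralZl// E1 mulr0.
Qed.

End flux_basics.

(** * Mollified fluxes *)

Lemma min_ord_gt0 (R : realType) n (P : 'I_n -> R -> Prop) :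
  (forall i r s, P i r -> s <= r -> P i s) ->
  (forall i, exists2 r, 0 < r & P i r) -> exists2 r, 0 < r & forall i, P i r.
Proof.
move=> Ple Pex.
have [r r0 rP] : exists2 r : 'I_n -> R, (forall i, 0 < r i) & forall i, P i (r i).
  have [r rP] := choice (fun i => let: ex_intro2 r a b := Pex i in ex_intro (fun r => 0 < r /\ P i r) r (conj a b)).
  by exists r => i; have [] := rP i.
exists (\big[Num.min/1]_i r i).
  by apply: (big_ind (fun x => 0 < x)) => // x y x0 y0; rewrite lt_min x0.
by move=> i; apply: Ple (rP i) _; exact: bigmin_le.
Qed.

(** [C'] is compact as the image of [C] times a closed cube under subtraction; half of the radius
    [r] keeps it inside [U]. *)
Lemma compact_nbhd (R : realType) n (C U : set 'rV[R]_n) : compact C -> open U -> C `<=` U ->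
  exists C' r, [/\ compact C', C' `<=` U, 0 < r & forall x y, C x -> `|x - y| < r -> C' y].
Proof.
move=> cC oU CU; have [r r0 rU] := compact_sub_open cC oU CU.
pose B := [set x : 'rV[R]_n | forall i, `|x ord0 i| <= r / 2].
pose C' := (fun p : 'rV[R]_n * 'rV[R]_n => p.1 - p.2) @` (C `*` B).
exists C', (r / 2); split.
- apply: continuous_compact; last by apply: compact_setX => //; exact: compact_box.
  by apply: continuous_subspaceT => p; apply: cvgB; [exact: cvg_fst|exact: cvg_snd].
- move=> _ [[x y] [/= Cx By] <-]; apply: rU Cx _.
  rewrite opprB addrC subrK (@le_lt_trans _ _ (r / 2)) ?gtr_pMr ?invf_lt1 ?ltr1n//.
  by apply: le_rV_norm => //; rewrite divr_ge0// ltW.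
- by rewrite divr_gt0.
- move=> x y Cx xy; exists (x, x - y) => /=; last by rewrite opprB addrC subrK.
  by split => // i /=; rewrite (le_trans (coord_le_norm _ i))// ltW.
Qed.

Section convolution_supp.
Context {R : realType} {n : nat}.
Implicit Types (v f : 'rV[R]_n -> R) (x y : 'rV[R]_n).

Let L := lebesgue_rV R n.

Lemma convol_sum (I : eqType) (r : seq I) (c : I -> R) (f : I -> 'rV[R]_n -> R) k x :
  cc k -> (forall i, lintg (f i)) ->
  lintg (fun y => \sum_(i <- r) c i * f i y) /\
  convol k (fun y => \sum_(i <- r) c i * f i y) x = \sum_(i <- r) c i * convol k (f i) x.
Proof.
move=> kk If; elim: r => [|i r [Ir IH]].
  rewrite (_ : (fun y => _) = 0); last by apply/funext => y; rewrite big_nil.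
  split; first exact: intg0.
  rewrite big_nil /convol (@eq_Rintegral _ _ _ L _ (cst 0)).
    by rewrite (Rintegral_cst L measurableT 0) mul0r.
  by move=> y _; rewrite mul0r.
rewrite (_ : (fun y => _) = c i *: f i + (fun y => \sum_(i <- r) c i * f i y)); last first.
  by apply/funext => y; rewrite big_cons.
have Ii : lintg (c i *: f i) by exact: (@intgZ _ _ _ L (c i) (f i) (If i)).
split; first exact: intgD.
by rewrite convolDr// convolZr// IH big_cons.
Qed.

Lemma convol_ker_supp (C C' : set 'rV[R]_n) r e f :
  (forall x y, C x -> `|x - y| < r -> C' y) -> 0 < e -> e <= r ->
  (forall x, ~ C x -> f x = 0) -> forall x, ~ C' x -> convol (ker e) f x = 0.
Proof.
move=> CC' e0 er f0 x C'x; rewrite /convol (@eq_Rintegral _ _ _ L _ (cst 0)).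
  by rewrite (Rintegral_cst L measurableT 0) mul0r.
move=> y _; have [Cy|/f0 ->] := pselect (C y); last exact: mul0r.
rewrite (norm_supp (f := ker e) e0) ?mulr0//; first by move=> z i; apply: (ker_supp e0).
rewrite leNgt; apply/negP => xy; apply: C'x; apply: CC' Cy _.
by rewrite distrC (lt_le_trans xy).
Qed.

End convolution_supp.

Section mollified_flux.
Context {R : realType} {n : nat}.
Variable alpha : 'I_n -> R.
Hypothesis Gamma_gt0 : forall i, 0 < Gamma (alpha i + 1).
Variable U : set 'rV[R]_n.
Hypothesis Uorthant : U `<=` orthant.
Implicit Types (x y : 'rV[R]_n).
Implicit Types (g k p : 'I_n -> 'rV[R]_n -> R) (dg dk dp : 'I_n -> 'I_n -> 'rV[R]_n -> R).

Let L := lebesgue_rV R n.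
Let a := coef alpha.

(** Uniform continuity of [ln (a i)] at the points of [C] keeps the ratio of the coefficients at two
    close points below [1 + t]. *)
Lemma coef_unif (C : set 'rV[R]_n) t : compact C -> C `<=` orthant -> 0 < t ->
  exists2 r, 0 < r & forall i x y, C x -> `|x - y| < r -> orthant y ->
    a i x <= (1 + t) * a i y.
Proof.
move=> cC Co t0.
apply: (@min_ord_gt0 _ _ (fun i r => forall x y, C x -> `|x - y| < r -> orthant y ->
    a i x <= (1 + t) * a i y)) => [i r s h sr x y Cx xy|i].
  by apply: h Cx _; exact: lt_le_trans xy sr.
have [da Ca] := C1on_coef alpha i.
have ca x : C x -> {for x, continuous (fun x => ln (a i x))}.
  move=> /Co xo; have [cx _ _] := Ca _ xo.
  apply: (@continuous_comp _ _ _ (a i) (@ln R)) => //.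
  by apply: continuous_ln; exact: coef_gt0.
have [|r r0 rP] := compact_unif_continuous cC ca (e := ln (1 + t)).
  by rewrite ln_gt0// ltrDl.
exists r => // x y Cx xy yo.
have ax : 0 < a i x by apply: coef_gt0 => //; exact: Co.
have ay : 0 < a i y by exact: coef_gt0.
have t1 : 0 < 1 + t by rewrite ltr_wpDl.
suff : ln (a i x) <= ln ((1 + t) * a i y) by rewrite ler_ln// posrE// mulr_gt0.
rewrite [ln ((1 + t) * _)]lnM ?posrE// -lerBlDr.
exact: le_trans (ler_norm _) (rP _ _ Cx xy).
Qed.

(** Averaging preserves a convex constraint with constant coefficients; here those at [x] and at
    nearby points differ by a factor at most [1 + t], which the division absorbs. The radius [r] is
    chosen before [p], since the fields used later depend on [e]. *)
Lemma convol_ker_flux (C C' : set 'rV[R]_n) r0 t : compact C -> C `<=` U ->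
  compact C' -> C' `<=` U -> 0 < r0 -> (forall x y, C x -> `|x - y| < r0 -> C' y) -> 0 < t ->
  exists2 r, 0 < r & forall e, 0 < e -> e < r -> forall p dp, flux alpha U p dp ->
    (forall i x, ~ C x -> p i x = 0) ->
    flux alpha U (fun i x => convol (ker e) (p i) x / (1 + t))
      (fun i j x => convol (ker e) (dp i j) x / (1 + t)).
Proof.
move=> cC CU cC' C'U r00 CC' t0.
have [r1 r10 ar] := coef_unif cC (subset_trans CU Uorthant) t0.
exists (Num.min r0 r1); first by rewrite lt_min r00.
move=> e e0; rewrite lt_min => /andP[er0 er1] p dp fp pC.
have [Cp _ p1] := fp; have pcc := flux_cc fp.
have pL i : lintg (p i) by apply: cc_intg; have [] := pcc i.
have kk := cc_ker (n := n) e0.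
have N0 : 0 < 1 + t by rewrite ltr_wpDl.
split.
- move=> i; have := C1M (C1_convol (@C1_ker R n e) kk (fun j => cc_dker j e0) (pL i)) (C1_cst (1 + t)^-1).
  congr C1; apply/funext => j; apply/funext => x.
  rewrite mulr0 add0r mulrC; congr (_ / _).
  apply: convol_dker => //; [exact: C1_ker|exact: cc_dker|].
  have [M M0 CM] := compact_box_supp cC.
  have clC : closed C by apply: compact_closed => //; exact: norm_hausdorff.
  exists M => // y l /CM Cy; split; first exact: pC.
  exact: (C1_eq0 clC (Cp i) (pC i)).
- exists C'; split=> // i x C'x.
  by rewrite (convol_ker_supp CC' e0 (ltW er0) (pC i))// mul0r.
move=> x Ux; have xo := Uorthant Ux.
pose T i := convol (ker e) (p i) x / a i x.
pose S := \sum_(i < n) T i ^+ 2.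
have a0 i : 0 < a i x by exact: coef_gt0.
rewrite (eq_bigr (fun i => T i ^+ 2 / (1 + t) ^+ 2)); last first.
  by move=> i _; rewrite -exprVn -exprMn /T mulrAC.
rewrite -mulr_suml ler_pdivrMr ?exprn_gt0// mul1r.
(* [S] is the mollification at [x] of a linear form in [p] with coefficients [T i / a i x]. Bounding
   each product by half the sum of the squares yields [S / 2] again, plus [(1 + t) ^+ 2 / 2], and
   [S] is then absorbed on the left. *)
suff : S <= (S + (1 + t) ^+ 2) / 2 by rewrite -/S; lra.
have [Iu uE] := convol_sum (index_enum 'I_n) (fun i => T i / a i x) x kk pL.
have SE : S = convol (ker e) (fun y => \sum_(i < n) T i / a i x * p i y) x.
  by rewrite uE; apply: eq_bigr => i _; rewrite /T expr2 mulrA [RHS]mulrAC.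
rewrite [leLHS]SE; have -> : (S + (1 + t) ^+ 2) / 2 = \int[L]_y ((S + (1 + t) ^+ 2) / 2 * ker e (x - y)).
  have Ik := lintg_ker x e0.
  rewrite RintegralZl//.
  by rewrite Int_ker// mulr1.
apply: (@le_Int _ _ _ L).
- exact: intg_convE.
- by apply: (@intgZ _ _ _ L ((S + (1 + t) ^+ 2) / 2)); exact: lintg_ker.
move=> y; have [xy|xy] := ltP `|x - y| e; last first.
  by rewrite (norm_supp (f := ker e) e0) ?mulr0//; move=> z i; apply: (ker_supp e0).
apply: ler_wpM2r; first exact: ker_ge0.
have [Cy|Cy] := pselect (C y); last first.
  rewrite big1 => [|i _]; last by rewrite pC// mulr0.
  by rewrite divr_ge0// addr_ge0 ?sqr_ge0// sumr_ge0// => i _; rewrite sqr_ge0.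
have yo := Uorthant (CU _ Cy).
have yx : `|y - x| < r1 by rewrite distrC (lt_trans xy).
apply: (@le_trans _ _ (\sum_(i < n) (T i ^+ 2 / 2 + (1 + t) ^+ 2 / 2 * (p i y / a i y) ^+ 2))).
  apply: ler_sum => i _.
  have ay : 0 < a i y by exact: coef_gt0.
  have ayx := ar i _ _ Cy yx xo.
  apply: (@le_trans _ _ (T i ^+ 2 / 2 + (p i y / a i x) ^+ 2 / 2)).
    rewrite mulrAC -mulrA; have := sqr_ge0 (T i - p i y / a i x); lra.
  rewrite lerD2l [leRHS]mulrAC -exprMn ler_wpM2r//.
  rewrite -[leLHS]real_normK ?num_real// -[leRHS]real_normK ?num_real//.
  rewrite ler_sqr ?nnegrE// !normrM !normfV (gtr0_norm (a0 i)) (gtr0_norm ay) (gtr0_norm N0).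
  rewrite [leRHS]mulrCA ler_wpM2l//.
  by rewrite ler_pdivlMr// mulrC ler_pdivrMr.
rewrite big_split/= -mulr_suml -/S -mulr_sumr mulrDl lerD2l ler_piMr ?divr_ge0 ?sqr_ge0//.
exact: p1 (CU _ Cy).
Qed.

End mollified_flux.

(** * Submodularity *)

Section lattice.
Context {R : realType} {n : nat}.
Variable alpha : 'I_n -> R.
Hypothesis Gamma_gt0 : forall i, 0 < Gamma (alpha i + 1).
Variable U : set 'rV[R]_n.
Hypothesis oU : open U.
Hypothesis Uorthant : U `<=` orthant.
Implicit Types (x y : 'rV[R]_n) (v f : 'rV[R]_n -> R) (h : lebesgue_type R n -> R).
Implicit Types (g k p : 'I_n -> 'rV[R]_n -> R) (dg dk dp : 'I_n -> 'I_n -> 'rV[R]_n -> R).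

Let L := lebesgue_rV R n.
Let mu := mu_ alpha.

Definition ndiv dg x : R := - \sum_(i < n) dg i i x.

(** That is, [c] bounds the total variation of [h] on [U]. *)
Definition flux_bound (h : lebesgue_type R n -> R) c := forall g dg, flux alpha U g dg ->
  dot mu h (flux_div alpha dg) <= c.

Lemma flux_bound_ge0 h c : flux_bound h c -> 0 <= c.
Proof.
move/(_ _ _ (flux0 alpha U)); rewrite /dot (@eq_Rintegral _ _ _ mu _ (cst 0)).
  by rewrite (Rintegral_cst mu measurableT 0) mul0r.
by move=> x _; rewrite !fctE /flux_div big1 ?oppr0 ?mul0r ?mulr0.
Qed.

(** The weight is bounded below by a positive constant on a compact part of the orthant. *)
Lemma lintg_compact (C : set 'rV[R]_n) h : compact C -> C `<=` orthant ->
  intg mu h -> lintg (h * \1_C).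
Proof.
move=> cC Co Ih; have mh := intg_measurable Ih.
have [c c0 wc] := weight_lb Gamma_gt0 cC Co.
have Ihw : lintg (h * weight alpha).
  exact/(intg_density (measurable_weight alpha) (@weight_ge0 _ _ alpha) (@mu_weight _ _ alpha) mh).
apply: (@le_intg _ (lebesgue_type R n) R L _ (fun x => c^-1 * `|(h * weight alpha) x|)).
- apply: measurable_funM; first exact: mh.
  apply/measurable_indic/borel_lebesgue_measurable.
  rewrite -[C]setCK; apply: measurableC; apply: open_measurable_rV.
  by apply: closed_openC; apply: compact_closed => //; exact: norm_hausdorff.
- move=> x; rewrite !fctE indicE normrM normrM (ger0_norm (weight_ge0 alpha x)) mulrCA.
  apply: ler_wpM2l => //; have [Cx|Cx] := pselect (C x).
    by rewrite mem_set// normr1 ler_pdivlMl// mulr1 wc.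
  by rewrite memNset// normr0 mulr_ge0 ?invr_ge0 ?(ltW c0)// weight_ge0.
- apply: (@intgZ _ _ _ L c^-1 (fun x => `|(h * weight alpha) x|)).
  exact: (@intg_abs _ _ _ L _ Ihw).
Qed.

Lemma cc_ndiv g dg : flux alpha U g dg -> cc (ndiv dg).
Proof.
move=> fg; have [cs [M M0 sM]] := cc_div fg; split; first exact: continuous_opp.
by exists M => // x i /sM; rewrite /ndiv => ->; rewrite oppr0.
Qed.

Lemma dot_compact (C : set 'rV[R]_n) h g dg : flux alpha U g dg ->
  (forall i x, ~ C x -> dg i i x = 0) -> measurable_fun [set: lebesgue_type R n] h ->
  dot mu h (flux_div alpha dg) = \int[L]_x ((h * \1_C) x * ndiv dg x).
Proof.
move=> fg gC mh; rewrite (dot_flux_div Gamma_gt0 Uorthant fg mh).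
apply: (@eq_Rintegral _ _ _ L) => x _; rewrite fctE indicE.
have [Cx|Cx] := pselect (C x); first by rewrite mem_set// mulr1.
by rewrite /ndiv big1 ?oppr0 ?mulr0// => i _; exact: gC.
Qed.

(** [convol_sym] passes the convolution from [h] to the field, and the mollified field divided by
    [1 + t] is again a flux. So mollifying [h] raises its total variation, tested by fields
    supported in [C], by a factor of at most [1 + t]. *)
Lemma mollified_bound (C C' : set 'rV[R]_n) r0 t : compact C -> C `<=` U ->
  compact C' -> C' `<=` U -> 0 < r0 -> (forall x y, C x -> `|x - y| < r0 -> C' y) -> 0 < t ->
  exists2 r, 0 < r & forall e, 0 < e -> e < r -> forall p dp, flux alpha U p dp ->
    (forall i x, ~ C x -> p i x = 0) ->
    forall h c, intg mu h -> flux_bound h c ->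
    \int[L]_x (convol (ker e) (h * \1_C') x * ndiv dp x) <= (1 + t) * c.
Proof.
move=> cC CU cC' C'U r00 CC' t0.
have [r1 r10 fr] := convol_ker_flux Gamma_gt0 Uorthant cC CU cC' C'U r00 CC' t0.
exists (Num.min r0 r1); first by rewrite lt_min r00.
move=> e e0; rewrite lt_min => /andP[er0 er1] p dp fp pC h c Ih hc.
have t1 : 0 < 1 + t by rewrite ltr_wpDl.
have kk := cc_ker (n := n) e0.
have Iv : lintg (h * \1_C') by apply: lintg_compact => //; exact: subset_trans C'U Uorthant.
have fq := fr e e0 er1 p dp fp pC.
have dpC i x : ~ C x -> dp i i x = 0.
  have clC : closed C by apply: compact_closed => //; exact: norm_hausdorff.
  by have [Cp _ _] := fp; exact: (C1_eq0 clC (Cp i) (pC i)).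
have dpL i : lintg (dp i i) by apply: cc_intg; have [_] := flux_cc fp i; exact.
have := hc _ _ fq; rewrite (dot_compact (C := C') fq); last 2 first.
- by move=> i x C'x; rewrite (convol_ker_supp CC' e0 (ltW er0) (dpC i))// mul0r.
- exact: intg_measurable Ih.
have ndE x : ndiv (fun i j x => convol (ker e) (dp i j) x / (1 + t)) x =
    (1 + t)^-1 * convol (ker e) (ndiv dp) x.
  have [_ E] := convol_sum (index_enum 'I_n) (fun _ => -1) x kk dpL.
  rewrite /ndiv -mulr_suml -mulNr mulrC; congr (_ * _).
  rewrite (_ : (fun x => - \sum_(i < n) dp i i x) = (fun y => \sum_(i < n) (-1) * dp i i y)); last first.
    by apply/funext => y; rewrite -mulr_sumr mulN1r.
  by rewrite E -mulr_sumr mulN1r.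
rewrite (@eq_Rintegral _ _ _ L _ (fun x => (1 + t)^-1 *
    ((h * \1_C') x * convol (ker e) (ndiv dp) x))); last first.
  by move=> x _; rewrite ndE mulrCA.
have cnd := cc_ndiv fp; have Ind := cc_intg cnd.
rewrite RintegralZl//; last first.
  have cq := cc_ndiv fq; have [b _ qb] := cc_bounded cq.
  apply: (@intg_bdM _ _ _ L (h * \1_C') (convol (ker e) (ndiv dp)) ((1 + t) * b)); last exact: Iv.
    by apply: measurable_lebesgue; exact: continuous_convol.
  move=> x; have := qb x; rewrite ndE normrM gtr0_norm ?invr_gt0//.
  by rewrite ler_pdivrMl.
rewrite -(convol_sym kk (@kerN _ _ e) Iv Ind).
by rewrite ler_pdivrMl.
Qed.

(** The integrand is the partial derivative of [(w * eta(w) - ramp(w)) * xi]: since [eta] is the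
    derivative of [ramp], the two terms in [eta(w) * dw] cancel. *)
Lemma Int_ramp_partial (C : set 'rV[R]_n) (w xi : 'rV[R]_n -> R) dw dxi j : compact C ->
  C1 w dw -> C1 xi dxi -> (forall x, ~ C x -> xi x = 0) ->
  let f x := w x * (eta (w x) * dxi j x + xi x * (deta (w x) * dw j x)) - ramp (w x) * dxi j x in
  lintg f /\ \int[L]_x f x = 0.
Proof.
move=> cC Cw Cxi xi0 f.
have ceta : continuous (@eta R).
  by move=> s; apply: differentiable_continuous; apply/derivable1_diffP; case: (is_derive_eta s).
have Cf := C1M (C1B (C1M Cw (C1_comp continuous_deta (@is_derive_eta R) Cw))
  (C1_comp ceta (@is_derive_ramp R) Cw)) Cxi.
have f0 x : ~ C x -> (w x * eta (w x) - ramp (w x)) * xi x = 0 by move=> /xi0 ->; rewrite mulr0.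
rewrite (_ : f = (fun x => (w x * eta (w x) - ramp (w x)) * dxi j x + xi x *
    (w x * (deta (w x) * dw j x) + eta (w x) * dw j x - eta (w x) * dw j x))); last first.
  by apply/funext => x; rewrite /f; ring.
split; last exact: (Int_partial_eq0 j cC Cf f0).
by apply: cc_intg; have [_] := C1_cc cC Cf f0; exact.
Qed.

Lemma lintg_cc v f : lintg v -> cc f -> lintg (v * f).
Proof.
move=> Iv cf; have [c _ fc] := cc_bounded cf.
apply: (@intg_bdM _ _ _ L v f c); [|exact: fc|exact: Iv].
by apply: measurable_lebesgue; case: cf.
Qed.

Lemma measurable_ramp : measurable_fun [set: R] (@ramp R).
Proof. by apply: continuous_measurable_fun; exact: continuous_ramp. Qed.

Lemma lintg_ramp v : lintg v -> lintg (ramp \o v).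
Proof.
move=> Iv; apply: (@le_intg _ (lebesgue_type R n) R L _ (fun x => `|v x|)).
- by apply: (measurableT_comp measurable_ramp); exact: (@intg_measurable _ _ _ L).
- by move=> x; exact: ramp_le.
- exact: (@intg_abs _ _ _ L).
Qed.

Lemma L2_ramp h : L2 mu h -> L2 mu (ramp \o h).
Proof.
move=> [mh Ih]; have mHh : measurable_fun [set: lebesgue_type R n] (ramp \o h).
  exact: (measurableT_comp measurable_ramp).
split; first exact: mHh.
apply: (@le_intg _ (lebesgue_type R n) R mu _ (h * h)); last exact: Ih.
  exact: (measurable_funM mHh mHh).
move=> x; rewrite -[leLHS]/(`|ramp (h x) * ramp (h x)|) -[leRHS]/(h x * h x) normrM.
rewrite (le_trans (ler_pM (normr_ge0 _) (normr_ge0 _) (ramp_le _) (ramp_le _)))//.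
by rewrite -normrM ger0_norm// -expr2 sqr_ge0.
Qed.

Lemma C1_kerE v e : 0 < e -> lintg v -> C1 (convol (ker e) v) (fun j => convol (dker e j) v).
Proof.
by move=> e0 Iv; apply: C1_convol => //; [exact: C1_ker|exact: cc_ker|move=> i; exact: cc_dker].
Qed.

Lemma moll_compact (C : set 'rV[R]_n) v : compact C -> lintg v ->
  (forall x, ~ C x -> v x = 0) -> moll v.
Proof.
move=> cC Iv v0; have [M M0 CM] := compact_box_supp cC.
apply: (moll_supp M0) => // x /existsNP[i /negP]; rewrite -leNgt [X in _ - X]mxE subr0.
by move/CM => /v0.
Qed.

(* The test fields [g + eta(w) (k - g)] and [k + eta(w) (g - k)], with [w] the
   mollification of [h1 - h2], are compared with [g] and [k]. *)
Lemma flux_lattice h1 h2 c1 c2 g dg k dk : L2 mu h1 -> L2 mu h2 ->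
  flux_bound h1 c1 -> flux_bound h2 c2 -> flux alpha U g dg -> flux alpha U k dk ->
  dot mu h1 (flux_div alpha dg) + dot mu h2 (flux_div alpha dk) +
  dot mu (ramp \o (h1 - h2)) (flux_div alpha dk - flux_div alpha dg) <= c1 + c2.
Proof.
move=> L1 L2' hc1 hc2 fg fk.
have mu_fin : (mu setT < +oo)%E by exact: mu_lty.
have Ih1 : intg mu h1 := L2_intg mu_fin L1.
have Ih2 : intg mu h2 := L2_intg mu_fin L2'.
have c10 := flux_bound_ge0 hc1; have c20 := flux_bound_ge0 hc2.
have [C [cC CU gC kC]] : exists C, [/\ compact C, C `<=` U,
    forall i x, ~ C x -> g i x = 0 & forall i x, ~ C x -> k i x = 0].
  have [_ [C1 [cC1 C1U g0]] _] := fg; have [_ [C2 [cC2 C2U k0]] _] := fk.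
  exists (C1 `|` C2); split; [exact: compactU|by rewrite subUset| |].
    by move=> i x /not_orP[/(g0 i)].
  by move=> i x /not_orP[_ /(k0 i)].
have [C' [r0 [cC' C'U r00 CC']]] := compact_nbhd cC oU CU.
have CC'sub : C `<=` C' by move=> x Cx; apply: CC' Cx _; rewrite subrr normr0.
have clC : closed C by apply: compact_closed => //; exact: norm_hausdorff.
have [Cg _ _] := fg; have [Ck _ _] := fk.
have dgC i x : ~ C' x -> dg i i x = 0.
  by move=> C'x; apply: (C1_eq0 clC (Cg i) (gC i)) => /CC'sub.
have dkC i x : ~ C' x -> dk i i x = 0.
  by move=> C'x; apply: (C1_eq0 clC (Ck i) (kC i)) => /CC'sub.
pose v1 := h1 * \1_C'; pose v2 := h2 * \1_C'.
have C'o := subset_trans C'U Uorthant.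
have Iv1 : lintg v1 by exact: lintg_compact.
have Iv2 : lintg v2 by exact: lintg_compact.
pose A := ndiv dg; pose B := ndiv dk.
have cA : cc A := cc_ndiv fg; have cB : cc B := cc_ndiv fk.
have cBA : cc (B - A).
  have [cAc [M1 M10 A0]] := cA; have [cBc [M2 M20 B0]] := cB.
  split; first exact: continuous_sub.
  exists (Num.max M1 M2); first by rewrite lt_max M10.
  by move=> x i; rewrite ge_max => /andP[/A0 Ax /B0 Bx]; rewrite !fctE Ax Bx subrr.
have mh1 := intg_measurable Ih1; have mh2 := intg_measurable Ih2.
have LH : L2 mu (ramp \o (h1 - h2)) by apply: L2_ramp; exact: L2B.
have mHh := LH.1.
have Lzg : L2 mu (flux_div alpha dg) by exact: flux_div_L2 fg.
have Lzk : L2 mu (flux_div alpha dk) by exact: flux_div_L2 fk.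
(* Cutting off to [C'] commutes with [ramp], because [ramp 0 = 0]. *)
have HE : (ramp \o (h1 - h2)) * \1_C' = ramp \o (v1 - v2).
  apply/funext => x; rewrite /v1 /v2 !fctE indicE; case: (_ \in _) => /=; first by rewrite !mulr1.
  by rewrite !mulr0 subrr ramp_npos.
rewrite dotBr// !(dot_compact (C := C') fg)// !(dot_compact (C := C') fk)// HE -/v1 -/v2 -/A -/B.
pose F0 := v1 * A + v2 * B + (ramp \o (v1 - v2)) * (B - A).
have IH0 : lintg (ramp \o (v1 - v2)) by apply: lintg_ramp; exact: intgB.
have -> : \int[L]_x (v1 x * A x) + \int[L]_x (v2 x * B x) +
    (\int[L]_x ((ramp \o (v1 - v2)) x * B x) - \int[L]_x ((ramp \o (v1 - v2)) x * A x)) = \int[L]_x F0 x.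
  rewrite /F0 IntD; [|by apply: intgD; exact: lintg_cc|exact: lintg_cc].
  rewrite IntD; [|exact: lintg_cc|exact: lintg_cc].
  by rewrite mulrBr IntB//; exact: lintg_cc.
have [M M0 [AM BM]] : exists2 M, 0 <= M & (forall x, `|A x| <= M) /\ (forall x, `|B x| <= M).
  have [b1 b10 Ab] := cc_bounded cA; have [b2 b20 Bb] := cc_bounded cB.
  exists (Num.max b1 b2); first by rewrite le_max b10.
  by split=> x; rewrite le_max ?Ab ?Bb ?orbT.
apply/ler_addgt0Pr => ep ep0.
(* Half of [ep] pays for the factor [1 + t], the other half for the L1 error [de] of the
   mollifications; the added 1 keeps the denominators positive. *)
pose t := ep / 2 / (c1 + c2 + 1).
have t0 : 0 < t by rewrite !divr_gt0// ltr_wpDl// addr_ge0.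
pose de := ep / 2 / (6 * M + 1).
have de0 : 0 < de by rewrite !divr_gt0// ltr_wpDl// mulr_ge0.
have [r1 r10 mb] := mollified_bound cC CU cC' C'U r00 CC' t0.
have v10 x : ~ C' x -> v1 x = 0 by move=> C'x; rewrite /v1 fctE indicE memNset// mulr0.
have v20 x : ~ C' x -> v2 x = 0 by move=> C'x; rewrite /v2 fctE indicE memNset// mulr0.
have [_ /(_ _ de0)[r2 r20 m1]] := moll_compact cC' Iv1 v10.
have [_ /(_ _ de0)[r3 r30 m2]] := moll_compact cC' Iv2 v20.
pose e := Num.min r1 (Num.min r2 r3) / 2.
have rm0 : 0 < Num.min r1 (Num.min r2 r3) by rewrite !lt_min r10 r20.
have e0 : 0 < e by rewrite divr_gt0.
have : e < Num.min r1 (Num.min r2 r3) by rewrite gtr_pMr// invf_lt1 ?ltr1n.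
rewrite !lt_min => /and3P[er1 /(m1 _ e0) {}m1 /(m2 _ e0) {}m2].
pose V1 := convol (ker e) v1; pose V2 := convol (ker e) v2.
have IV1 : lintg V1 by exact: lintg_convol_ker.
have IV2 : lintg V2 by exact: lintg_convol_ker.
have Cw := C1B (C1_kerE e0 Iv1) (C1_kerE e0 Iv2).
pose w x := V1 x - V2 x.
pose dw (j : 'I_n) x := convol (dker e j) v1 x - convol (dker e j) v2 x.
have Ct : C1 (fun x => eta (w x)) (fun j x => deta (w x) * dw j x).
  exact: (C1_comp continuous_deta (@is_derive_eta R) Cw).
have t01 x : 0 <= eta (w x) <= 1 by exact: eta_itv.
have fp := flux_conv Ct t01 fg fk; have fq := flux_conv Ct t01 fk fg.
have pC i x : ~ C x -> g i x + eta (w x) * (k i x - g i x) = 0.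
  by move=> Cx; rewrite gC// kC// subrr mulr0 addr0.
have qC i x : ~ C x -> k i x + eta (w x) * (g i x - k i x) = 0.
  by move=> Cx; rewrite gC// kC// subrr mulr0 addr0.
have := mb e e0 er1 _ _ fp pC h1 c1 Ih1 hc1; have := mb e e0 er1 _ _ fq qC h2 c2 Ih2 hc2.
rewrite -/v1 -/v2 -/V1 -/V2.
have := cc_ndiv fp; have := cc_ndiv fq.
set Q := ndiv _; set P := ndiv _ => cQ cP b2 b1.
have xi0 i x : ~ C x -> k i x - g i x = 0 by move=> Cx; rewrite gC// kC// subrr.
have [] := Int_sum_eq0 (index_enum 'I_n)
  (fun i => Int_ramp_partial i cC Cw (C1B (Ck i) (Cg i)) (xi0 i)).
set Z := fun x => _; rewrite -[lebesgue_rV R n]/L => IZ EZ.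
pose Fe := V1 * A + V2 * B + (ramp \o w) * (B - A).
(* The exchange moves [s] between the two divergences: [P = A - s] and [Q = B + s]. So
   [V1 * P + V2 * Q] loses [w * s], and adding [Z], whose integral is 0, turns this loss into
   [ramp w * (B - A)]. *)
have FeE x : Fe x = (V1 * P + V2 * Q + Z) x.
  pose s x := \sum_(i < n) (eta (w x) * (dk i i x - dg i i x) + (k i x - g i x) * (deta (w x) * dw i x)).
  have PE : P x = A x - s x by rewrite /P /ndiv big_split/= opprD.
  have QE : Q x = B x + s x.
    rewrite /Q /ndiv big_split/= opprD; congr (_ + _); rewrite -sumrN; apply: eq_bigr => i _; ring.
  have ZE : Z x = w x * s x - ramp (w x) * (A x - B x).
    rewrite /Z sumrB -!mulr_sumr; congr (_ * _ - _ * _).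
    by rewrite sumrB /A /B /ndiv opprK addrC.
  by rewrite /Fe !fctE PE QE ZE /= /w; ring.
have Iw : lintg (ramp \o w) by apply: lintg_ramp; exact: intgB.
have IFe : lintg Fe.
  by apply: intgD; [apply: intgD|]; exact: lintg_cc.
have IF0 : lintg F0.
  by apply: intgD; [apply: intgD|]; exact: lintg_cc.
have Feb : \int[L]_x Fe x <= (1 + t) * c1 + (1 + t) * c2.
  rewrite (@eq_Rintegral _ _ _ L _ _ _ (fun x _ => FeE x)).
  rewrite IntD//; last by apply: intgD; exact: lintg_cc.
  rewrite IntD; [|exact: lintg_cc|exact: lintg_cc].
  by rewrite EZ addr0 lerD.
have I1 : lintg (fun x => `|V1 x - v1 x|) by apply: (@intg_abs _ _ _ L (V1 - v1)); exact: intgB.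
have I2 : lintg (fun x => `|V2 x - v2 x|) by apply: (@intg_abs _ _ _ L (V2 - v2)); exact: intgB.
(* Each mollification error is multiplied by at most [M] in the linear terms and by [2 * M] through
   the 1-Lipschitz [ramp]; hence [3 * M]. *)
have diff : \int[L]_x F0 x - \int[L]_x Fe x <= 3 * M * de + 3 * M * de.
  rewrite -IntB//.
  apply: (@le_trans _ _ (\int[L]_x ((3 * M) *: (fun x => `|V1 x - v1 x|) + (3 * M) *: (fun x => `|V2 x - v2 x|)) x)).
    apply: le_Int; first exact: intgB.
      by apply: intgD; apply: intgZ.
    move=> x; rewrite -[leLHS]/((v1 x * A x + v2 x * B x + ramp (v1 x - v2 x) * (B x - A x)) -
        (V1 x * A x + V2 x * B x + ramp (w x) * (B x - A x))).
    rewrite -[leRHS]/(3 * M * `|V1 x - v1 x| + 3 * M * `|V2 x - v2 x|).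
    have Hw : `|ramp (v1 x - v2 x) - ramp (w x)| <= `|V1 x - v1 x| + `|V2 x - v2 x|.
      apply: (le_trans (ramp_lipschitz _ _)); rewrite /w.
      rewrite (_ : _ - _ = (V2 x - v2 x) - (V1 x - v1 x)); last by ring.
      by rewrite (le_trans (ler_normB _ _))// addrC.
    rewrite (_ : _ - _ = - ((V1 x - v1 x) * A x) - (V2 x - v2 x) * B x +
      (ramp (v1 x - v2 x) - ramp (w x)) * (B x - A x)); last by ring.
    apply: (le_trans (ler_norm _)).
    apply: (@le_trans _ _ (`|V1 x - v1 x| * M + `|V2 x - v2 x| * M +
       (`|V1 x - v1 x| + `|V2 x - v2 x|) * (M + M))); last by lra.
    apply: (le_trans (ler_normD _ _)); apply: lerD.
      apply: (le_trans (ler_normB _ _)); rewrite normrN !normrM.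
      by apply: lerD; apply: ler_wpM2l.
    rewrite normrM; apply: ler_pM => //.
    by rewrite (le_trans (ler_normB _ _))// lerD.
  rewrite IntD; [|exact: intgZ|exact: intgZ].
  by rewrite !IntZ// lerD// ler_wpM2l// mulr_ge0.
have tb : t * (c1 + c2) <= ep / 2.
  rewrite /t -mulrA ler_piMr ?divr_ge0 ?(ltW ep0)// mulrC ler_pdivrMr ?mul1r ?ltr_wpDl ?addr_ge0//.
  by rewrite lerDl.
have db : 6 * M * de <= ep / 2.
  rewrite (_ : _ * de = ep / 2 * (6 * M / (6 * M + 1))); last by rewrite /de; ring.
  rewrite ler_piMr ?divr_ge0 ?(ltW ep0)// ler_pdivrMr ?mul1r ?ltr_wpDl ?mulr_ge0//.
  by rewrite lerDl.
lra.
Qed.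

End lattice.

(** * Perimeters *)

Lemma open_orthant (R : realType) n : open (@orthant R n).
Proof.
rewrite openE => x xo.
suff : nbhs x [set y : 'rV[R]_n | forall i, 0 < y ord0 i] by [].
apply: (@filter_forall _ _ (fun (i : 'I_n) (y : 'rV[R]_n) => 0 < y ord0 i) (nbhs x)) => i.
have /cvgr_gt/(_ _ (xo i)) := @coord_continuous R 1 n ord0 i x; exact.
Qed.

Section degenerate.
Context {R : realType} {n : nat}.
Variable alpha : 'I_n -> R.

(* [Gamma] takes the junk value 0 if its integral diverges; division by 0 then
   makes [omega] vanish identically. *)
Lemma integral_mu_eq0 i (D : set (lebesgue_type R n)) (f : lebesgue_type R n -> \bar R) :
  Gamma (alpha i + 1) = 0 -> (\int[mu_ alpha]_(x in D) f x = 0)%E.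
Proof.
move=> G0; rewrite (eq_measure_integral mzero) ?integral_measure_zero// => A mA _.
suff : mu_ alpha A = 0%E by [].
apply: integral0_eq => x _.
by rewrite /omega (bigD1 i)//= G0 invr0 mulr0 mul0r.
Qed.

End degenerate.

Section perimeter_flux.
Context {R : realType} {n : nat}.
Variable alpha : 'I_n -> R.
Hypothesis Gamma_gt0 : forall i, 0 < Gamma (alpha i + 1).

Let mu := mu_ alpha.

Lemma integral_dot (F : set (lebesgue_type R n)) f : measurable F -> intg mu f ->
  (\int[mu]_(x in F) (f x)%:E = (dot mu \1_F f)%:E)%E.
Proof.
move=> mF If; have IF : mu.-integrable F (EFin \o f) by exact: integrableS If.
rewrite -(fineK (integrable_fin_num mF IF)); congr EFin.
have := Rintegral_indic mu f F; rewrite /Rintegral => ->.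
by rewrite dotC.
Qed.

(** A flux on [U] vanishes off a compact part of [U], where the norm constraint is trivial. *)
Lemma flux_orthant (U : set 'rV[R]_n) g dg : U `<=` orthant ->
  flux alpha U g dg -> flux alpha orthant g dg.
Proof.
move=> Uo [Cg [C [cC CU g0]] g1]; split => //.
  by exists C; split => //; exact: subset_trans CU Uo.
move=> x xo; have [/CU/g1//|Cx] := pselect (C x).
by rewrite big1// => i _; rewrite g0// mul0r expr0n.
Qed.

Variable U : set 'rV[R]_n.
Hypothesis oU : open U.
Hypothesis Uorthant : U `<=` orthant.

Lemma dot_flux_perimeter (F : set (lebesgue_type R n)) g dg : measurable F ->
  flux alpha U g dg -> ((dot mu \1_F (flux_div alpha dg))%:E <= perimeter alpha F U)%E.
Proof.
move=> mF fg; have Lz := flux_div_L2 Gamma_gt0 Uorthant fg.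
rewrite -integral_dot//; last exact: (L2_intg (mu_lty alpha) Lz).
apply: ereal_sup_ubound.
have [phi tphi <-] := flux_test_fields Gamma_gt0 oU Uorthant fg.
by exists phi.
Qed.

(** Together with [dot_flux_perimeter], it identifies the perimeter with a supremum over fluxes. *)
Lemma perimeter_flux_le (F : set (lebesgue_type R n)) (c : \bar R) : measurable F ->
  (forall g dg, flux alpha U g dg -> ((dot mu \1_F (flux_div alpha dg))%:E <= c)%E) ->
  (perimeter alpha F U <= c)%E.
Proof.
move=> mF Fc; apply: ub_ereal_sup => _ [phi tphi <-].
have [g [dg [fg ->]]] := test_fields_flux Gamma_gt0 oU Uorthant tphi.
rewrite integral_dot//; first exact: Fc fg.
exact: (L2_intg (mu_lty alpha) (flux_div_L2 Gamma_gt0 Uorthant fg)).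
Qed.

Lemma perimeter_ge0 (F : set (lebesgue_type R n)) : measurable F ->
  (0 <= perimeter alpha F U)%E.
Proof.
move=> mF; apply: le_trans (dot_flux_perimeter mF (flux0 alpha U)).
rewrite lee_fin /dot (@eq_Rintegral _ _ _ mu _ (cst 0)).
  by rewrite (Rintegral_cst mu measurableT 0) mul0r.
by move=> x _; rewrite !fctE /flux_div big1 ?oppr0 ?mul0r ?mulr0.
Qed.

End perimeter_flux.

Lemma perimeter_orthant (R : realType) n (alpha : 'I_n -> R) (U : set 'rV[R]_n)
    (F : set (lebesgue_type R n)) : (forall i, 0 < Gamma (alpha i + 1)) ->
  open U -> U `<=` orthant -> measurable F ->
  (perimeter alpha F U <= perimeter alpha F orthant)%E.
Proof.
move=> G0 oU Uo mF; apply: perimeter_flux_le => // g dg /(flux_orthant Uo) fg.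
exact: (dot_flux_perimeter G0 (@open_orthant R n) (@subset_refl _ _) mF fg).
Qed.

Theorem theorem3p1 (R : realType) (d : nat) (alpha : 'I_d -> R)
    (Omega : set 'rV[R]_d) :
  (3 <= d)%N ->
  (forall i, -1 < alpha i) ->
  open Omega ->
  Omega `<=` orthant ->
  open (Omega1 Omega) ->
  forall E : set 'rV[R]_d, finite_perimeter alpha E orthant ->
  exists2 u : 'rV[R]_d -> R,
    (mu_ alpha).-integrable orthant (EFin \o u) &
    forall F : set 'rV[R]_d, finite_perimeter alpha F (Omega1 Omega) ->
      (massari alpha Omega u E <= massari alpha Omega u F)%E.
Proof.
move=> _ _ _ Oo oU E [mE Eo Efin].
have Uo : Omega1 Omega `<=` orthant by move=> x [/Oo].
have [Gneq0|/existsNP[i /negP]] := pselect (forall i, Gamma (alpha i + 1) != 0); last first.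
  rewrite negbK => /eqP G0.
  (* All integrals against [mu_ alpha] vanish, so the two functionals for [u = 0] are suprema of
     zeros over the same test fields. *)
  have I0 := integral_mu_eq0 _ _ G0.
  exists (cst 0) => [|F _]; first exact: integrable0.
  rewrite /massari !I0 !adde0.
  apply: ub_ereal_sup => _ [phi tphi <-]; rewrite I0.
  by apply: ereal_sup_ubound; exists phi; rewrite ?I0.
have G0 i : 0 < Gamma (alpha i + 1) by rewrite lt_neqAle eq_sym Gneq0 Gamma_ge0.
pose U := Omega1 Omega.
pose K := [set z | exists g dg, flux alpha U g dg /\ z = flux_div alpha dg].
have finP F : measurable (F : set (lebesgue_type R d)) -> (perimeter alpha F U < +oo)%E ->
    perimeter alpha F U = (fine (perimeter alpha F U))%:E.
  by move=> mF Foo; rewrite fineK// ge0_fin_numE// perimeter_ge0.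
(* [E] has finite perimeter in the orthant and need not lie in [U]; what is used of it is its
   perimeter in [U], a supremum over fewer fields. *)
have Eoo : (perimeter alpha E U < +oo)%E.
  by apply: le_lt_trans Efin; exact: perimeter_orthant.
have bK F : measurable (F : set (lebesgue_type R d)) -> (perimeter alpha F U < +oo)%E ->
    forall z, K z -> dot (mu_ alpha) \1_F z <= fine (perimeter alpha F U).
  move=> mF Foo z [g [dg [fg ->]]]; rewrite -lee_fin -finP//.
  exact: (dot_flux_perimeter G0 oU Uo mF fg).
have KL2 z : K z -> L2 (mu_ alpha) z by move=> [g [dg [fg ->]]]; exact: flux_div_L2 fg.
have K0 : K 0.
  exists (fun _ _ => 0), (fun _ _ _ => 0); split; first exact: flux0.
  by apply/funext => x; rewrite /flux_div big1 ?oppr0 ?mul0r.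
have Kconv z1 z2 (t : R) : K z1 -> K z2 -> 0 <= t <= 1 -> K ((1 - t) *: z1 + t *: z2).
  move=> [g [dg [fg ->]]] [k [dk [fk ->]]] t01.
  (* With a constant weight, [flux_conv] is ordinary convexity. *)
  have fgk := flux_conv (C1_cst t) (fun=> t01) fg fk.
  eexists; eexists; split; first exact: fgk.
  apply/funext => x; rewrite !fctE /GRing.scale/= /flux_div.
  rewrite !mulrA -!mulrDl; congr (_ / _); rewrite !mulrN -opprD; congr (- _).
  rewrite !mulr_sumr -big_split/=; apply: eq_bigr => i _; ring.
have Kint z : K z -> dot (mu_ alpha) (cst 1) z = 0.
  by move=> [g [dg [fg ->]]]; exact: Int_flux_div fg.
have Klat h1 h2 c1 c2 : L2 (mu_ alpha) h1 -> L2 (mu_ alpha) h2 ->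
    (forall z, K z -> dot (mu_ alpha) h1 z <= c1) ->
    (forall z, K z -> dot (mu_ alpha) h2 z <= c2) ->
    forall z1 z2, K z1 -> K z2 -> dot (mu_ alpha) h1 z1 + dot (mu_ alpha) h2 z2 +
      dot (mu_ alpha) (ramp \o (h1 - h2)) (z2 - z1) <= c1 + c2.
  move=> Lh1 Lh2 b1 b2 _ _ [g [dg [fg ->]]] [k [dk [fk ->]]].
  apply: flux_lattice fg fk => // p dp fp; [apply: b1|apply: b2]; by exists p, dp.
have [s [Is sF sE]] := calibration (mu_lty alpha) KL2 K0 Kconv Kint (@measurable_ramp R)
  (@ramp_ge0 R) (@ramp_gt0 R) (@ramp_npos R) (@ramp_le R) Klat mE (bK _ mE Eoo).
have Iu : intg (mu_ alpha) (- s) by exact: intgN.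
have uE F : measurable (F : set (lebesgue_type R d)) ->
    (\int[mu_ alpha]_(x in F) ((- s) x)%:E = (- dot (mu_ alpha) \1_F s)%:E)%E.
  move=> mF; rewrite integral_dot//; congr EFin.
  rewrite /dot mulrN -scaleN1r IntZ ?mulN1r//.
  by rewrite mulrC; exact: intg_indic.
exists (- s) => [|F [mF _ Foo]].
  by apply: integrableS Iu => //; exact: measurable_orthant.
rewrite /massari !uE// -/U finP// [in leRHS]finP// -!EFinD lee_fin.
apply: (@le_trans _ _ 0).
  rewrite subr_le0 -lee_fin -finP//; apply: perimeter_flux_le => // g dg fg.
  by rewrite lee_fin; apply: sE; exists g, dg.
by rewrite subr_ge0; apply: sF => //; exact: bK.
Qed.
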